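(* Let $p$ be a natural number greater than $1$. Then the canonical extension $\tilde f$ of any $f\in H_b(B_{\ell_p})$ to $M_b^0(B_{\ell_p})$ is of bounded type.
   Context: $\ell_p$ is the complex sequence space and $B_{\ell_p}$ its open unit ball. $H_b(B_{\ell_p})$ is the Fréchet algebra of holomorphic functions on $B_{\ell_p}$ bounded on each $sB_{\ell_p}$, $0<s<1$, with uniform convergence on these sets. $M_b(B_{\ell_p})$ is the set of nonzero continuous linear multiplicative functionals on $H_b(B_{\ell_p})$; $\varphi\prec A$ means $|\varphi(f)|\le\sup_A|f|$ for all $f\in H_b(B_{\ell_p})$. The map $\pi:M_b(B_{\ell_p})\to\ell_p''=\ell_p$ is $\pi(\varphi)=\varphi|_{\ell_p'}$. If $\varphi\prec sB_{\ell_p}$, $0<s<1$, and $z\in\ell_p$, $\|z\|<1-s$, then $\varphi^z(f)=\sum_{n=0}^\infty\varphi\big(y\mapsto\frac{d^nf(y)}{n!}(z)\big)$ defines an element of $M_b(B_{\ell_p})$. $M_b(B_{\ell_p})$ carries the Hausdorff topology with basis the sets $\{\varphi^z:\|z\|<\varepsilon\}$, with $\varphi\prec sB_{\ell_p}$ and $0<\varepsilon<1-s$; with it $(M_b(B_{\ell_p}),\pi)$ is a Riemann domain over $\ell_p$ (i.e. $\pi$ is a local homeomorphism). The sheet $S(\varphi)$ of $\varphi$ is the connected component of $M_b(B_{\ell_p})$ containing $\varphi$. For $0<r<1$, $\varphi\in M_b(B_{\ell_p})$ is an $r$-block homomorphism if it is an adherent (cluster) point, for the topology of pointwise convergence on $H_b(B_{\ell_p})$,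 of the sequence of evaluations $(\delta_{x_n})_n$ at the elements of a block basic sequence $(x_n)_n$ with $\|x_n\|=r$ for all $n$; that is, $x_n=\sum_{k\in J_n}\alpha_ke_k$ with $J_n\subset\mathbb N$ finite, $\max J_n<\min J_{n+1}$. $M_b^0(B_{\ell_p})$ is the union of the sheets of all $r$-block homomorphisms over all $0<r<1$; it is an open subset of $M_b(B_{\ell_p})$, hence a Riemann domain $X=M_b^0(B_{\ell_p})$ over $\ell_p$ with projection $\pi$. For $\varphi\in X$, $\mathrm{dist}_X(\varphi)$ is the supremum of the $\rho>0$ such that some neighbourhood of $\varphi$ in $X$ is mapped homeomorphically by $\pi$ onto $B(\pi(\varphi),\rho)$; $A\subset X$ is $X$-bounded if $\pi(A)$ is bounded and $\inf_A\mathrm{dist}_X>0$; a holomorphic function on $X$ is of bounded type if it is bounded on every $X$-bounded set. The canonical extension of $f$ is $\tilde f(\varphi)=\varphi(f)$. *)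

(* Defs.v *)
From HB Require Import structures.
From mathcomp Require Import all_boot all_order all_algebra.
From mathcomp Require Import finmap complex.
From mathcomp Require Import all_classical all_reals all_analysis.

Set Implicit Arguments.
Unset Strict Implicit.
Unset Printing Implicit Defensive.

Import Order.TTheory GRing.Theory Num.Theory.
Import numFieldNormedType.Exports.

Local Open Scope classical_set_scope.
Local Open Scope complex_scope.
Local Open Scope ring_scope.

(* [Cx R] is the normed space [C] over the field [C = R[i]]. Norms of normed
   modules over [R[i]] take their values in [R[i]]; [normc] is the modulus
   with values in [R]. *)
Notation Cx R := (R[i]^o).
Notation normc := (@Normc.normc _).

Section lp_norm.
Context {R : realType} (p : nat).
Implicit Types x y : nat -> Cx R.

Definition lpnorm x : \bar R :=
  ((\sum_(0 <= k <oo) (normc (x k) ^+ p)%:E) `^ (p%:R^-1))%E.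

Hypothesis hp : (1 < p)%N.

Let p_ge1 : 1 <= p%:R :> R.
Proof. by rewrite ler1n ltnW. Qed.

Let p_gt0 : 0 < p%:R :> R.
Proof. exact: lt_le_trans p_ge1. Qed.

Lemma normc_ge0 (z : R[i]) : 0 <= normc z.
Proof. by case: z => a b /=; rewrite sqrtr_ge0. Qed.

Lemma normcR (a : R) : 0 <= a -> normc a%:C = a.
Proof. by move=> a0; rewrite /= expr0n/= addr0 sqrtr_sqr ger0_norm. Qed.

Let sum_ge0 x (P : pred nat) :
  (0 <= \sum_(0 <= k <oo | P k) (normc (x k) ^+ p)%:E)%E.
Proof. by apply: nneseries_ge0 => k _ _; rewrite lee_fin exprn_ge0 ?normc_ge0. Qed.

Lemma lpnormE x : lpnorm x = Lnorm counting p%:R%:E (EFin \o (normc \o x)).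
Proof.
rewrite Lnorm_counting// /lpnorm; congr (_ `^ _)%E.
apply: eq_eseriesr => k _ /=.
by rewrite ger0_norm ?normc_ge0// powR_mulrn ?normc_ge0.
Qed.

Lemma lpnorm_ge0 x : (0 <= lpnorm x)%E.
Proof. exact: poweR_ge0. Qed.

Lemma ler_lpnorm x y : (forall k, normc (x k) <= normc (y k)) ->
  (lpnorm x <= lpnorm y)%E.
Proof.
move=> xy; rewrite /lpnorm; apply: gt0_ler_poweR.
- by rewrite invr_ge0 ltW.
- by rewrite in_itv/= leey andbT.
- by rewrite in_itv/= leey andbT.
apply: lee_nneseries => k _; rewrite lee_fin ?exprn_ge0 ?normc_ge0//.
by rewrite lerXn2r// nnegrE normc_ge0.
Qed.

Lemma lpnormD x y : (lpnorm (x + y)%R <= lpnorm x + lpnorm y)%E.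
Proof.
have mf (f : nat -> R) : measurable_fun [set: nat] f by [].
have := @minkowski_EFin _ _ _ counting (normc \o x) (normc \o y) p%:R
  (mf _) (mf _) p_ge1.
rewrite -!lpnormE; apply: le_trans.
have -> : Lnorm counting p%:R%:E (EFin \o ((normc \o x) \+ (normc \o y))%R)
   = lpnorm (fun k => (normc (x k) + normc (y k))%:C).
  by rewrite lpnormE; congr Lnorm; apply/funext => k;
    rewrite /comp normcR// addr_ge0 ?normc_ge0.
apply: ler_lpnorm => k; rewrite normcR ?addr_ge0 ?normc_ge0//.
exact: le_normcD.
Qed.

Lemma lpnormZ a x : lpnorm (a *: x) = ((normc a)%:E * lpnorm x)%E.
Proof.
rewrite /lpnorm.
have -> : (\sum_(0 <= k <oo) (normc ((a *: x) k) ^+ p)%:E =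
   ((normc a) ^+ p)%:E * \sum_(0 <= k <oo) (normc (x k) ^+ p)%:E)%E.
  rewrite -nneseriesZl; last by move=> k _; rewrite lee_fin exprn_ge0 ?normc_ge0.
  by apply: eq_eseriesr => k _; rewrite -EFinM -exprMn -Normc.normcM.
rewrite poweRM//; last by rewrite lee_fin exprn_ge0 ?normc_ge0.
by rewrite poweR_EFin -powR_mulrn ?normc_ge0// -powRrM divff ?gt_eqF// powRr1 ?normc_ge0.
Qed.

Lemma lpnorm0_eq0 x : lpnorm x = 0%E -> x = 0.
Proof.
move=> /poweR_eq0_eq0 x0; apply/funext => k /=; apply: Normc.eq0_normc.
have : ((normc (x k) ^+ p)%:E <= 0)%E.
  rewrite -x0// (@nneseriesD1 _ _ k)//; last first.
    by move=> i _; rewrite lee_fin exprn_ge0 ?normc_ge0.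
  by rewrite leeDl.
rewrite lee_fin => h; apply/eqP.
have : normc (x k) ^+ p == 0 by rewrite eq_le h exprn_ge0 ?normc_ge0.
by rewrite expf_eq0 => /andP[].
Qed.

Lemma lpnorm_delta k : (lpnorm (fun i => (i == k)%:R) < +oo)%E.
Proof.
apply: poweR_lty; rewrite (@nneseriesD1 _ _ k)//; last first.
  by move=> i _; rewrite lee_fin exprn_ge0 ?normc_ge0.
rewrite eseries0 ?adde0 ?ltry// => i _ /= /negPf ->.
by rewrite normcR// expr0n; case: p hp.
Qed.

End lp_norm.

Definition lp_pred (R : realType) (p : nat) (hp : (1 < p)%N) :
  {pred nat -> Cx R} := [pred x | (lpnorm p x < +oo)%E].

(* hp is an index of the type because the triangle inequality, hence the
   normed module structure, needs 1 <= p. *)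
Record ell (R : realType) (p : nat) (hp : (1 < p)%N) :=
  Ell { ell_val :> nat -> Cx R ; _ : ell_val \in @lp_pred R p hp }.

Section ell_normed.
Context {R : realType} {p : nat} (hp : (1 < p)%N).
Local Notation E := (ell R hp).

Lemma lp_pred_submod : submod_closed (@lp_pred R p hp).
Proof.
split.
  rewrite inE (_ : 0 = 0 *: 0); last by rewrite scale0r.
  by rewrite lpnormZ// -[normc 0]/(normc 0%:C) normcR// mul0e.
move=> a x y; rewrite !inE => xoo yoo.
apply: le_lt_trans (lpnormD hp _ _) _.
by rewrite lte_add_pinfty// lpnormZ// lte_mul_pinfty// lee_fin normc_ge0.
Qed.

HB.instance Definition _ := GRing.isSubmodClosed.Build _ _ (@lp_pred R p hp)
  lp_pred_submod.
HB.instance Definition _ := [isSub for @ell_val R p hp].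
HB.instance Definition _ := [Choice of E by <:].
HB.instance Definition _ := [SubChoice_isSubLmodule of E by <:].

Definition ell_norm (x : E) : R[i] := (fine (lpnorm p x))%:C.

Let fin (x : E) : lpnorm p x \is a fin_num.
Proof. by rewrite ge0_fin_numE ?lpnorm_ge0//; case: x. Qed.

Lemma ell_normD x y : ell_norm (x + y) <= ell_norm x + ell_norm y.
Proof.
rewrite /ell_norm -rmorphD lecR -fineD//.
apply: fine_le; rewrite ?fin_numD ?fin//.
exact: lpnormD.
Qed.

Lemma ell_normZ a x : ell_norm (a *: x) = `|a| * ell_norm x.
Proof.
rewrite /ell_norm -[ `|a| ]/(normc a)%:C -rmorphM; congr (_%:C).
by rewrite lpnormZ// fineM//; exact: fin.
Qed.

Lemma ell_norm0_eq0 x : ell_norm x = 0 -> x = 0.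
Proof.
move=> [x0]; apply/val_inj; apply: (@lpnorm0_eq0 R p).
by rewrite -(fineK (fin x)) x0.
Qed.

HB.instance Definition _ := @Lmodule_isNormed.Build R[i] E
  ell_norm ell_normD ell_normZ ell_norm0_eq0.

Definition ell_basis (k : nat) : E :=
  @Ell R p hp (fun i => (i == k)%:R) (lpnorm_delta hp k).

End ell_normed.

Lemma near_differentiable (K : numFieldType) (V W : normedModType K)
    (f g : V -> W) (x : V) :
  (\forall y \near x, f y = g y) -> differentiable f x -> differentiable g x.
Proof.
move=> fg df.
have fgx : f x = g x := nbhs_singleton fg.
have dg : g \o shift x = cst (g x) + 'd f x +o_ 0 id.
  apply/eqaddoP => e e0; have /eqaddoP/(_ e e0) := diff_locally df.
  have : \forall y \near (0 : V), f (y + x) = g (y + x).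
    by move: fg; rewrite (near_shift 0) subr0.
  apply: filterS2 => y /= yfg.
  by rewrite !fctE /= yfg fgx.
apply/diff_locallyP; rewrite (diff_unique _ dg); last exact: diff_continuous.
by split; [exact: diff_continuous | ].
Qed.

Section Hb_def.
Context {R : realType} {p : nat} (hp : (1 < p)%N).
Local Notation E := (ell R hp).
Local Notation B := {x : E | `|x| < 1}.
Implicit Types (f g : B -> Cx R) (s : R).

Definition sball s : set B := [set x | `|val x| < s%:C].

(* Extension by 0 outside the ball: only its germs at points of the open ball
   are used, and these depend on f alone. *)
Definition ext0 f (x : E) : Cx R := if insub x is Some u then f u else 0.

Definition hb_pred : {pred B -> Cx R} := [pred f | `[<
  (forall x : B, differentiable (ext0 f) (val x)) /\
  (forall s, 0 < s < 1 -> bounded_set (f @` sball s)) >]].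

Lemma near_uball (u : B) : \forall x \near val u, `|x| < 1.
Proof.
apply/nbhs_ballP; exists (1 - `|val u|) => /=.
  by rewrite subr_gt0; exact: (valP u).
move=> x; rewrite -ball_normE /= ltrBrDl; apply: le_lt_trans.
by rewrite -{1}(subrK (val u) x) addrC (le_trans (ler_normD _ _))// distrC.
Qed.

Lemma ext0E f (F : E -> Cx R) : (forall u, f u = F (val u)) ->
  forall u : B, \forall x \near val u, F x = ext0 f x.
Proof.
move=> fF u; have := near_uball u; apply: filterS => x x1.
by rewrite /ext0 insubT fF.
Qed.

Lemma bounded_imageP (T : Type) (A : set T) (F : T -> Cx R) :
  bounded_set (F @` A) <-> exists M : R, forall x, A x -> normc (F x) <= M.
Proof.
split=> [/pinfty_ex_gt0[M M0 h]|[M h]].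
  exists (normc M) => x Ax.
  by rewrite -lecR [leRHS](gtr0_norm M0); exact: h (imageP _ Ax).
exists M%:C; split; first by rewrite complex_real.
move=> N MN _ [x Ax <-]; apply: le_trans (ltW MN).
by rewrite lecR h.
Qed.

Lemma hb_pred_sub : submod_closed (@hb_pred).
Proof.
split.
  apply/asboolP; split=> [u|s s01].
    have dc := @differentiable_cst _ E _ (0 : Cx R) (val u).
    exact: (near_differentiable (ext0E (fun=> erefl) u) dc).
  by apply/bounded_imageP; exists 0 => x _; rewrite (@normcR _ 0).
move=> a f g /asboolP[df bf] /asboolP[dg bg]; apply/asboolP.
split=> [u|s s01].
  have -> : ext0 (a *: f + g) = a *: ext0 f + ext0 g.
    apply/funext => x; rewrite -[RHS]/(a * ext0 f x + ext0 g x) /ext0.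
    by case: insubP => [//|_]; rewrite mulr0 addr0.
  exact: (differentiableD (differentiableZ a (df u)) (dg u)).
have /bounded_imageP[M hM] := bf s s01.
have /bounded_imageP[N hN] := bg s s01.
apply/bounded_imageP; exists (normc a * M + N) => x xs.
apply: le_trans (le_normcD _ _) _; apply: lerD; last exact: hN.
by rewrite Normc.normcM ler_wpM2l ?normc_ge0 ?hM.
Qed.

Lemma hb_pred_subring : subring_closed (@hb_pred).
Proof.
have [h0 hD] := hb_pred_sub.
split.
- apply/asboolP; split=> [u|s s01].
    have dc := @differentiable_cst _ E _ (1 : Cx R) (val u).
    exact: (near_differentiable (ext0E (fun=> erefl) u) dc).
  by apply/bounded_imageP; exists 1 => x _; rewrite (@normcR _ 1).
- by move=> f g hf hg; rewrite addrC -scaleN1r; exact: hD.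
move=> f g /asboolP[df bf] /asboolP[dg bg]; apply/asboolP.
split=> [u|s s01].
  have -> : ext0 (f * g) = ext0 f * ext0 g.
    apply/funext => x; rewrite -[RHS]/(ext0 f x * ext0 g x) /ext0.
    by case: insubP => [//|_]; rewrite mulr0.
  exact: differentiableM.
have /bounded_imageP[M hM] := bf s s01.
have /bounded_imageP[N hN] := bg s s01.
apply/bounded_imageP; exists (M * N) => x xs.
by rewrite Normc.normcM ler_pM ?normc_ge0 ?hM ?hN.
Qed.

HB.instance Definition _ := GRing.isSubmodClosed.Build _ _ hb_pred hb_pred_sub.
HB.instance Definition _ := GRing.isSubringClosed.Build _ hb_pred hb_pred_subring.

End Hb_def.

(* H_b of the open unit ball; differentiability in [hb_pred] is Frechet
   differentiability over R[i], i.e. holomorphy. *)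
Record Hb (R : realType) (p : nat) (hp : (1 < p)%N) := MkHb {
  hb_val :> {x : ell R hp | `|x| < 1} -> Cx R ; _ : hb_val \in @hb_pred R p hp }.

Section spectrum.
Context {R : realType} {p : nat} (hp : (1 < p)%N).
Local Notation E := (ell R hp).
Local Notation B := {x : E | `|x| < 1}.
Local Notation H := (Hb R hp).

HB.instance Definition _ := [isSub for @hb_val R p hp].
HB.instance Definition _ := [Choice of H by <:].
HB.instance Definition _ :=
  GRing.SubChoice_isSubComPzRing.Build _ _ H (GRing.subringClosedP _).
HB.instance Definition _ := [SubZmodule_isSubLmodule of H by <:].

(* topology of uniform convergence on the balls of radius s < 1 *)
HB.instance Definition _ := Topological.copy H (initial_topology
  (@hb_val R p hp : H -> {family [set @sball R p hp s | s in [set s | 0 < s < 1]],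
                   B -> Cx R})).

Record Mb := MkMb {
  mb_val :> H -> Cx R ;
  mb_linear : linear mb_val ;
  mb_mul : {morph mb_val : f g / f * g} ;
  mb_continuous : continuous mb_val ;
  mb_neq0 : exists f, mb_val f != 0 }.

HB.instance Definition _ := gen_eqMixin Mb.
HB.instance Definition _ := gen_choiceMixin Mb.

Definition prec (phi : Mb) (A : set B) := forall f : H,
  ((normc (phi f))%:E <= ereal_sup [set (normc (f x))%:E | x in A])%E.

Lemma hb_linear (L : {linear E -> Cx R}) : continuous L ->
  L \o val \in @hb_pred R p hp.
Proof.
move=> cL; apply/asboolP; split=> [u|s s01].
  have dL : differentiable L (val u) by exact: linear_differentiable.
  exact: (near_differentiable (ext0E (F := L) (fun=> erefl) u) dL).
have /linear_bounded_continuous/linear_boundedP/pinfty_ex_gt0[M M0 h] := cL.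
exists M; split; first exact: gtr0_real.
move=> N MN _ [x xs <-]; apply: le_trans (ltW MN).
apply: le_trans (h _) _; rewrite ler_piMr ?ltW//.
exact: (valP x).
Qed.

(* y |-> d^n f(y)(z, .., z) / n! *)
Definition taylor_term (f : H) (n : nat) (z : E) : B -> Cx R :=
  fun y => (n`!%:R)^-1 * iter n (fun g => 'D_z g) (ext0 f) (val y).

(* psi = phi^z; [insubd 0 g] is the function g as an element of [Hb] (the
   Taylor terms of f always belong to [Hb], so that the default value 0 is not
   used) *)
Definition is_translate (phi : Mb) (z : E) (psi : Mb) := forall f : H,
  series (fun n => phi (insubd (0 : H) (taylor_term f n z))) @ \oo --> psi f.

Definition mb_base : set (set Mb) := [set U | exists phi s e,
  [/\ 0 < s < 1, prec phi (@sball R p hp s), 0 < e < 1 - s &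
      U = [set psi | exists2 z : E, `|z| < e%:C & is_translate phi z psi]]].

(* mb_base is a basis, so that the topology it generates as a subbasis is the
   one having it as basis. *)
HB.instance Definition _ :=
  @isSubBaseTopological.Build Mb (set Mb) mb_base id.

(* ell'' being identified with ell, pi(phi) is the element of ell representing
   the restriction of phi to ell' *)
Definition mb_pi (phi : Mb) : E := xget 0 [set z |
  forall (L : {linear E -> Cx R}) (cL : continuous L),
    phi (MkHb (hb_linear cL)) = L z].

Definition sheet (phi : Mb) : set Mb := connected_component setT phi.

(* When the x n are nonzero (as in [block_hom]) the J n are nonempty, so the
   order condition says max (J n) < min (J n.+1). *)
Definition block_basic (x : nat -> E) :=
  exists (J : nat -> {fset nat}) (a : nat -> R[i]),
    (forall n i j, i \in J n -> j \in J n.+1 -> (i < j)%N) /\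
    (forall n, x n = \sum_(k <- J n) a k *: ell_basis hp k).

Definition block_hom (r : R) (phi : Mb) := exists x : nat -> B,
  [/\ block_basic (val \o x), forall n, `|val (x n)| = r%:C &
      cluster ((fun n => (fun f : H => f (x n)) : {ptws H -> Cx R}) @ \oo)
        (phi : {ptws H -> Cx R})].

Definition canonical_ext (f : H) (phi : Mb) : Cx R := phi f.

Definition Mb0 : set Mb := [set psi |
  exists r phi, [/\ 0 < r < 1, block_hom r phi & sheet phi psi]].

End spectrum.

Section riemann_domain.
Context {R : realType} {E : normedModType R[i]} {X : topologicalType}.
Variable q : X -> E.

Definition homeo_onto (U : set X) (V : set E) (g : E -> X) :=
  [/\ q @` U = V, forall x, U x -> g (q x) = x,
      {within U, continuous q} & {within V, continuous g}].

Definition dist_dom (x : X) : \bar R := ereal_sup [set rho%:E | rho in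
  [set rho : R | 0 < rho /\
    exists U g, nbhs x U /\ homeo_onto U (ball (q x) rho%:C) g]].

Definition dom_bounded (A : set X) :=
  bounded_set (q @` A) /\ (0 < ereal_inf (dist_dom @` A))%E.

Definition dom_holomorphic (F : X -> Cx R) := forall x : X,
  exists (rho : R) U g, [/\ 0 < rho, nbhs x U,
    homeo_onto U (ball (q x) rho%:C) g &
    forall y, ball (q x) rho%:C y -> differentiable (F \o g) y].

Definition bounded_type (F : X -> Cx R) :=
  dom_holomorphic F /\ (forall A, dom_bounded A -> bounded_set (F @` A)).

End riemann_domain.

(* Main.v *)
Require Import Defs.
From HB Require Import structures.
From mathcomp Require Import all_boot all_order all_algebra.
From mathcomp Require Import finmap complex.
From mathcomp Require Import all_classical all_reals all_analysis.
From mathcomp Require Import ring lra.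

(** Let phi be an r-block homomorphism, adherent to the evaluations at blocks
    x_n of norm r, and let psi lie on its sheet, with z = pi psi.  On functions
    of bounded type psi is hard to describe, because a translate of a
    translate need not be a translate of phi.  On an entire function P of
    polynomial growth, however, the Taylor series defining a translate is a
    finite sum, so that psi^w P = psi (P(. + w)).  The characters psi for which
    some z satisfies psi P = phi (P(. + z)) for all such P thus form a set that
    is stable under translation in both directions, hence open and closed;
    the whole sheet of phi is in it ([sheet_shifted]).  Since the blocks are
    weakly null ([block_linear0]), this z is pi psi ([mb_pi_shifted]).

    Boundedness.  Suppose that dist psi > delta.  Moving psi inside its sheet
    we reach a character over the point z' = (z_0, .., z_(K-1), delta, 0, ..) for
    every large K.  The diagonal polynomial Q = sum_k theta_k x_k^p, with
    theta_k of modulus at most 1 such that theta_k x_k^p is |x_k|^p both at z' and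
    at all the x_n with n > K,
    takes the value r^p + |z'|^p at x_n + z' as soon as the support of x_n lies
    beyond that of z'.  Hence the character over z' gives Q this value.  As
    |Q(x)| <= |x|^p < 1 on the ball, the values of characters at Q have modulus
    less than 1 ([spectral_bound]); so r^p + |z'|^p < 1, and letting K grow
    r^p + |z|^p <= 1 - delta^p ([shifted_radius], [dist_radius]).  Here the
    hypothesis that p is an integer is used, to have Q.  Conversely |psi P| is
    at most the supremum of |P| on tB as soon as t^p > r^p + |z|^p, because
    |x_n + z| tends to (r^p + |z|^p)^(1/p) ([shifted_entire_bound]).  On a
    bounded set of the domain, delta, hence some t < 1, can be chosen uniformly;
    the partial sums of the Taylor series of f at 0 are polynomials that are
    uniformly bounded on tB and that approximate psi f
    ([taylor_partial_sums]), which bounds psi f.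

    Holomorphy.  Near psi, the inverse of pi is w |-> psi^(w - pi psi); it is
    continuous because translates of translates by short vectors are
    translates ([translate_add], [translate_continuous]).  Then f~ becomes
    y |-> psi^(y - pi psi) f, which has the linear part v |-> chi (D_v f) at the
    character chi above y, with a quadratic remainder ([quadratic_remainder]), and such
    an expansion makes a bounded function differentiable ([quadratic_diff]).

    All of this rests on the theory of holomorphic functions of one variable,
    which is developed from complex differentiability alone, without
    integrals: circle integrals are replaced by means over the 2^m-th roots
    of unity.  The Goursat subdivision argument, carried out for trapezoid sums
    on rectangles in the log-polar coordinate, shows that these means are
    asymptotically independent of the radius ([circle_mean_annulus]); the
    Cauchy formula and the Taylor expansion with its estimates follow
    ([cauchy_formula], [taylor_disc], [taylor_line]). *)

Set Implicit Arguments.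
Unset Strict Implicit.
Unset Printing Implicit Defensive.

Import Order.TTheory GRing.Theory Num.Theory.
Import numFieldNormedType.Exports.

Local Open Scope classical_set_scope.
Local Open Scope complex_scope.
Local Open Scope ring_scope.

(** * Moduli, norms and limits over R[i] *)

Section modulus.
Context {R : realType}.
Local Notation C := R[i].
Implicit Types (x y z : C) (a b : R).

Lemma normcD x y : normc (x + y) <= normc x + normc y.
Proof. exact: le_normcD. Qed.

Lemma normcB x y : normc (x - y) <= normc x + normc y.
Proof. by rewrite -(normcN y) normcD. Qed.

Lemma normc_dist x y : normc (x - y) = normc (y - x).
Proof. by rewrite -normcN opprB. Qed.

Lemma normc_triangle z x y : normc (x - y) <= normc (x - z) + normc (z - y).
Proof. by rewrite (le_trans _ (normcD _ _))// addrA subrK. Qed.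

Lemma normcX x n : normc (x ^+ n) = normc x ^+ n.
Proof.
by elim: n => [|n IH]; rewrite ?expr0 ?Normc.normc1// !exprS Normc.normcM IH.
Qed.

Lemma normc_sum (I : Type) (s : seq I) (P : pred I) (F : I -> C) :
  normc (\sum_(i <- s | P i) F i) <= \sum_(i <- s | P i) normc (F i).
Proof.
elim/big_ind2 : _ => [|x a y b xa yb|//]; first by rewrite Normc.normc0.
exact: le_trans (normcD _ _) (lerD xa yb).
Qed.

Lemma normc_realE a : normc a%:C = `|a|.
Proof. by rewrite /= expr0n/= addr0 sqrtr_sqr. Qed.

Lemma normc_nat n : normc (n%:R : C) = n%:R.
Proof. by rewrite -(rmorph_nat (real_complex R)) normc_realE ger0_norm. Qed.

Lemma normc_eq0 x : (normc x == 0) = (x == 0).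
Proof.
by apply/eqP/eqP => [/Normc.eq0_normc//|->]; exact: Normc.normc0.
Qed.

Lemma normc_gt0 x : (0 < normc x) = (x != 0).
Proof. by rewrite lt_def normc_eq0 normc_ge0 andbT. Qed.

Lemma normc_lerB x y : normc x - normc y <= normc (x - y).
Proof. by rewrite lerBlDr (le_trans _ (normcD _ _))// subrK. Qed.

Lemma normc_le_ReIm a b : normc (a +i* b) <= `|a| + `|b|.
Proof.
rewrite /= -[leRHS]ger0_norm ?addr_ge0// -sqrtr_sqr ler_wsqrtr//.
rewrite -(real_normK (num_real a)) -(real_normK (num_real b)).
have := normr_ge0 a; have := normr_ge0 b; nra.
Qed.

Lemma Re_le_normc a b : `|a| <= normc (a +i* b).
Proof.
by rewrite /= -sqrtr_sqr ler_wsqrtr// lerDl sqr_ge0.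
Qed.

Lemma Im_le_normc a b : `|b| <= normc (a +i* b).
Proof.
by rewrite /= -sqrtr_sqr ler_wsqrtr// lerDr sqr_ge0.
Qed.

Lemma normc_normr (x : Cx R) : `|x| = (normc x)%:C.
Proof. by []. Qed.

(** In the partial order of R[i] only real numbers are positive, so that the
    radii of balls and of estimates can be taken in R. *)
Lemma gt0_complexE x : 0 < x -> x = (complex.Re x)%:C /\ 0 < complex.Re x.
Proof.
by case: x => a b; rewrite ltcE /= => /andP[/eqP -> ?].
Qed.

Lemma cvgC_dist {T} {F : set_system T} {FF : Filter F} (u : T -> Cx R) (l : Cx R) :
  u @ F --> l <-> forall e : R, 0 < e -> \forall t \near F, normc (u t - l) < e.
Proof.
split=> [/cvgrPdist_lt h e e0|h].
  have := h e%:C; rewrite ltcR => /(_ e0).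
  by apply: filterS => t; rewrite distrC normc_normr ltcR.
apply/cvgrPdist_lt => e /gt0_complexE[-> e0].
have := h _ e0; apply: filterS => t.
by rewrite distrC normc_normr ltcR.
Qed.

Lemma cvgC_distn (u : nat -> Cx R) (l : Cx R) :
  u @ \oo --> l <-> forall e : R, 0 < e ->
    exists N, forall n, (N <= n)%N -> normc (u n - l) < e.
Proof.
split=> [/cvgC_dist h e /h[N _ hN]|h].
  by exists N => n Nn; exact: hN.
by apply/cvgC_dist => e /h[N hN]; exists N => // n /= Nn; exact: hN.
Qed.

Lemma cvgC_normc_le (u : nat -> Cx R) (l : Cx R) (M : R) :
  u @ \oo --> l -> (\forall n \near \oo, normc (u n) <= M) -> normc l <= M.
Proof.
move=> /cvgC_dist ul uM; apply/ler_addgt0Pr => e e0.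
have [n [un uM']] := filter_ex (filterI (ul _ e0) uM).
rewrite -(subrK (u n) l) (le_trans (normcD _ _))// normc_dist; lra.
Qed.

Lemma cauchyC_cvg (u : nat -> Cx R) :
  (forall e : R, 0 < e -> exists N, forall m n, (N <= m)%N -> (N <= n)%N ->
     normc (u m - u n) < e) ->
  exists l : Cx R, u @ \oo --> l.
Proof.
move=> h.
have key (g : C -> R) : (forall x y, `|g x - g y| <= normc (x - y)) ->
    exists l : R, g \o u @ \oo --> l.
  move=> gl; suff : cvgn (g \o u) by move=> /cvg_ex.
  apply: cauchy_cvg; apply/cauchy_exP => e e0.
  have [N hN] := h _ e0.
  exists (g (u N)); exists N => // n /= Nn; rewrite /ball /=.
  exact: le_lt_trans (gl _ _) (hN _ _ _ _).
have [a ca] := key (@complex.Re R) (fun x y => let: a +i* b := x in let: c +i* d := y in Re_le_normc (a - c) (b - d)).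
have [b cb] := key (@complex.Im R) (fun x y => let: a +i* b := x in let: c +i* d := y in Im_le_normc (a - c) (b - d)).
exists (a +i* b); apply/cvgC_dist => e e0.
have e20 : 0 < e / 2 by rewrite divr_gt0.
move/cvgrPdist_lt : ca => /(_ _ e20) ca; move/cvgrPdist_lt : cb => /(_ _ e20) cb.
apply: filterS2 ca cb => n /=; case: (u n) => c d /= ca cb.
rewrite (le_lt_trans (normc_le_ReIm (c - a) (d - b)))//.
by rewrite (distrC c) (distrC d); lra.
Qed.

Lemma cvgCB (u v : nat -> Cx R) (a b : Cx R) : u @ \oo --> a -> v @ \oo --> b ->
  (fun n => u n - v n) @ \oo --> (a - b : Cx R).
Proof. by move=> ua vb; exact: (cvgB ua vb). Qed.

Lemma cvgCD (u v : nat -> Cx R) (a b : Cx R) : u @ \oo --> a -> v @ \oo --> b ->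
  (fun n => u n + v n) @ \oo --> (a + b : Cx R).
Proof. by move=> ua vb; exact: (cvgD ua vb). Qed.

Lemma cvgCM (u v : nat -> Cx R) (a b : Cx R) : u @ \oo --> a -> v @ \oo --> b ->
  (fun n => u n * v n) @ \oo --> (a * b : Cx R).
Proof. by move=> ua vb; exact: (cvgM ua vb). Qed.

Lemma cvgC_cst (a : Cx R) : (fun _ : nat => a) @ \oo --> a.
Proof. exact: cvg_cst. Qed.

Lemma cvgC_uniq (u : nat -> Cx R) (a b : Cx R) :
  u @ \oo --> a -> u @ \oo --> b -> a = b.
Proof. by move=> ua ub; apply: (cvg_unique _ ua ub). Qed.

End modulus.
Arguments cvgC_cst {R} a.

Section real_norm.
Context {R : realType} {V : normedModType R[i]}.
Implicit Types (v w : V) (a : R[i]).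

(** The norm of a normed space over R[i] takes its values in R[i]; this is the same
    norm as a real number. *)
Definition nrm v : R := complex.Re `|v|.

Lemma nrmE v : `|v| = (nrm v)%:C.
Proof. by rewrite /nrm; apply/esym/RRe_real; exact: normr_real. Qed.

Lemma nrm_ge0 v : 0 <= nrm v.
Proof. by rewrite -ler0c -nrmE normr_ge0. Qed.

Lemma nrmD v w : nrm (v + w) <= nrm v + nrm w.
Proof. by rewrite -lecR rmorphD /= -!nrmE; exact: ler_normD. Qed.

Lemma nrmN v : nrm (- v) = nrm v.
Proof. by rewrite /nrm normrN. Qed.

Lemma nrmB v w : nrm (v - w) <= nrm v + nrm w.
Proof. by rewrite -(nrmN w) nrmD. Qed.

Lemma nrmZ a v : nrm (a *: v) = normc a * nrm v.
Proof.
apply: complexI; rewrite rmorphM /= -!nrmE normrZ; congr (_ * _).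
Qed.

Lemma nrm0 : nrm 0 = 0.
Proof. by apply: complexI; rewrite -nrmE normr0. Qed.

Lemma nrm_eq0 v : nrm v = 0 -> v = 0.
Proof. by move=> v0; apply/eqP; rewrite -normr_eq0 nrmE v0. Qed.

Lemma nearV (P : set V) (x : V) : (\forall y \near x, P y) <->
  exists2 d : R, 0 < d & forall y, nrm (y - x) < d -> P y.
Proof.
split=> [/nbhs_ballP[e /= /gt0_complexE[-> e0] h]|[d d0 h]].
  exists (complex.Re e) => // y yx; apply: h.
  by rewrite -ball_normE /= distrC nrmE ltcR.
apply/nbhs_ballP; exists d%:C => /=; first by rewrite ltcR.
by move=> y; rewrite -ball_normE /= distrC nrmE ltcR => /h.
Qed.

Lemma nearV0 (P : set V) : (\forall y \near (0 : V), P y) <->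
  exists2 d : R, 0 < d & forall y, nrm y < d -> P y.
Proof.
by rewrite nearV; split=> -[d d0 h]; exists d => // y hy; apply: h; move: hy; rewrite ?subr0.
Qed.

Lemma diff_eps (f : V -> Cx R) (x : V) : differentiable f x ->
  forall e : R, 0 < e -> exists2 d : R, 0 < d & forall v, nrm v < d ->
    normc (f (x + v) - f x - 'd f x v) <= e * nrm v.
Proof.
move=> df e e0.
have e0C : 0 < e%:C by rewrite ltcR.
have /eqaddoP/(_ _ e0C)/nearV0[d d0 h] := diff_locally df; exists d => // v /h /=.
rewrite !fctE /= (addrC v) opprD addrA nrmE -rmorphM.
by rewrite normc_normr lecR.
Qed.

End real_norm.

Lemma geometric_small (R : realType) (K q e : R) : 0 <= K -> 0 <= q < 1 -> 0 < e ->
  exists N, forall n, (N <= n)%N -> K * q ^+ n < e.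
Proof.
move=> K0 /andP[q0 q1] e0; have cv : (fun n => K * q ^+ n) @ \oo --> 0.
  rewrite -(mulr0 K); apply: cvgM; first exact: cvg_cst.
  by apply: cvg_expr; rewrite ger0_norm.
move/cvgrPdist_lt : cv => /(_ _ e0)[N _ hN].
exists N => n /hN /=; rewrite sub0r normrN ger0_norm//.
by apply: mulr_ge0; rewrite ?exprn_ge0.
Qed.

(** * The Goursat theorem for trapezoid sums *)

Section goursat.
Context {R : realType}.
Local Notation C := R[i].
Implicit Types (F G : C -> C) (z h v : C).

(** The trapezoid sum with N intervals for the integral of F over the segment
    from z to z + h. *)
Definition edge N F z h : C :=
  \sum_(j < N) (F (z + j%:R / N%:R * h) + F (z + j.+1%:R / N%:R * h)) *
    (h / (2 * N%:R)).

(** The four sides, with orientation, of the parallelogram spanned by h and v. *)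
Definition rect N F z h v : C :=
  edge N F z h + edge N F (z + h) v - edge N F (z + v) h - edge N F z v.

Let natC_neq0 n : (0 < n)%N -> (n%:R : C) != 0.
Proof. by rewrite lt0n pnatr_eq0. Qed.

Lemma edgeB N F G z h :
  edge N (fun w => F w - G w) z h = edge N F z h - edge N G z h.
Proof. by rewrite /edge -sumrB; apply: eq_bigr => j _; ring. Qed.

Lemma edge_double N F z h : (0 < N)%N ->
  edge (N + N) F z h = edge N F z (h / 2) + edge N F (z + h / 2) (h / 2).
Proof.
move=> /natC_neq0 N0; rewrite /edge big_split_ord /=.
have N2 : (N%:R + N%:R : C) != 0 by rewrite -mulr2n mulrn_eq0.
congr (_ + _); apply: eq_bigr => j _.
  by congr ((F _ + F _) * _); rewrite natrD; field; rewrite N0 /= N2 ?andbT.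
by congr ((F _ + F _) * _); rewrite -?addnS !natrD; field; rewrite N0 /= N2 ?andbT.
Qed.

Lemma rect_double N F z h v : (0 < N)%N ->
  rect (N + N) F z h v = rect N F z (h / 2) (v / 2) +
    rect N F (z + h / 2) (h / 2) (v / 2) + rect N F (z + v / 2) (h / 2) (v / 2) +
    rect N F (z + h / 2 + v / 2) (h / 2) (v / 2).
Proof.
move=> N0; rewrite /rect !edge_double//.
have hh : z + h / 2 + h / 2 = z + h by field.
have hv : z + v / 2 + v / 2 = z + v by field.
have -> : z + h / 2 + v / 2 + h / 2 = z + h + v / 2 by field.
have -> : z + h / 2 + v / 2 + v / 2 = z + v + h / 2 by field.
have -> : z + v / 2 + h / 2 = z + h / 2 + v / 2 by field.
rewrite hh hv; ring.
Qed.

(** The trapezoid rule is exact on affine functions, because it telescopes on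
    their primitives. *)
Lemma edge_affine N z h (a b : C) : (0 < N)%N ->
  edge N (fun w => a + b * w) z h = a * h + b * (z * h + h ^+ 2 / 2).
Proof.
move=> /natC_neq0 N0.
pose G (j : nat) : C := a * (j%:R / N%:R * h) +
  b * (z * (j%:R / N%:R * h) + (j%:R / N%:R * h) ^+ 2 / 2).
rewrite /edge (eq_bigr (fun j : 'I_N => G j.+1 - G j)); last first.
  by move=> j _; rewrite /G -natr1; field.
rewrite -(big_mkord xpredT (fun j => G j.+1 - G j)) telescope_sumr//.
by rewrite /G mul0r !mul0r divff// mul1r; ring.
Qed.

Lemma rect_affine N z h v (a b : C) : (0 < N)%N ->
  rect N (fun w => a + b * w) z h v = 0.
Proof. by move=> N0; rewrite /rect !edge_affine//; field. Qed.

Lemma edge_bound N F z h (e : R) : (0 < N)%N ->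
  (forall t : R, 0 <= t <= 1 -> normc (F (z + t%:C * h)) <= e) ->
  normc (edge N F z h) <= e * normc h.
Proof.
move=> N0 Fe.
have NR : 0 < N%:R :> R by rewrite ltr0n.
have Fj (j : nat) : (j <= N)%N -> normc (F (z + j%:R / N%:R * h)) <= e.
  move=> jN; have := Fe (j%:R / N%:R).
  rewrite fmorph_div !rmorph_nat; apply.
  by rewrite divr_ge0//= ler_pdivrMr// mul1r ler_nat.
apply: le_trans (normc_sum _ _ _) _.
have -> : e * normc h = \sum_(j < N) ((e + e) * (normc h / (2 * N%:R))).
  by rewrite sumr_const card_ord -mulr_natl; field; rewrite gt_eqF.
apply: ler_sum => j _; rewrite !Normc.normcM Normc.normcV Normc.normcM !normc_nat.
apply: ler_wpM2r.
  by rewrite divr_ge0 ?normc_ge0// mulr_ge0.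
apply: le_trans (normcD _ _) _; apply: lerD; apply: Fj => //.
exact: ltnW.
Qed.

Lemma rect_bound N F z h v (e : R) : (0 < N)%N ->
  (forall s t : R, 0 <= s <= 1 -> 0 <= t <= 1 ->
     normc (F (z + s%:C * h + t%:C * v)) <= e) ->
  normc (rect N F z h v) <= e * (2 * (normc h + normc v)).
Proof.
move=> N0 Fe; rewrite /rect.
have i0 : 0 <= (0 : R) <= 1 by rewrite lexx ler01.
have i1 : 0 <= (1 : R) <= 1 by rewrite lexx ler01.
have b1 : normc (edge N F z h) <= e * normc h.
  by apply: edge_bound => // t t01; have := Fe t 0 t01 i0; rewrite mul0r addr0.
have b2 : normc (edge N F (z + h) v) <= e * normc v.
  by apply: edge_bound => // t t01; have := Fe 1 t i1 t01; rewrite mul1r.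
have b3 : normc (edge N F (z + v) h) <= e * normc h.
  by apply: edge_bound => // t t01; have := Fe t 1 t01 i1; rewrite mul1r addrAC.
have b4 : normc (edge N F z v) <= e * normc v.
  by apply: edge_bound => // t t01; have := Fe 0 t i0 t01; rewrite mul0r addr0.
apply: le_trans (normcB _ _) _; apply: le_trans (lerD (normcB _ _) (lexx _)) _.
apply: le_trans (lerD (lerD (normcD _ _) (lexx _)) (lexx _)) _.
lra.
Qed.

Lemma rect_near_affine N F z h v (a b : C) (e : R) : (0 < N)%N ->
  (forall s t : R, 0 <= s <= 1 -> 0 <= t <= 1 ->
     normc (F (z + s%:C * h + t%:C * v) - (a + b * (z + s%:C * h + t%:C * v))) <= e) ->
  normc (rect N F z h v) <= e * (2 * (normc h + normc v)).
Proof.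
move=> N0 Fe.
have -> : rect N F z h v = rect N (fun w => F w - (a + b * w)) z h v.
  have := rect_affine z h v a b N0; rewrite /rect !edgeB => A0.
  rewrite -[LHS]subr0 -A0; ring.
exact: rect_bound.
Qed.

(** Goursat's subdivision argument, with trapezoid sums over [2 ^ m] intervals
    per side instead of integrals.  By [rect_double] such a sum over a rectangle
    is the total of the sums with [2 ^ m.-1] intervals over its quarters;
    if the conclusion failed, it would fail (with the tolerance divided by 4)
    on one of the quarters, and so on along a sequence shrinking to a point
    c.  There F is affine up to an error that is small relative to the
    diameter, and trapezoid sums are exact on affine functions. *)
Lemma goursat F (s t a b : R) : 0 <= a -> 0 <= b ->
  (forall x y, s <= x <= s + a -> t <= y <= t + b ->
     differentiable (F : Cx R -> Cx R) (x +i* y : Cx R)) ->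
  forall e : R, 0 < e -> exists m0, forall m, (m0 <= m)%N ->
    normc (rect (2 ^ m) F (s +i* t) (a%:C) (0 +i* b)) <= e.
Proof.
move=> a0 b0 dF e e0; set h := a%:C; set v := 0 +i* b.
have hE : normc h = a by rewrite normc_realE ger0_norm.
have vE : normc v = b by rewrite /v /= expr0n/= add0r sqrtr_sqr ger0_norm.
pose p k : R := 2^-1 ^+ k.
have p0 k : 0 < p k by rewrite exprn_gt0// invr_gt0.
have pS k : p k.+1 = p k / 2 by rewrite /p exprS mulrC.
pose hk k : C := (p k)%:C * h; pose vk k : C := (p k)%:C * v.
have hkS k : hk k.+1 = hk k / 2.
  by rewrite /hk pS rmorphM fmorphV rmorph_nat; ring.
have vkS k : vk k.+1 = vk k / 2.
  by rewrite /vk pS rmorphM fmorphV rmorph_nat; ring.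
pose good k z := exists m0, forall m, (m0 <= m)%N ->
  normc (rect (2 ^ m) F z (hk k) (vk k)) <= e * (p k) ^+ 2.
  (* the area is divided by 4 at each step, and so is the tolerance *)
have quarter k z : ~ good k z -> exists i j : bool,
    ~ good k.+1 (z + i%:R * hk k.+1 + j%:R * vk k.+1).
  move=> bad; apply: contrapT => nex; apply: bad.
  have g i j : good k.+1 (z + (i : bool)%:R * hk k.+1 + (j : bool)%:R * vk k.+1).
    by apply: contrapT => ng; apply: nex; exists i, j.
  have [m1 h1] := g false false; have [m2 h2] := g true false.
  have [m3 h3] := g false true; have [m4 h4] := g true true.
  exists (maxn (maxn m1 m2) (maxn m3 m4)).+1 => -[//|m].
  rewrite ltnS !geq_max => /andP[/andP[l1 l2] /andP[l3 l4]].
  move: (h1 _ l1) (h2 _ l2) (h3 _ l3) (h4 _ l4).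
  rewrite !mul0r !mul1r !addr0 hkS vkS pS => g1 g2 g3 g4.
  rewrite expnS mul2n -addnn rect_double ?expn_gt0//.
  apply: le_trans (normcD _ _) _; apply: le_trans (lerD (normcD _ _) (lexx _)) _.
  apply: le_trans (lerD (lerD (normcD _ _) (lexx _)) (lexx _)) _.
  have -> : e * p k ^+ 2 = e * (p k / 2) ^+ 2 + e * (p k / 2) ^+ 2 +
    e * (p k / 2) ^+ 2 + e * (p k / 2) ^+ 2 by field.
  by do 3?[apply: lerD => //].
apply: contrapT => nex.
have bad0 : ~ good 0%N (s +i* t).
  by rewrite /good /hk /vk /p !expr0 expr1n mulr1 !mul1r.
have step (x : nat * C) : exists y : C, ~ good x.1 x.2 ->
    ~ good x.1.+1 y /\ exists i j : bool, y = x.2 + i%:R * hk x.1.+1 + j%:R * vk x.1.+1.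
  have [gx|/quarter[i [j ij]]] := EM (good x.1 x.2); first by exists 0.
  exists (x.2 + i%:R * hk x.1.+1 + j%:R * vk x.1.+1) => _.
  by split; [exact: ij | exists i, j].
have /choice[nxt nxtP] := step.
pose z := fix z k : C := if k is k'.+1 then nxt (k', z k') else s +i* t.
have zbad k : ~ good k (z k).
  by elim: k => // k IH; have [] := nxtP (k, z k) IH.
have zS k : exists i j : bool, z k.+1 = z k + i%:R * hk k.+1 + j%:R * vk k.+1.
  by have [] := nxtP (k, z k) (zbad k).
have zin k : (s <= complex.Re (z k) <= s + a * (1 - p k)) &&
    (t <= complex.Im (z k) <= t + b * (1 - p k)).
  elim: k => [|k]; first by rewrite /= /p expr0 subrr !mulr0 !addr0 !lexx.
  have [i [j ->]] := zS k; case: (z k) => x y /= /andP[/andP[x1 x2] /andP[y1 y2]].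
  have pk := p0 k.
  have ha : 0 <= a * p k by rewrite mulr_ge0// ltW.
  have hb : 0 <= b * p k by rewrite mulr_ge0// ltW.
  rewrite /hk /vk /h /v pS; case: i; case: j; rewrite ?mul0r ?mul1r ?addr0 /=;
    apply/andP; split; apply/andP; split; lra.
pose L := a + b.
have zdist k n : normc (z (k + n)%N - z k) <= L * (p k - p (k + n)%N).
  elim: n => [|n IH]; first by rewrite addn0 !subrr mulr0 Normc.normc0.
  have [i [j]] := zS (k + n)%N; rewrite addnS => zSkn.
  apply: le_trans (normc_triangle (z (k + n)%N) _ _) _.
  have -> : L * (p k - p (k + n).+1) = L * p (k + n).+1 + L * (p k - p (k + n)%N).
    by rewrite pS; field.
  apply: lerD => //; rewrite zSkn.
  have -> (x y w : C) : x + y + w - x = y + w by ring.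
  apply: le_trans (normcD _ _) _; rewrite /L mulrDl !Normc.normcM hE vE !normc_realE.
  rewrite !normc_nat ger0_norm ?(ltW (p0 _))//.
  have pa := mulr_ge0 a0 (ltW (p0 (k + n).+1)).
  have pb := mulr_ge0 b0 (ltW (p0 (k + n).+1)).
  by apply: lerD; case: (i); case: (j); rewrite ?mul0r ?mul1r// mulrC.
have L0 : 0 <= L by rewrite addr_ge0.
have zdist' k n : normc (z (k + n)%N - z k) <= L * p k.
  by rewrite (le_trans (zdist _ _))// ler_wpM2l// gerBl ltW.
have pcvg (d : R) : 0 < d -> exists N, p N < d.
  move=> d0; have : p @ \oo --> 0 by apply: cvg_expr; rewrite ger0_norm; lra.
  move/cvgrPdist_lt => /(_ _ d0)[N _ /(_ N (leqnn N))].
  by rewrite /= sub0r normrN ger0_norm ?(ltW (p0 _))//; exists N.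
have Lp (d : R) : 0 < d -> exists N, L * p N < d.
  move=> d0; have L1 : 0 < L + 1 by lra.
  have [N pN] := pcvg _ (divr_gt0 d0 L1); exists N.
  by move: pN; rewrite ltr_pdivlMr// mulrDr; have := p0 N; lra.
have [c zc] : exists c : Cx R, z @ \oo --> c.
  apply: cauchyC_cvg => d d0; have [N LN] := Lp _ (divr_gt0 d0 (ltr0Sn R 1)).
  exists N => m n Nm Nn; apply: le_lt_trans (normc_triangle (z N) _ _) _.
  have := zdist' N (m - N)%N; have := zdist' N (n - N)%N.
  rewrite !subnKC// (normc_dist (z N)); lra.
have zck k : normc (c - z k) <= L * p k.
  have : (fun n => z n - z k) @ \oo --> (c - z k : Cx R).
    exact: cvgCB zc (cvgC_cst _).
  move=> h1; refine (@cvgC_normc_le _ _ _ _ h1 _).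
  by exists k => // n /= kn; have := zdist' k (n - k)%N; rewrite subnKC.
have cin : (s <= complex.Re c <= s + a) /\ (t <= complex.Im c <= t + b).
  case: (c) zck => x y zck /=.
  have pa k := mulr_ge0 a0 (ltW (p0 k)).
  have pb k := mulr_ge0 b0 (ltW (p0 k)).
  suff h1 d : 0 < d -> (s - d <= x <= s + a + d) && (t - d <= y <= t + b + d).
    by split; apply/andP; split; apply/ler_addgt0Pr => d /h1; lra.
  move=> /Lp[k Lk]; have := zin k; have := zck k; case: (z k) => x' y' /= dist.
  have := Re_le_normc (x - x') (y - y'); have := Im_le_normc (x - x') (y - y').
  move: dist => /= dist; have := pa k; have := pb k.
  rewrite !ler_norml => ? ? /andP[] ? ? /andP[] ? ?.
  by move=> /andP[/andP[? ?] /andP[? ?]]; apply/andP; split; apply/andP; split; lra.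
have dc : differentiable (F : Cx R -> Cx R) (c : Cx R).
  by case: (c) cin => x y /= [? ?]; exact: dF.
(* F is affine up to eta |w - c| near c, |w - c| <= 2 L 2^-k on the k-th rectangle and
   its perimeter is 2 L 2^-k; eta makes the product at most e 4^-k *)
pose eta := e / (4 * L ^+ 2 + 1).
have den0 : 0 < 4 * L ^+ 2 + 1 by have := sqr_ge0 L; lra.
have eta0 : 0 < eta by rewrite divr_gt0.
have [d d0 hd] := diff_eps dc eta0.
have [k Lk] := Lp _ (divr_gt0 d0 (ltr0Sn R 1)).
apply: (zbad k); exists 0%N => m _.
have LkE : normc (hk k) + normc (vk k) = L * p k.
  by rewrite !Normc.normcM hE vE normc_realE ger0_norm ?(ltW (p0 _))// /L; ring.
pose D := 'd (F : Cx R -> Cx R) (c : Cx R) 1 : C.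
have DE (u : C) : 'd (F : Cx R -> Cx R) (c : Cx R) u = u * D.
  by rewrite -{1}[u]mulr1 -[u * 1]/((u : C) *: (1 : Cx R)) linearZ.
have Lp0 : 0 <= L * p k by rewrite mulr_ge0// ltW.
apply: le_trans (@rect_near_affine _ _ _ _ _ (F c - D * c) D (eta * (2 * (L * p k))) _ _) _.
- by rewrite expn_gt0.
- move=> x y x01 y01; set w := z k + x%:C * hk k + y%:C * vk k.
  have wz : normc (w - z k) <= L * p k.
    have -> : w - z k = x%:C * hk k + y%:C * vk k by rewrite /w; ring.
    rewrite (le_trans (normcD _ _))// -LkE; apply: lerD.
      rewrite Normc.normcM normc_realE ger0_norm; last by case/andP: x01.
      by rewrite ler_piMl ?normc_ge0//; case/andP: x01.
    rewrite Normc.normcM normc_realE ger0_norm; last by case/andP: y01.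
    by rewrite ler_piMl ?normc_ge0//; case/andP: y01.
  have wc : normc (w - c) <= 2 * (L * p k).
    have := normc_triangle (z k) w c; have := zck k.
    rewrite (normc_dist c); lra.
  have /hd : nrm (w - c : Cx R) < d by rewrite /nrm /=; apply: le_lt_trans wc _; lra.
  rewrite DE subrKC => hw.
  have -> : F w - (F c - D * c + D * w) = F w - F c - (w - c) * D by ring.
  apply: le_trans hw _; rewrite ler_wpM2l// ltW//.
- rewrite LkE /eta.
  have -> : e / (4 * L ^+ 2 + 1) * (2 * (L * p k)) * (2 * (L * p k)) =
     e * (p k) ^+ 2 * ((4 * L ^+ 2) / (4 * L ^+ 2 + 1)) by field; rewrite gt_eqF.
  apply: ler_piMr; first by rewrite mulr_ge0 ?exprn_ge0 ?ltW.
  by rewrite ler_pdivrMr// mul1r lerDl.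
Qed.

End goursat.

(** * Differentiability and the complex exponential *)

Section differentiability.
Context {R : realType} {V : normedModType R[i]}.

Lemma eps_diff (f : V -> Cx R) (x : V) (L : {linear V -> Cx R}) :
  continuous L ->
  (forall e : R, 0 < e -> exists2 d : R, 0 < d & forall v, nrm v < d ->
    normc (f (x + v) - f x - L v) <= e * nrm v) ->
  differentiable f x /\ 'd f x = L :> (V -> Cx R).
Proof.
move=> cL h.
have fx : f \o shift x = cst (f x) + L +o_ 0 id.
  apply/eqaddoP => e /gt0_complexE[-> e0]; apply/nearV0.
  have [d d0 hd] := h _ e0; exists d => // v /hd.
  by rewrite !fctE /= (addrC v) opprD addrA normc_normr (nrmE v) -rmorphM lecR.
have dE := diff_unique cL fx.
split; last exact: dE.
by apply/diff_locallyP; rewrite dE; split; [exact: cL | exact: fx].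
Qed.

Lemma normc_bounded_continuous (L : {linear V -> Cx R}) (K : R) :
  (forall x, normc (L x) <= K * nrm x) -> continuous L.
Proof.
move=> h; apply: continuousfor0_continuous => //.
apply/cvgrPdist_lt => e /gt0_complexE[-> e0]; apply/nearV0.
have K1 : 0 < `|K| + 1 by rewrite ltr_wpDl.
exists (complex.Re e / (`|K| + 1)); first exact: divr_gt0.
move=> v; rewrite ltr_pdivlMr// linear0 sub0r normrN normc_normr ltcR.
apply: le_lt_trans; apply: le_trans (h v) _.
have := ler_norm K; have := nrm_ge0 v; nra.
Qed.

End differentiability.

Section complex_exponential.
Context {R : realType}.
Local Notation C := R[i].

(** Named so that it can be declared linear: a complex derivative d is the
    Frechet derivative [mul1 d]. *)
Definition mul1 (d : C) : Cx R -> Cx R := fun u => u * d.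

Lemma mul1_linear d : linear (mul1 d).
Proof. by move=> a u v; rewrite /mul1 mulrDl; congr (_ + _); exact/esym/mulrA. Qed.

HB.instance Definition _ d :=
  GRing.isLinear.Build C (Cx R) (Cx R) *:%R (mul1 d) (mul1_linear d).

Lemma mul1_continuous d : continuous (mul1 d).
Proof.
move=> u; apply/(@cvgC_dist _ _ (nbhs u) _) => e e0; apply/(@nearV R (Cx R)).
have d0 : 0 < normc d + 1 by rewrite ltr_wpDl ?normc_ge0.
exists (e / (normc d + 1)); first by rewrite divr_gt0.
move=> v; rewrite ltr_pdivlMr// => vu.
have -> : mul1 d v - mul1 d u = (v - u) * d by rewrite -mulrBl.
rewrite Normc.normcM; apply: le_lt_trans vu.
by rewrite ler_wpM2l ?normc_ge0// lerDl.
Qed.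

Lemma eps_diffC (f : Cx R -> Cx R) (x d : Cx R) :
  (forall e : R, 0 < e -> exists2 r : R, 0 < r & forall v : C, normc v < r ->
    normc (f (x + v) - f x - v * d) <= e * normc v) -> differentiable f x.
Proof.
move=> h.
by have [] := @eps_diff R (Cx R) f x (mul1 d) (@mul1_continuous d) h.
Qed.

Lemma diffC_eps (f : Cx R -> Cx R) (x : Cx R) : differentiable f x ->
  exists d : C, forall e : R, 0 < e -> exists2 r : R, 0 < r &
    forall v : C, normc v < r -> normc (f (x + v) - f x - v * d) <= e * normc v.
Proof.
move=> df; exists ('d f x (1 : Cx R)) => e e0.
have [r r0 h] := diff_eps df e0; exists r => // v /h.
have -> // : 'd f x v = v * 'd f x (1 : Cx R).
by rewrite -{1}[v]mulr1 -[v * 1]/((v : C) *: (1 : Cx R)) linearZ.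
Qed.

Lemma real_derive_eps (f : R -> R) (x df : R) : is_derive x 1 f df ->
  forall e : R, 0 < e -> exists2 r : R, 0 < r &
    forall t : R, `|t| < r -> `|f (x + t) - f x - df * t| <= e * `|t|.
Proof.
move=> [dfx <-] e e0.
move/cvgrPdist_le : (dfx) => /(_ _ e0)/nbhs_ballP[r /= r0 h].
exists r => // t tr; have [->|t0] := eqVneq t 0.
  by rewrite addr0 subrr mulr0 subr0 normr0 mulr0.
have := h t; rewrite /ball /= sub0r normrN => /(_ tr t0).
rewrite /= [_ *: 1]mulr1 -(ler_pM2r (_ : 0 < `|t|)) ?normr_gt0// => h1.
apply: le_trans h1; rewrite -normrM distrC mulrBl.
have -> : t^-1 *: (f (t + x) - f x) * t = f (t + x) - f x.
  by rewrite mulrC; exact: (mulVKf t0 (f (t + x) - f x)).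
by rewrite (addrC t).
Qed.

Definition cexp (z : C) : C :=
  (expR (complex.Re z))%:C * (cos (complex.Im z) +i* sin (complex.Im z)).

Lemma cexpD z w : cexp (z + w) = cexp z * cexp w.
Proof.
case: z => a b; case: w => c d; rewrite /cexp /= expRD cosD sinD.
by apply/eqP; rewrite eq_complex /=; apply/andP; split; apply/eqP; ring.
Qed.

Lemma normc_cexp z : normc (cexp z) = expR (complex.Re z).
Proof.
rewrite Normc.normcM normc_realE ger0_norm ?expR_ge0//=.
by rewrite cos2Dsin2 sqrtr1 mulr1.
Qed.

Lemma cexp_periodic z : cexp (z + (0 +i* (pi *+ 2))) = cexp z.
Proof.
by rewrite cexpD [X in _ * X]/cexp /= expR0 cos2pi sin2pi mul1r -[_ +i* 0]/(1 : C) mulr1.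
Qed.

(** By the addition formula it is enough to expand exp at 0, where the real and
    imaginary parts are handled by the derivatives of the real functions exp, cos
    and sin. *)
Lemma differentiable_cexp z : differentiable (cexp : Cx R -> Cx R) (z : Cx R).
Proof.
apply: (@eps_diffC _ _ (cexp z)) => e e0.
have z1 : normc (cexp z) + 1 > 0 by rewrite ltr_wpDl ?normc_ge0.
(* 12 exceeds the sum of the constants in the final estimate *)
pose e1 := Num.min 1 (e / (12 * (normc (cexp z) + 1))).
have e10 : 0 < e1 by rewrite lt_min ltr01 divr_gt0// mulr_gt0.
have e11 : e1 <= 1 by rewrite ge_min lexx.
have e1e : e1 * 12 * normc (cexp z) <= e.
  have : e1 <= e / (12 * (normc (cexp z) + 1)) by rewrite ge_min lexx orbT.
  rewrite ler_pdivlMr ?mulr_gt0//; nra.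
clearbody e1.
have [r1 r10 h1] := real_derive_eps (is_derive_expR (0 : R)) e10.
have [r2 r20 h2] := real_derive_eps (is_derive_cos (0 : R)) e10.
have [r3 r30 h3] := real_derive_eps (is_derive_sin (0 : R)) e10.
exists (Num.min (Num.min r1 r2) (Num.min r3 e1)).
  by rewrite !lt_min r10 r20 r30 e10.
move=> v; rewrite !lt_min => /andP[/andP[v1 v2] /andP[v3 v4]].
rewrite cexpD.
have -> : cexp z * cexp v - cexp z - v * cexp z = cexp z * (cexp v - 1 - v) by ring.
rewrite Normc.normcM.
suff hv : normc (cexp v - 1 - v) <= e1 * 12 * normc v.
  apply: le_trans (ler_wpM2l (normc_ge0 _) hv) _.
  by rewrite mulrA ler_wpM2r ?normc_ge0// mulrC.
case: v v1 v2 v3 v4 => s t v1 v2 v3 v4.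
have sv := Re_le_normc s t; have tv := Im_le_normc s t.
have := h1 s (le_lt_trans sv v1); rewrite add0r expR0 mul1r => {}h1.
have := h2 t (le_lt_trans tv v2); rewrite add0r cos0 sin0 oppr0 mul0r subr0 => {}h2.
have := h3 t (le_lt_trans tv v3); rewrite add0r cos0 sin0 mul1r subr0 => {}h3.
have -> : cexp (s +i* t) - 1 - (s +i* t) =
  (expR s - 1 - s + (expR s * (cos t - 1))) +i* ((expR s - 1) * sin t + (sin t - t)).
  by apply/eqP; rewrite eq_complex /=; apply/andP; split; apply/eqP; ring.
apply: le_trans (normc_le_ReIm _ _) _.
set N := normc (s +i* t) in v1 v2 v3 v4 sv tv *.
have N0 : 0 <= N by exact: normc_ge0.
have tN : e1 * `|t| <= e1 * N by rewrite ler_wpM2l// ltW.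
have sN : e1 * `|s| <= e1 * N by rewrite ler_wpM2l// ltW.
have e1N : e1 * N <= N by rewrite ler_piMl.
have E1 : `|expR s - 1| <= 2 * N.
  rewrite -(subrK s (expR s - 1)) (le_trans (ler_normD _ _))//; lra.
have E2 : `|expR s| <= 3.
  rewrite -(subrK 1 (expR s)) (le_trans (ler_normD _ _))// normr1; lra.
have S1 : `|sin t| <= 2 * N.
  rewrite -(subrK t (sin t)) (le_trans (ler_normD _ _))//; lra.
have T1 : `|expR s * (cos t - 1)| <= 3 * (e1 * N).
  by rewrite normrM ler_pM// (le_trans h2).
have T2 : `|(expR s - 1) * sin t| <= 4 * (e1 * N).
  rewrite normrM; apply: le_trans (ler_pM _ _ E1 S1) _ => //.
  have : N * N <= e1 * N by rewrite ler_wpM2r// ltW.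
  lra.
have := ler_normD (expR s - 1 - s) (expR s * (cos t - 1)).
have := ler_normD ((expR s - 1) * sin t) (sin t - t).
have : 0 <= e1 * N by rewrite mulr_ge0// ltW.
lra.
Qed.

End complex_exponential.

(** * Means over roots of unity *)

Section circle_means.
Context {R : realType}.
Local Notation C := R[i].
Implicit Types (G : C -> C) (r : R).

(** The points of the unit circle, parametrized by the number of turns. *)
Definition unit_pt (t : R) : C := cexp (0 +i* (t * (pi *+ 2))).

Lemma normc_unit_pt t : normc (unit_pt t) = 1.
Proof. by rewrite normc_cexp /= expR0. Qed.

(** The mean of G over the [2 ^ m]-th roots of unity, scaled by r: the substitute
    for (2 pi i)^-1 times the integral of G w / w over the circle of radius r. *)
Definition circle_mean (m : nat) G r : C := ((2 ^ m)%N%:R)^-1 *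
  \sum_(k < 2 ^ m) G (r%:C * unit_pt (k%:R / (2 ^ m)%N%:R)).

Let pow2_neq0 m : ((2 ^ m)%N%:R : C) != 0.
Proof. by rewrite pnatr_eq0 -lt0n expn_gt0. Qed.

Lemma circle_mean_ext m G H r : 0 <= r -> (forall w, normc w = r -> G w = H w) ->
  circle_mean m G r = circle_mean m H r.
Proof.
move=> r0 GH; congr (_ * _); apply: eq_bigr => k _; apply: GH.
by rewrite Normc.normcM normc_unit_pt mulr1 normc_realE ger0_norm.
Qed.

Lemma circle_meanB m G H r :
  circle_mean m (fun w => G w - H w) r = circle_mean m G r - circle_mean m H r.
Proof. by rewrite /circle_mean sumrB mulrBr. Qed.

Lemma circle_meanD m G H r :
  circle_mean m (fun w => G w + H w) r = circle_mean m G r + circle_mean m H r.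
Proof. by rewrite /circle_mean big_split mulrDr. Qed.

Lemma circle_meanZ m (a : C) G r :
  circle_mean m (fun w => a * G w) r = a * circle_mean m G r.
Proof. by rewrite /circle_mean -mulr_sumr mulrCA. Qed.

Lemma circle_mean_cst m (a : C) r : circle_mean m (fun=> a) r = a.
Proof.
by rewrite /circle_mean sumr_const card_ord -[a *+ _]mulr_natl mulKf.
Qed.

Lemma circle_mean_diff_bound m G H r r' (M : R) :
  (forall t, 0 <= t <= 1 -> normc (G (r%:C * unit_pt t) - H (r'%:C * unit_pt t)) <= M) ->
  normc (circle_mean m G r - circle_mean m H r') <= M.
Proof.
move=> GM; rewrite /circle_mean -mulrBr -sumrB Normc.normcM Normc.normcV normc_nat.
have p0 : 0 < (2 ^ m)%N%:R :> R by rewrite ltr0n expn_gt0.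
rewrite mulrC ler_pdivrMr//.
apply: le_trans (normc_sum _ _ _) _.
have -> : M * (2 ^ m)%N%:R = \sum_(k < 2 ^ m) M by rewrite sumr_const card_ord mulr_natr.
apply: ler_sum => k _; apply: GM.
by rewrite divr_ge0//= ler_pdivrMr// mul1r ler_nat ltnW.
Qed.

Lemma circle_mean_bound m G r (M : R) : 0 <= r ->
  (forall w, normc w = r -> normc (G w) <= M) -> normc (circle_mean m G r) <= M.
Proof.
move=> r0 GM; rewrite -(subr0 (circle_mean _ _ _)) -(circle_mean_cst m 0 r).
apply: circle_mean_diff_bound => t _; rewrite subr0; apply: GM.
by rewrite Normc.normcM normc_unit_pt mulr1 normc_realE ger0_norm.
Qed.

(** Under w = exp (x + i y) the circles of radii r0 and r1 become the vertical
    sides of a rectangle of height 2 pi, on which trapezoid sums are circle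
    means up to the factor 2 pi i; the horizontal sides cancel by
    periodicity, and [goursat] applies to G o exp. *)
Lemma circle_mean_annulus G r0 r1 : 0 < r0 -> r0 <= r1 ->
  (forall w, r0 <= normc w <= r1 -> differentiable (G : Cx R -> Cx R) (w : Cx R)) ->
  (fun m => circle_mean m G r1 - circle_mean m G r0) @ \oo --> (0 : Cx R).
Proof.
move=> r00 r01 dG; have r10 : 0 < r1 by exact: lt_le_trans r01.
pose F : C -> C := G \o cexp.
pose T : R := pi *+ 2.
have T0 : 0 < T by rewrite /T mulrn_wgt0// pi_gt0.
have a0 : 0 <= ln r1 - ln r0 by rewrite subr_ge0 ler_ln ?posrE.
have dF x y : ln r0 <= x <= ln r0 + (ln r1 - ln r0) -> 0 <= y <= 0 + T ->
     differentiable (F : Cx R -> Cx R) (x +i* y : Cx R).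
  rewrite subrKC => /andP[x0 x1] _.
  apply: (@differentiable_comp _ (Cx R) (Cx R) (Cx R) cexp G).
    exact: differentiable_cexp.
  apply: dG; rewrite normc_cexp /= -[X in X <= _ <= _]lnK ?posrE//.
  by rewrite -[X in _ <= _ <= X]lnK ?posrE// !ler_expR x0 x1.
have := goursat a0 (ltW T0) dF.
set h := (ln r1 - ln r0)%:C; set v := 0 +i* T => gr.
have edge_v m x : edge (2 ^ m) F (x +i* 0) v = v * circle_mean m G (expR x).
  rewrite /edge /circle_mean.
  set N := (2 ^ m)%N; pose f k := F ((x +i* 0) + k%:R / N%:R * v).
  have Nn0 : N%:R != 0 :> C by exact: pow2_neq0.
  have fE k : f k = G ((expR x)%:C * unit_pt (k%:R / N%:R)).
    rewrite /f /F /= cexpD; congr (G (_ * _)).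
      by rewrite /cexp /= cos0 sin0 mulr1.
    rewrite /unit_pt; congr (cexp _).
    have -> : (k%:R / N%:R : C) = (k%:R / N%:R : R)%:C.
      by rewrite fmorph_div !rmorph_nat.
    by apply/eqP; rewrite eq_complex /= !mul0r !mulr0 subrr addr0 !eqxx.
  have fN : f N = f 0%N.
    rewrite /f divff// mul0r mul1r mul0r addr0 /F /=; congr G.
    exact: cexp_periodic.
  have sS : \sum_(k < N) f k.+1 = \sum_(k < N) f k.
    have fS n : \sum_(k < n) f k.+1 = \sum_(k < n) f k + (f n - f 0%N).
      elim: n => [|n IH]; first by rewrite !big_ord0 subrr addr0.
      by rewrite !big_ord_recr /= IH; ring.
    by rewrite fS fN subrr addr0.
  transitivity (\sum_(k < N) (f k + f k.+1) * (v / (2 * N%:R))) => //.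
  rewrite -mulr_suml big_split /= sS.
  rewrite [in RHS](eq_bigr (fun k : 'I_N => f k)); last by move=> k _; rewrite fE.
  by field.
have edge_h m : edge (2 ^ m) F ((ln r0 +i* 0) + v) h = edge (2 ^ m) F (ln r0 +i* 0) h.
  apply: eq_bigr => j _; congr ((_ + _) * _); rewrite /F /= addrAC.
    by rewrite cexp_periodic.
  by rewrite cexp_periodic.
have rE m : rect (2 ^ m) F (ln r0 +i* 0) h v =
    v * (circle_mean m G r1 - circle_mean m G r0).
  rewrite /rect edge_h edge_v lnK ?posrE//.
  have -> : (ln r0 +i* 0) + h = (ln r1 +i* 0).
    by apply/eqP; rewrite eq_complex /= subrKC addr0 !eqxx.
  by rewrite edge_v lnK ?posrE//; ring.
have vT : normc v = T by rewrite /v /= expr0n/= add0r sqrtr_sqr gtr0_norm.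
apply/cvgC_distn => e e0.
have [m0 hm0] := gr (T * (e / 2)) (mulr_gt0 T0 (divr_gt0 e0 (ltr0Sn R 1))).
exists m0 => m /hm0; rewrite rE Normc.normcM vT ler_pM2l// subr0; lra.
Qed.

(** Shrinking the circle, the mean value property; differentiability at the centre
    is replaced by continuity, as needed for difference quotients. *)
Lemma circle_mean_center G (rho r : R) : 0 < r -> r < rho ->
  (forall w, w != 0 -> normc w < rho -> differentiable (G : Cx R -> Cx R) (w : Cx R)) ->
  {for 0, continuous (G : Cx R -> Cx R)} ->
  (fun m => circle_mean m G r) @ \oo --> (G 0 : Cx R).
Proof.
move=> r0 rrho dG cG; apply/cvgC_distn => e e0.
have e20 : 0 < e / 2 by rewrite divr_gt0.
move/(@cvgC_dist _ _ (nbhs (0 : Cx R)) _) : cG => /(_ _ e20).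
move/(@nearV0 R (Cx R)) => [d d0 hd].
pose s := Num.min r (d / 2).
have s0 : 0 < s by rewrite lt_min r0 divr_gt0.
have sr : s <= r by rewrite ge_min lexx.
have sd : s < d by apply: (@le_lt_trans _ _ (d / 2)); [rewrite ge_min lexx orbT | lra].
have /cvgC_distn /(_ _ e20) [N hN] : (fun m => circle_mean m G r - circle_mean m G s) @ \oo --> (0 : Cx R).
  apply: circle_mean_annulus => // w /andP[sw wr]; apply: dG.
    by rewrite -normc_gt0 (lt_le_trans s0).
  exact: le_lt_trans wr rrho.
exists N => m /hN; rewrite subr0 => h1.
apply: le_lt_trans (normc_triangle (circle_mean m G s) _ _) _.
have h2 : normc (circle_mean m G s - G 0) <= e / 2.
  rewrite -(circle_mean_cst m (G 0) s); apply: circle_mean_diff_bound => t _.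
  apply/ltW; apply: hd; rewrite -[nrm _]/(normc _).
  by rewrite Normc.normcM normc_unit_pt mulr1 normc_realE gtr0_norm.
lra.
Qed.

Lemma unit_pt_continuous : continuous (unit_pt : R -> Cx R).
Proof.
move=> t; apply/(@cvgC_dist _ _ (nbhs t) _) => e e0.
have cc : {for (0 +i* (t * (pi *+ 2)) : Cx R), continuous (cexp : Cx R -> Cx R)}.
  by apply: differentiable_continuous; exact: differentiable_cexp.
move/(@cvgC_dist _ _ (nbhs (_ : Cx R)) _) : cc => /(_ _ e0).
move/(@nearV R (Cx R)) => [d d0 hd].
have T0 : 0 < pi *+ 2 :> R by rewrite mulrn_wgt0// pi_gt0.
rewrite /unit_pt; move: (pi *+ 2) T0 hd => T T0 hd.
apply/nbhs_ballP; exists (d / T); first exact: divr_gt0.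
move=> u /= tu; apply: (hd (0 +i* (u * T))).
have -> : (0 +i* (u * T)) - (0 +i* (t * T)) = 0 +i* ((u - t) * T) :> C.
  by apply/eqP; rewrite eq_complex /= subrr mulrBl !eqxx.
rewrite -[nrm _]/(normc (0 +i* ((u - t) * T))) /= expr0n add0r sqrtr_sqr.
rewrite normrM (gtr0_norm T0) -ltr_pdivlMr// distrC.
exact: tu.
Qed.

(** Compactness of the circle makes the estimate uniform in the argument, hence
    independent of the number 2^m of nodes. *)
Lemma circle_mean_continuous G (s : R) : 0 <= s ->
  (forall w, normc w = s -> {for w, continuous (G : Cx R -> Cx R)}) ->
  forall e : R, 0 < e -> exists2 d : R, 0 < d & forall r, `|r - s| < d ->
    forall m, normc (circle_mean m G r - circle_mean m G s) <= e.
Proof.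
move=> s0 cG e e0.
have e20 : 0 < e / 2 by rewrite divr_gt0.
have /compact_near_coveringP/(_ R (nbhs s)
  (fun r t => normc (G (r%:C * unit_pt t) - G (s%:C * unit_pt t)) <= e) _) :=
  @segment_compact R 0 1.
case=> [t _|d /= d0 hd].
  have ws : normc (s%:C * unit_pt t) = s.
    by rewrite Normc.normcM normc_unit_pt mulr1 normc_realE ger0_norm.
  have := cG _ ws => /(@cvgC_dist _ _ (nbhs (_ : Cx R)) _)/(_ _ e20).
  move/(@nearV R (Cx R)) => [d d0 hd].
  have d1 : 0 < d / (2 * (s + 1)) by rewrite divr_gt0// mulr_gt0//; lra.
  have := @unit_pt_continuous t => /(@cvgC_dist _ _ (nbhs t) _)/(_ _ d1) ut.
  have rs : \forall r \near s, `|r - s| < d / 2.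
    apply/nbhs_ballP; exists (d / 2) => /=; first by rewrite divr_gt0.
    by move=> r; rewrite /ball /= distrC.
  near=> t' r.
  have tt : normc (unit_pt t' - unit_pt t) < d / (2 * (s + 1)) by near: t'.
  have rs' : `|r - s| < d / 2 by near: r.
  have st : s * normc (unit_pt t' - unit_pt t) < d / 2.
    move: tt; rewrite ltr_pdivlMr; last by rewrite mulr_gt0//; lra.
    have := normc_ge0 (unit_pt t' - unit_pt t); nra.
  have h1 : normc (G (r%:C * unit_pt t') - G (s%:C * unit_pt t)) < e / 2.
    apply: hd; rewrite -[nrm _]/(normc _).
    have -> : r%:C * unit_pt t' - s%:C * unit_pt t =
      (r - s)%:C * unit_pt t' + s%:C * (unit_pt t' - unit_pt t).
      by rewrite rmorphB; ring.
    apply: le_lt_trans (normcD _ _) _.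
    rewrite (Normc.normcM (r - s)%:C) (Normc.normcM s%:C) normc_unit_pt mulr1.
    by rewrite !normc_realE (ger0_norm s0); lra.
  have h2 : normc (G (s%:C * unit_pt t') - G (s%:C * unit_pt t)) < e / 2.
    apply: hd; rewrite -[nrm _]/(normc _) -mulrBr Normc.normcM normc_realE (ger0_norm s0).
    lra.
  apply: le_trans (normc_triangle (G (s%:C * unit_pt t)) _ _) _.
  by rewrite (normc_dist (G (s%:C * unit_pt t))); lra.
exists d => // r rs m; apply: circle_mean_diff_bound => t t01.
by apply: (hd r); rewrite ?in_itv//= /ball /= distrC.
Unshelve. all: by end_near.
Qed.

End circle_means.

(** * The Cauchy formula and Taylor series on a disc *)

Section cauchy_formula.
Context {R : realType}.
Local Notation C := R[i].
Implicit Types (h G : C -> C) (r rho : R) (l : C).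

Lemma differentiable_divsub h l (w : C) : differentiable (h : Cx R -> Cx R) (w : Cx R) ->
  w != l -> differentiable (fun x : Cx R => (h x) / (x - l) : Cx R) (w : Cx R).
Proof.
move=> dh wl; apply: (@differentiableM _ (Cx R) h (fun x => (x - l)^-1)).
  exact: dh.
apply: (@differentiableV _ (Cx R) (fun x : Cx R => x - l)); last by rewrite subr_eq0.
by apply: differentiableB; [exact: ex_diff | exact: differentiable_cst].
Qed.

Lemma near_neqC (w l : Cx R) : w != l -> \forall y \near w, y != l.
Proof.
move=> wl; apply/(@nearV R (Cx R)); exists (normc (w - l)).
  by rewrite normc_gt0 subr_eq0.
by move=> y; apply: contraTneq => ->; rewrite -[nrm _]/(normc _) normc_dist ltxx.
Qed.

(** By [circle_mean_annulus] the radius may be replaced by a large one S, where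
    w / (w - l) is nearly 1. *)
Lemma circle_mean_kernel l r : normc l < r ->
  (fun m => circle_mean m (fun w => w / (w - l)) r) @ \oo --> (1 : Cx R).
Proof.
move=> lr; have r0 : 0 < r by exact: le_lt_trans (normc_ge0 _) lr.
apply/cvgC_distn => e e0; have l0 := normc_ge0 l.
(* |w / (w - l) - 1| <= |l| / (S - |l|) <= e / 2 when |w| = S *)
pose S := r + normc l + (2 * normc l) / e.
have e20 : 0 < e / 2 by rewrite divr_gt0.
have le0 : 0 <= (2 * normc l) / e by rewrite divr_ge0 ?mulr_ge0 ?(ltW e0).
have rS : r <= S by rewrite /S -addrA lerDl addr_ge0.
have S0 : 0 <= S by rewrite (le_trans (ltW r0)).
have /cvgC_distn /(_ _ e20) [N hN] : (fun m => circle_mean m (fun w => w / (w - l)) S -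
    circle_mean m (fun w => w / (w - l)) r) @ \oo --> (0 : Cx R).
  apply: circle_mean_annulus; [exact: r0 | exact: rS | move=> w /andP[rw _]].
  apply: differentiable_divsub; first exact: ex_diff.
  by apply: contraTneq rw => ->; rewrite -ltNge.
exists N => m /hN; rewrite subr0 => h1.
apply: le_lt_trans (normc_triangle (circle_mean m (fun w => w / (w - l)) S) _ _) _.
rewrite normc_dist.
have h2 : normc (circle_mean m (fun w => w / (w - l)) S - 1) <= e / 2.
  rewrite -(circle_mean_cst m 1 S) -circle_meanB; apply: circle_mean_bound => // w wS.
  have wl : S - normc l <= normc (w - l) by rewrite -wS normc_lerB.
  have d0 : 0 < S - normc l by rewrite /S; lra.
  have wl0 : w - l != 0 by rewrite -normc_gt0; lra.
  have -> : w / (w - l) - 1 = l / (w - l) by field.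
  rewrite Normc.normcM Normc.normcV ler_pdivrMr; last by lra.
  have h3 : e / 2 * (S - normc l) <= e / 2 * normc (w - l) by rewrite ler_wpM2l ?(ltW e20).
  apply: le_trans h3; rewrite /S.
  have -> : e / 2 * (r + normc l + 2 * normc l / e - normc l) = e / 2 * r + normc l.
    by field; rewrite gt_eqF.
  by rewrite lerDr mulr_ge0// ltW.
lra.
Qed.

(** As in the classical proof, the formula for h follows from the kernel
    ([circle_mean_kernel]) once the means of G w = w (h w - h l) / (w - l) are
    shown to tend to 0 = G 0.  This G is differentiable except at l, where it
    is continuous.  The circle of radius |l| through the singularity is crossed by
    the uniform continuity of the means in the radius ([circle_mean_continuous]),
    the annuli on both sides by [circle_mean_annulus]. *)
Lemma cauchy_formula h rho r l : r < rho -> normc l < r ->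
  (forall w, normc w < rho -> differentiable (h : Cx R -> Cx R) (w : Cx R)) ->
  (fun m => circle_mean m (fun w => w * h w / (w - l)) r) @ \oo --> (h l : Cx R).
Proof.
move=> rrho lr dh; have r0 : 0 < r by exact: le_lt_trans (normc_ge0 _) lr.
have ch w : normc w < rho -> {for (w : Cx R), continuous (h : Cx R -> Cx R)}.
  by move=> wr; apply: differentiable_continuous; exact: dh.
have [l0|l0] := eqVneq l 0.
  have := @circle_mean_center R h rho r r0 rrho (fun w _ => dh w)
    (ch 0 _); rewrite Normc.normc0 l0 => /(_ (lt_trans r0 rrho)).
  rewrite (_ : (fun m => _) = (fun m => circle_mean m h r))//; apply/funext => m.
  apply: circle_mean_ext => [|w wr]; first exact: ltW.
  by rewrite subr0 mulrAC divff ?mul1r// -normc_gt0 wr.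
have [d hd] := diffC_eps (dh l (lt_trans lr rrho)).
have nl : 0 < normc l by rewrite normc_gt0.
pose q w := (h w - h l) / (w - l).
pose G w := if w == l then l * d else w * q w.
have GE w : w != l -> G w = w * q w by rewrite /G => /negPf ->.
have dG w : normc w < rho -> w != l -> differentiable (G : Cx R -> Cx R) (w : Cx R).
  move=> wr wl; apply: (@near_differentiable _ (Cx R) (Cx R) (fun w => w * q w)).
    by have := near_neqC wl; apply: filterS => y yl; rewrite GE.
  apply: (@differentiableM _ (Cx R) id q); first exact: ex_diff.
  apply: (@differentiable_divsub (fun w => h w - h l)); last exact: wl.
  by apply: differentiableB; [exact: dh | exact: differentiable_cst].
have cG : {for (l : Cx R), continuous (G : Cx R -> Cx R)}.
  apply/(@cvgC_dist _ _ (nbhs (l : Cx R)) _) => e e0; apply/(@nearV R (Cx R)).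
  pose A := normc l + 1; have A0 : 0 < A by rewrite /A; lra.
  pose B := normc d + 1; have B0 : 0 < B by rewrite /B; have := normc_ge0 d; lra.
  have e1 : 0 < e / (2 * A) by rewrite divr_gt0// mulr_gt0.
  have [d1 d10 h1] := hd _ e1.
  exists (Num.min d1 (Num.min 1 (e / (2 * B)))).
    by rewrite !lt_min d10 ltr01 divr_gt0// mulr_gt0.
  move=> y; rewrite -[nrm _]/(normc _) !lt_min => /and3P[y1 y2 y3].
  have [->|yl] := eqVneq y l; first by rewrite subrr Normc.normc0.
  rewrite GE// /G eqxx.
  have yl0 : y - l != 0 by rewrite subr_eq0.
  have -> : y * q y - l * d = y * ((h y - h l - (y - l) * d) / (y - l)) + (y - l) * d.
    by rewrite /q; field.
  apply: le_lt_trans (normcD _ _) _; rewrite !Normc.normcM Normc.normcV.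
  have := h1 _ y1; rewrite subrKC => h2.
  have nyl : 0 < normc (y - l) by rewrite normc_gt0.
  have h3 : normc (h y - h l - (y - l) * d) / normc (y - l) <= e / (2 * A).
    by rewrite ler_pdivrMr.
  have yA : normc y <= A by rewrite -(subrK l y) (le_trans (normcD _ _))// /A; lra.
  have h4 : normc y * (normc (h y - h l - (y - l) * d) / normc (y - l)) <= A * (e / (2 * A)).
    by apply: ler_pM => //; rewrite ?normc_ge0// divr_ge0 ?normc_ge0.
  have h5 : normc (y - l) * normc d < e / 2.
    move: y3; rewrite ltr_pdivlMr ?mulr_gt0// /B => y3; nra.
  have h6 : A * (e / (2 * A)) = e / 2 by field; rewrite gt_eqF.
  rewrite h6 in h4; lra.
have cG' w : normc w < rho -> {for (w : Cx R), continuous (G : Cx R -> Cx R)}.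
  move=> wr; have [->//|wl] := eqVneq w l.
  by apply: differentiable_continuous; exact: dG.
have G0 : G 0 = 0 by rewrite GE ?mul0r// eq_sym.
have mG : (fun m => circle_mean m G r) @ \oo --> (0 : Cx R).
  apply/cvgC_distn => e e0; have e4 : 0 < e / 4 by rewrite divr_gt0.
  have := @circle_mean_continuous R G (normc l) (ltW nl).
  have ci w : normc w = normc l -> {for (w : Cx R), continuous (G : Cx R -> Cx R)}.
    by move=> wl; apply: cG'; rewrite wl (lt_trans lr).
  move=> /(_ ci _ e4)[d1 d10 hd1].
  (* r1 < |l| < r2 are so close to |l| that the means at r1 and r2 differ little from
     the mean at |l| *)
  pose r1 := Num.max (normc l / 2) (normc l - d1 / 2).
  pose r2 := Num.min r (normc l + d1 / 2).
  have r10 : 0 < r1 by rewrite lt_max divr_gt0.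
  have r1l : r1 < normc l by rewrite gt_max; apply/andP; split; lra.
  have lr2 : normc l < r2 by rewrite lt_min lr ltrDl divr_gt0.
  have r2r : r2 <= r by rewrite ge_min lexx.
  have r1d : `|r1 - normc l| < d1.
    rewrite ltr0_norm ?subr_lt0// opprB ltrBlDr -ltrBlDl lt_max; apply/orP; right; lra.
  have r2d : `|r2 - normc l| < d1.
    rewrite gtr0_norm ?subr_gt0// ltrBlDr gt_min; apply/orP; right; lra.
  have /cvgC_distn /(_ _ e4)[N1 hN1] := @circle_mean_annulus R G r2 r
    (lt_trans nl lr2) r2r (fun w hw => dG w (le_lt_trans (proj2 (andP hw)) rrho)
      (ltac:(by apply: contraTneq hw => ->; rewrite leNgt lr2))).
  have /cvgC_distn /(_ _ e4)[N2 hN2] : (fun m => circle_mean m G r1) @ \oo --> (G 0 : Cx R).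
    apply: (@circle_mean_center _ _ (normc l)).
    - exact: r10.
    - exact: r1l.
    - move=> w _ wl; apply: dG; first by rewrite (lt_trans wl)// (lt_trans lr).
      by apply: contraTneq wl => ->; rewrite ltxx.
    - by apply: cG'; rewrite Normc.normc0 (lt_trans r0).
  exists (maxn N1 N2) => m; rewrite geq_max => /andP[/hN1 g1 /hN2 g2].
  move: g1 g2; rewrite G0 !subr0 => g1 g2.
  have g3 := hd1 r1 r1d m; have g4 := hd1 r2 r2d m.
  have -> : circle_mean m G r = (circle_mean m G r - circle_mean m G r2) +
    (circle_mean m G r2 - circle_mean m G (normc l)) -
    (circle_mean m G r1 - circle_mean m G (normc l)) + circle_mean m G r1 by ring.
  apply: le_lt_trans (normcD _ _) _; apply: le_lt_trans (lerD (normcB _ _) (lexx _)) _.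
  apply: le_lt_trans (lerD (lerD (normcD _ _) (lexx _)) (lexx _)) _; lra.
have := cvgCD mG (cvgCM (cvgC_cst (h l)) (circle_mean_kernel lr)).
rewrite add0r mulr1 (_ : (fun m => _) =
  (fun m => circle_mean m (fun w => w * h w / (w - l)) r))//; apply/funext => m.
rewrite -circle_meanZ -circle_meanD; apply: circle_mean_ext => [|w wr]; first exact: ltW.
have wl : w != l by apply: contraTneq lr => wl; rewrite -wl wr ltxx.
by rewrite GE// /q; field; rewrite subr_eq0.
Qed.

(** First order expansion of the powers of the Cauchy kernel, with a remainder
    that is uniform on circles: u and v will be 1 / (w - l - mu) and
    1 / (w - l). *)
Lemma inv_pow_taylor (u v mu : C) k : u - v = mu * (u * v) ->
  forall B : R, normc u <= B -> normc v <= B ->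
  normc (u ^+ k - v ^+ k - k%:R * mu * v ^+ k.+1) <= (k * k)%:R * B ^+ k.+2 * normc mu ^+ 2.
Proof.
move=> uv B uB vB.
have B0 : 0 <= B by exact: le_trans (normc_ge0 _) uB.
elim: k => [|k IH]; first by rewrite !expr0 subrr !mul0r subr0 Normc.normc0.
have -> : u ^+ k.+1 - v ^+ k.+1 - k.+1%:R * mu * v ^+ k.+2 =
  u * (u ^+ k - v ^+ k - k%:R * mu * v ^+ k.+1) + k.+1%:R * mu ^+ 2 * (u * v ^+ k.+2).
  have D0 : u - v - mu * (u * v) = 0 by rewrite uv subrr.
  apply/eqP; rewrite -subr_eq0; apply/eqP.
  transitivity ((u - v - mu * (u * v)) * (v ^+ k + k.+1%:R * mu * v ^+ k.+1)).
    by rewrite -natr1 !exprS; ring.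
  by rewrite D0 mul0r.
apply: le_trans (normcD _ _) _.
have -> : (k.+1 * k.+1)%:R * B ^+ k.+3 * normc mu ^+ 2 =
  B * ((k * k)%:R * B ^+ k.+2 * normc mu ^+ 2) +
  (k + k.+1)%:R * B ^+ k.+3 * normc mu ^+ 2 :> R.
  by rewrite !natrM natrD -natr1 !exprS; ring.
apply: lerD; first by rewrite Normc.normcM ler_pM ?normc_ge0.
rewrite Normc.normcM (Normc.normcM k.+1%:R) (Normc.normcM u) !normcX normc_nat.
rewrite mulrAC; apply: ler_wpM2r; first by rewrite exprn_ge0 ?normc_ge0.
apply: ler_pM => //; first by rewrite mulr_ge0 ?exprn_ge0 ?normc_ge0.
  by rewrite ler_nat leq_addl.
rewrite [leRHS]exprS; apply: ler_pM; rewrite ?exprn_ge0 ?normc_ge0//.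
by rewrite lerXn2r ?nnegrE ?normc_ge0.
Qed.

(** H k l stands for the k-th Taylor coefficient of h at l.  It is the limit in
    m of the Cauchy means Phi m k l; these satisfy the expansion of
    [inv_pow_taylor] in l uniformly in m, which gives the existence of the
    limit for k.+1 from that for k as well as the derivative of H k.  The
    bounds are those of the kernel and of the geometric series on the circle
    of radius r. *)
Lemma taylor_disc h rho r (M : R) : 0 < r -> r < rho ->
  (forall w, normc w < rho -> differentiable (h : Cx R -> Cx R) (w : Cx R)) ->
  (forall w, normc w = r -> normc (h w) <= M) ->
  exists H : nat -> C -> C,
  [/\ forall l, normc l < r -> H 0%N l = h l,
      forall k l, normc l < r -> forall e : R, 0 < e -> exists2 d : R, 0 < d &
        forall mu, normc mu < d ->
          normc (H k (l + mu) - H k l - mu * (k.+1%:R * H k.+1 l)) <= e * normc mu,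
      forall k, normc (H k 0) <= M / r ^+ k &
      forall n l, normc l < r -> normc (h l - \sum_(i < n) H i 0 * l ^+ i) <=
        M * (normc l / r) ^+ n * (r / (r - normc l))].
Proof.
move=> r0 rrho dh hM.
have M0 : 0 <= M.
  apply: le_trans (normc_ge0 _) (hM r%:C _); by rewrite normc_realE gtr0_norm.
(* (w - l)^-(k+1) is the k-th derivative of 1 / (w - l), up to k! *)
pose Phi m k l := circle_mean m (fun w => w * h w / (w - l) ^+ k.+1) r.
have wl_neq w l : normc w = r -> normc l < r -> w - l != 0.
  by move=> wr lr; rewrite subr_eq0; apply: contraTneq lr => <-; rewrite wr ltxx.
have wl_ge w l : normc w = r -> r - normc l <= normc (w - l).
  by move=> <-; exact: normc_lerB.
have step k l : normc l < r -> exists K d : R, [/\ 0 <= K, 0 < d, normc l + d < r &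
    forall mu m, normc mu <= d ->
    normc (Phi m k (l + mu) - Phi m k l - mu * (k.+1%:R * Phi m k.+1 l)) <=
      K * normc mu ^+ 2].
  move=> lr; pose d := (r - normc l) / 2; have d0 : 0 < d by rewrite divr_gt0// subr_gt0.
  exists (r * M * ((k.+1 * k.+1)%:R * d^-1 ^+ k.+3)), d.
  split; [|exact: d0|by rewrite /d; lra|].
    by apply: mulr_ge0; apply: mulr_ge0; rewrite ?exprn_ge0 ?invr_ge0 ?(ltW r0) ?(ltW d0).
  move=> mu m mud; rewrite /Phi (mulrA mu) -circle_meanZ -!circle_meanB.
  apply: circle_mean_bound => [|w wr]; first exact: ltW.
  have lmr : normc (l + mu) < r by apply: le_lt_trans (normcD _ _) _; rewrite /d in mud; lra.
  have n1 := wl_neq _ _ wr lr; have n2 := wl_neq _ _ wr lmr.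
  have -> : w * h w / (w - (l + mu)) ^+ k.+1 - w * h w / (w - l) ^+ k.+1 -
      mu * k.+1%:R * (w * h w / (w - l) ^+ k.+2) =
    w * h w * ((w - (l + mu))^-1 ^+ k.+1 - (w - l)^-1 ^+ k.+1 -
      k.+1%:R * mu * (w - l)^-1 ^+ k.+2) by rewrite -!exprVn; ring.
  rewrite Normc.normcM (Normc.normcM w) wr -[leRHS]mulrA.
  apply: ler_pM; rewrite ?mulr_ge0 ?normc_ge0 ?(ltW r0)//.
    by rewrite ler_wpM2l ?(ltW r0) ?hM.
  apply: inv_pow_taylor; first by field; rewrite n1 n2.
    rewrite Normc.normcV lef_pV2 ?posrE ?normc_gt0//.
    apply: le_trans (wl_ge _ _ wr); have := normcD l mu; rewrite /d in mud *; lra.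
  rewrite Normc.normcV lef_pV2 ?posrE ?normc_gt0//.
  by apply: le_trans (wl_ge _ _ wr); rewrite /d; lra.
have cvPhi k l : normc l < r -> exists y : Cx R, (fun m => Phi m k l) @ \oo --> y.
  elim: k l => [|k IH] l lr.
    exists (h l); have := cauchy_formula rrho lr dh.
    by under eq_fun do under eq_fun do rewrite -[w in _ / w]expr1.
  have [K [d [K0 d0 ld hK]]] := step k l lr.
  apply: cauchyC_cvg => e e0.
  (* k.+1 Phi m k.+1 l is a difference quotient of Phi m k with step t, up to K t, and
     the difference quotients converge by induction *)
  pose t := Num.min d (e / (4 * (K + 1))).
  have t0 : 0 < t by rewrite lt_min d0 divr_gt0// mulr_gt0//; lra.
  have td : t <= d by rewrite ge_min lexx.
  have Kt : 4 * K * t < e.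
    have : t <= e / (4 * (K + 1)) by rewrite ge_min lexx orbT.
    rewrite ler_pdivlMr; [nra | lra].
  have nt : normc (t%:C : C) = t by rewrite normc_realE gtr0_norm.
  have lt' : normc (l + t%:C) < r by apply: le_lt_trans (normcD _ _) _; rewrite nt; lra.
  have [y1 /cvgC_distn c1] := IH _ lt'; have [y2 /cvgC_distn c2] := IH _ lr.
  have et : 0 < e * t / 8 by rewrite divr_gt0// mulr_gt0.
  have [N1 h1] := c1 _ et; have [N2 h2] := c2 _ et.
  exists (maxn N1 N2) => m n; rewrite !geq_max => /andP[m1 m2] /andP[n1 n2].
  have := hK t%:C m; have := hK t%:C n; rewrite nt => /(_ td) gn /(_ td) gm.
  have k1 : 1 <= k.+1%:R :> R by rewrite ler1n.
  have D0 := normc_ge0 (Phi m k.+1 l - Phi n k.+1 l).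
  suff : t * normc (Phi m k.+1 l - Phi n k.+1 l) < t * e by rewrite ltr_pM2l.
  apply: (@le_lt_trans _ _ (normc (t%:C * (k.+1%:R * (Phi m k.+1 l - Phi n k.+1 l))))).
    by rewrite !Normc.normcM nt normc_nat ler_wpM2l ?(ltW t0)// ler_peMl.
  have -> : t%:C * (k.+1%:R * (Phi m k.+1 l - Phi n k.+1 l)) =
    (Phi n k (l + t%:C) - Phi n k l - t%:C * (k.+1%:R * Phi n k.+1 l)) -
    (Phi m k (l + t%:C) - Phi m k l - t%:C * (k.+1%:R * Phi m k.+1 l)) +
    (Phi m k (l + t%:C) - y1) - (Phi n k (l + t%:C) - y1) -
    ((Phi m k l - y2) - (Phi n k l - y2)) by ring.
  have a1 := h1 _ m1; have a2 := h1 _ n1; have a3 := h2 _ m2; have a4 := h2 _ n2.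
  apply: le_lt_trans (normcB _ _) _.
  apply: le_lt_trans (lerD (normcB _ _) (normcB _ _)) _.
  apply: le_lt_trans (lerD (lerD (normcD _ _) (lexx _)) (lexx _)) _.
  apply: le_lt_trans (lerD (lerD (lerD (normcB _ _) (lexx _)) (lexx _)) (lexx _)) _.
  nra.
pose P k l : set (Cx R) := [set y | (fun m => Phi m k l) @ \oo --> y].
pose H k l : C := xget 0 (P k l).
have HP k l : normc l < r -> (fun m => Phi m k l) @ \oo --> (H k l : Cx R).
  by move=> lr; have [y hy] := cvPhi k l lr; by rewrite -[_ --> _]/(P k l (H k l)); apply: xgetPex; exists y.
exists H; split.
- move=> l lr; apply: cvgC_uniq (HP 0%N l lr) _; have := cauchy_formula rrho lr dh.
  by under eq_fun do under eq_fun do rewrite -[w in _ / w]expr1.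
- move=> k l lr e e0; have [K [d [K0 d0 ld hK]]] := step k l lr.
  exists (Num.min d (e / (K + 1))).
    by rewrite lt_min d0 divr_gt0//; lra.
  move=> mu; rewrite lt_min => /andP[mud mue].
  have lmr : normc (l + mu) < r by apply: le_lt_trans (normcD _ _) _; lra.
  have cv := cvgCB (cvgCB (HP k _ lmr) (HP k _ lr))
    (cvgCM (cvgC_cst mu) (cvgCM (cvgC_cst k.+1%:R) (HP k.+1 _ lr))).
  apply: le_trans (cvgC_normc_le cv (M := K * normc mu ^+ 2) _) _.
    by exists 0%N => // m _ /=; exact/hK/ltW.
  rewrite expr2 mulrA ler_wpM2r ?normc_ge0//.
  move: mue; rewrite ltr_pdivlMr; last by lra.
  have := normc_ge0 mu; nra.
- move=> k; apply: cvgC_normc_le (HP k 0 _) _; first by rewrite Normc.normc0.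
  exists 0%N => // m _ /=; apply: circle_mean_bound => [|w wr]; first exact: ltW.
  have w0 : w != 0 by rewrite -normc_gt0 wr.
  rewrite subr0 !Normc.normcM Normc.normcV normcX wr exprS invfM mulrACA divff ?gt_eqF//.
  by rewrite mul1r ler_wpM2r ?invr_ge0 ?exprn_ge0 ?(ltW r0) ?hM.
- move=> n l lr.
  have cvS : (fun m => \sum_(i < n) Phi m i 0 * l ^+ i) @ \oo -->
      (\sum_(i < n) H i 0 * l ^+ i : Cx R).
    elim: n => [|n IH].
      rewrite big_ord0; under eq_fun do rewrite big_ord0; exact: cvgC_cst.
    rewrite big_ord_recr /=; under eq_fun do rewrite big_ord_recr /=.
    apply: cvgCD IH (cvgCM (HP _ _ _) (cvgC_cst _)).
    by rewrite Normc.normc0.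
  have cv := cvgCB (cauchy_formula rrho lr dh) cvS.
  apply: cvgC_normc_le cv _; exists 0%N => // m _ /=.
  have -> : \sum_(i < n) Phi m i 0 * l ^+ i =
    circle_mean m (fun w => \sum_(i < n) (w * h w / (w - 0) ^+ i.+1) * l ^+ i) r.
    elim: n {cvS} => [|n IH].
      rewrite big_ord0 -[LHS](circle_mean_cst m 0 r); apply: circle_mean_ext; first exact: ltW.
      by move=> w _; rewrite big_ord0.
    rewrite big_ord_recr /= IH [_ * l ^+ n]mulrC -circle_meanZ -circle_meanD.
    apply: circle_mean_ext; first exact: ltW.
    by move=> w _; rewrite big_ord_recr /= [l ^+ n * _]mulrC.
  rewrite -circle_meanB; apply: circle_mean_bound => [|w wr]; first exact: ltW.
  have w0 : w != 0 by rewrite -normc_gt0 wr.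
  have wl := wl_neq _ _ wr lr.
  have -> : w * h w / (w - l) - \sum_(i < n) w * h w / (w - 0) ^+ i.+1 * l ^+ i =
    h w * (l / w) ^+ n * (w / (w - l)).
    elim: n {cvS} => [|n IH]; first by rewrite big_ord0 expr0 subr0 mulr1; ring.
    rewrite big_ord_recr /= opprD addrA IH subr0 !exprMn -!exprVn.
    rewrite !exprS; have : w * w^-1 = 1 by rewrite divff.
    move=> ww; field; rewrite ?wl ?w0 //.
  rewrite Normc.normcM (Normc.normcM (h w)) (Normc.normcM w) normcX.
  rewrite (Normc.normcM l) !Normc.normcV wr.
  have q0 : 0 <= normc l / r by rewrite divr_ge0 ?normc_ge0 ?(ltW r0).
  have nwl : 0 < normc (w - l) by rewrite normc_gt0.
  have p0 : 0 <= (normc l / r) ^+ n by rewrite exprn_ge0.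
  apply: ler_pM.
  - by rewrite mulr_ge0 ?normc_ge0.
  - by rewrite divr_ge0 ?(ltW r0) ?(ltW nwl).
  - by rewrite ler_wpM2r ?hM.
  rewrite ler_wpM2l ?(ltW r0)// lef_pV2 ?posrE ?subr_gt0//.
  exact: wl_ge.
Qed.

End cauchy_formula.

(** * Holomorphic functions on a normed space *)

Section holomorphic_functions.
Context {R : realType} {V : normedModType R[i]}.
Local Notation C := R[i].
Implicit Types (f g : V -> Cx R) (x y v w : V).

(** The k-th derivative along w divided by k!, that is, the coefficient of l^k in the
    expansion of f (y + l w). *)
Definition taylor_coef f (k : nat) w y : Cx R :=
  (k`!%:R)^-1 * iter k (fun g => 'D_w g) f y.

Lemma derive_limE g x w (D : Cx R) :
  (forall e : R, 0 < e -> exists2 d : R, 0 < d & forall t : C, t != 0 -> normc t < d ->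
     normc (t^-1 * (g (x + t *: w) - g x) - D) <= e) ->
  'D_w g x = D.
Proof.
move=> h; apply: cvg_lim; first exact: norm_hausdorff.
apply/cvgrPdist_lt => e /gt0_complexE[-> e0].
have [d d0 hd] := h _ (divr_gt0 e0 (ltr0Sn R 1)).
apply/nbhs_ballP; exists d%:C => /=; first by rewrite ltcR.
move=> t; rewrite -ball_normE /= sub0r normrN normc_normr ltcR => td t0.
rewrite distrC normc_normr ltcR.
apply: (@le_lt_trans _ _ (complex.Re e / 2)); last by lra.
by rewrite (addrC _ x); exact: hd.
Qed.

Lemma derive_approx g x w : derivable g x w -> forall e : R, 0 < e ->
  exists2 d : R, 0 < d & forall t : C, t != 0 -> normc t < d ->
     normc (t^-1 * (g (x + t *: w) - g x) - 'D_w g x) < e.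
Proof.
move=> dg e e0; have e0C : 0 < e%:C by rewrite ltcR.
move/cvgrPdist_lt : (dg) => /(_ _ e0C)/nbhs_ballP[d /= d0 hd].
have [dE {}d0] := gt0_complexE d0.
exists (complex.Re d) => // t t0 td; rewrite (addrC x).
have := hd t; rewrite -ball_normE /= sub0r normrN normc_normr dE ltcR => /(_ td t0).
by rewrite distrC normc_normr ltcR.
Qed.

Lemma differentiable_line y w (l : Cx R) :
  differentiable (fun a : Cx R => y + (a : C) *: w) l.
Proof.
apply: differentiableD; first exact: differentiable_cst.
exact: ex_diff.
Qed.

(** The restriction of f to the complex line through y in the direction w is
    holomorphic, and its iterated derivatives are the functions k! H k of
    [taylor_disc]. *)
Lemma taylor_line f y w (rho r M : R) : 0 < r -> r < rho ->
  (forall l : C, normc l < rho -> differentiable f (y + l *: w)) ->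
  (forall l : C, normc l = r -> normc (f (y + l *: w)) <= M) ->
  (forall k, normc (taylor_coef f k w y) <= M / r ^+ k) /\
  (forall n (l : C), normc l < r ->
    normc (f (y + l *: w) - \sum_(i < n) taylor_coef f i w y * l ^+ i) <=
      M * (normc l / r) ^+ n * (r / (r - normc l))).
Proof.
move=> r0 rrho df fM; pose h (l : C) : C := f (y + l *: w).
have dh (l : C) : normc l < rho -> differentiable (h : Cx R -> Cx R) (l : Cx R).
  move=> lr; apply: (@differentiable_comp _ (Cx R) V (Cx R) (fun a => y + (a : C) *: w) f).
    exact: differentiable_line.
  exact: df.
have [H [H0 HD Hb HT]] := taylor_disc r0 rrho dh fM.
have key k (l : C) : normc l < r ->
    iter k (fun g => 'D_w g) f (y + l *: w) = k`!%:R * H k l.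
  elim: k l => [|k IH] l lr; first by rewrite fact0 mul1r H0.
  rewrite iterS; apply: derive_limE => e e0.
  have f0 : 0 < k`!%:R :> R by rewrite ltr0n fact_gt0.
  have [d d0 hd] := HD k l lr (e / k`!%:R) (divr_gt0 e0 f0).
  exists (Num.min d (r - normc l)); first by rewrite lt_min d0 subr_gt0.
  move=> t t0; rewrite lt_min => /andP[td tr].
  have ltr : normc (l + t) < r by apply: le_lt_trans (normcD _ _) _; lra.
  rewrite -addrA -scalerDl !IH//.
  have -> : t^-1 * (k`!%:R * H k (l + t) - k`!%:R * H k l) - (k.+1)`!%:R * H k.+1 l =
    k`!%:R * (t^-1 * (H k (l + t) - H k l - t * (k.+1%:R * H k.+1 l))) :> C.
    by rewrite factS natrM; field.
  rewrite !Normc.normcM Normc.normcV normc_nat.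
  have := hd t td => h1; have nt : 0 < normc t by rewrite normc_gt0.
  rewrite mulrC -ler_pdivlMr// mulrC ler_pdivrMr//.
have key0 k : taylor_coef f k w y = H k 0.
  rewrite /taylor_coef -[y in iter _ _ _ y]addr0 -(scale0r w) key ?Normc.normc0//.
  by rewrite mulKf// pnatr_eq0 -lt0n fact_gt0.
split=> [k|n l lr]; first by rewrite key0.
by under eq_bigr do rewrite key0; exact: HT.
Qed.

Lemma taylor_coef0 f w y : taylor_coef f 0 w y = f y.
Proof. by rewrite /taylor_coef fact0 invr1 mul1r. Qed.

Lemma taylor_coef1 f w y : taylor_coef f 1 w y = 'D_w f y.
Proof. by rewrite /taylor_coef factS fact0 invr1 mul1r. Qed.

Lemma line_in_ball y x w (l : C) (s : R) : nrm (x - y) + normc l * nrm w < s ->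
  nrm ((x + l *: w) - y) < s.
Proof.
by move=> h; rewrite addrAC; apply: le_lt_trans (nrmD _ _) _; rewrite nrmZ.
Qed.

(** The Taylor remainder of order 2 along the line through y and y + v, on which f
    is controlled up to the parameter rho / |v|. *)
Lemma quadratic_remainder f y (rho M : R) : 0 < rho ->
  (forall x, nrm (x - y) < rho -> differentiable f x) ->
  (forall x, nrm (x - y) < rho -> normc (f x) <= M) ->
  forall v, nrm v <= rho / 4 ->
    normc (f (y + v) - f y - 'd f y v) <= (8 * M / rho ^+ 2) * nrm v ^+ 2.
Proof.
move=> rho0 df fM v vr.
have M0 : 0 <= M by apply: le_trans (normc_ge0 _) (fM y _); rewrite subrr nrm0.
have [v0|v0] := eqVneq (nrm v) 0.
  by rewrite (nrm_eq0 v0) addr0 subrr linear0 subr0 Normc.normc0 nrm0 expr0n mulr0.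
have nv : 0 < nrm v by rewrite lt_def v0 nrm_ge0.
have r0 : 0 < rho / (2 * nrm v) by rewrite divr_gt0// mulr_gt0.
have rr : rho / (2 * nrm v) < rho / nrm v.
  by rewrite ltr_pM2l// ltf_pV2 ?posrE ?mulr_gt0//; lra.
have lin (l : C) : normc l < rho / nrm v -> nrm ((y + l *: v) - y) < rho.
  move=> h; apply: line_in_ball; rewrite subrr nrm0 add0r.
  by rewrite -ltr_pdivlMr.
have r2 : 2 <= rho / (2 * nrm v) by rewrite ler_pdivlMr ?mulr_gt0//; lra.
set r := rho / (2 * nrm v) in r0 rr r2.
have [|_ /(_ 2%N 1)] := @taylor_line f y v _ _ M r0 rr (fun l hl => df _ (lin l hl)).
  by move=> l lr; apply: fM; apply: lin; rewrite lr.
rewrite Normc.normc1 => /(_ ltac:(lra)).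
rewrite !big_ord_recr big_ord0 /= add0r taylor_coef0 taylor_coef1 expr0 expr1 !mulr1 scale1r.
rewrite -deriveE; last by apply: df; rewrite subrr nrm0.
rewrite opprD addrA => /le_trans; apply.
have -> : 8 * M / rho ^+ 2 * nrm v ^+ 2 = M * (1 / r) ^+ 2 * 2.
  by rewrite /r; field; rewrite !gt_eqF.
apply: ler_wpM2l; first by apply: mulr_ge0 => //; rewrite exprn_ge0// divr_ge0// ltW.
by rewrite ler_pdivrMr; lra.
Qed.

(** No continuity of the linear part L has to be assumed: local bounds of f and of
    the remainder bound L on a ball.  This matters where L is only known as a
    pointwise limit, or through a character. *)
Lemma quadratic_diff f x (L : V -> Cx R) (rho K M : R) : linear L -> 0 < rho ->
  (forall v, nrm v < rho -> normc (f (x + v)) <= M) ->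
  (forall v, nrm v < rho -> normc (f (x + v) - f x - L v) <= K * nrm v ^+ 2) ->
  differentiable f x.
Proof.
move=> lL rho0 fM fK.
pose LL : {linear V -> Cx R} := HB.pack L (GRing.isLinear.Build R[i] V (Cx R) *:%R L lL).
have LE : LL = L :> (V -> Cx R) by [].
pose K0 := Num.max 0 K.
have K00 : 0 <= K0 by rewrite le_max lexx.
have KK0 : K <= K0 by rewrite le_max lexx orbT.
have fK0 v : nrm v < rho -> normc (f (x + v) - f x - LL v) <= K0 * nrm v ^+ 2.
  by move=> vr; apply: le_trans (fK _ vr) _; rewrite ler_wpM2r ?sqr_ge0.
pose A := 2 * M + K0 * rho ^+ 2.
have LA v : nrm v < rho -> normc (LL v) <= A.
  move=> vr.
  have -> : LL v = f (x + v) - f x - (f (x + v) - f x - LL v) by ring.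
  apply: le_trans (normcB _ _) _; apply: le_trans (lerD (normcB _ _) (fK0 _ vr)) _.
  have h1 := fM _ vr; have := fM 0; rewrite addr0 nrm0 => /(_ rho0) h2.
  rewrite /A; have : K0 * nrm v ^+ 2 <= K0 * rho ^+ 2.
    by rewrite ler_wpM2l// lerXn2r ?nnegrE ?nrm_ge0 ?(ltW rho0)// ltW.
  lra.
have A0 : 0 <= A by apply: le_trans (normc_ge0 (LL 0)) (LA 0 _); rewrite nrm0.
have LB v : normc (LL v) <= (2 * A / rho) * nrm v.
  have [v0|v0] := eqVneq (nrm v) 0.
    by rewrite (nrm_eq0 v0) linear0 Normc.normc0 nrm0 mulr0.
  have nv : 0 < nrm v by rewrite lt_def v0 nrm_ge0.
  have c0 : 0 < rho / (2 * nrm v) by rewrite divr_gt0// mulr_gt0.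
  have := LA ((rho / (2 * nrm v))%:C *: v); rewrite nrmZ linearZ normc_realE gtr0_norm//.
  have -> : rho / (2 * nrm v) * nrm v = rho / 2 by field; rewrite gt_eqF.
  rewrite -[X in normc X]/((rho / (2 * nrm v))%:C * LL v) Normc.normcM normc_realE gtr0_norm//.
  move=> /(_ ltac:(lra)); rewrite -ler_pdivlMl// => /le_trans; apply.
  by rewrite invf_div; have -> : 2 * A / rho * nrm v = 2 * nrm v / rho * A by ring.
have cL : continuous LL := normc_bounded_continuous LB.
apply: proj1 (@eps_diff R V f x LL cL _) => e e0.
exists (Num.min rho (e / (K0 + 1))); first by rewrite lt_min rho0 divr_gt0// ltr_wpDl.
move=> v; rewrite lt_min => /andP[vr ve]; apply: le_trans (fK0 _ vr) _.
rewrite expr2 mulrA ler_wpM2r ?nrm_ge0//.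
move: ve; rewrite ltr_pdivlMr ?ltr_wpDl// => ve; have := nrm_ge0 v; nra.
Qed.

(** A substitute for the Weierstrass theorem: the quadratic remainders of the g n are
    uniformly controlled by the bound M, so pointwise convergence forces the
    differentials at y to converge, and the limit inherits the expansion. *)
Lemma bounded_limit_diff (g : nat -> V -> Cx R) f y (rho M : R) : 0 < rho ->
  (forall n x, nrm (x - y) < rho -> differentiable (g n) x) ->
  (forall n x, nrm (x - y) < rho -> normc (g n x) <= M) ->
  (forall x, nrm (x - y) < rho -> (fun n => g n x) @ \oo --> f x) ->
  differentiable f y.
Proof.
move=> rho0 dg gM gf.
have M0 : 0 <= M by apply: le_trans (normc_ge0 _) (gM 0%N y _); rewrite subrr nrm0.
pose K := 8 * M / rho ^+ 2.
have K0 : 0 <= K by rewrite divr_ge0 ?mulr_ge0 ?exprn_ge0 ?(ltW rho0).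
have gK n v : nrm v <= rho / 4 ->
    normc (g n (y + v) - g n y - 'd (g n) y v) <= K * nrm v ^+ 2.
  by apply: quadratic_remainder => // x xy; [exact: dg|exact: gM].
have yv v : nrm v < rho -> nrm ((y + v) - y) < rho by rewrite addrAC subrr add0r.
have cL v : exists l : Cx R, (fun n => 'd (g n) y v) @ \oo --> l.
  apply: cauchyC_cvg => e e0.
  pose N := nrm v; have N0 : 0 <= N := nrm_ge0 v.
  pose t := Num.min (rho / (4 * (N + 1))) (e / (4 * (K * N ^+ 2 + 1))).
  have d1 : 0 < K * N ^+ 2 + 1 by rewrite ltr_wpDl// mulr_ge0// exprn_ge0.
  have t0 : 0 < t by rewrite lt_min !divr_gt0// mulr_gt0// ltr_wpDl.
  have tN : t * N <= rho / 4.
    have : t <= rho / (4 * (N + 1)) by rewrite ge_min lexx.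
    rewrite ler_pdivlMr ?mulr_gt0 ?ltr_wpDl//; nra.
  have tK : 4 * K * N ^+ 2 * t < e.
    have : t <= e / (4 * (K * N ^+ 2 + 1)) by rewrite ge_min lexx orbT.
    rewrite ler_pdivlMr ?mulr_gt0//; nra.
  have nt : nrm (t%:C *: v) = t * N by rewrite nrmZ normc_realE gtr0_norm.
  have ytv : nrm ((y + t%:C *: v) - y) < rho.
    by apply: yv; rewrite nt; apply: le_lt_trans tN _; lra.
  have y0 : nrm (y - y) < rho by rewrite subrr nrm0.
  have /cvgC_distn c1 := gf _ ytv; have /cvgC_distn c2 := gf _ y0.
  have et : 0 < e * t / 8 by rewrite divr_gt0// mulr_gt0.
  have [N1 h1] := c1 _ et; have [N2 h2] := c2 _ et.
  exists (maxn N1 N2) => m n; rewrite !geq_max => /andP[m1 m2] /andP[n1 n2].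
  have := gK m (t%:C *: v); have := gK n (t%:C *: v); rewrite nt => /(_ tN) gn /(_ tN) gm.
  have dZ k : 'd (g k) y (t%:C *: v) = t%:C * 'd (g k) y v by rewrite linearZ.
  rewrite dZ in gm; rewrite dZ in gn.
  suff : t * normc ('d (g m) y v - 'd (g n) y v) < t * e by rewrite ltr_pM2l.
  have -> : t * normc ('d (g m) y v - 'd (g n) y v) =
      normc (t%:C * ('d (g m) y v - 'd (g n) y v)).
    by rewrite Normc.normcM normc_realE gtr0_norm.
  have alg (c D D' a b a' b' f1 f2 : C) : c * (D - D') =
      (b - b' - c * D') - (a - a' - c * D) + (a - f1) - (b - f1) - ((a' - f2) - (b' - f2)).
    by ring.
  rewrite (alg _ _ _ (g m (y + t%:C *: v)) (g n (y + t%:C *: v)) (g m y) (g n y)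
    (f (y + t%:C *: v)) (f y)).
  have a1 := h1 _ m1; have a2 := h1 _ n1; have a3 := h2 _ m2; have a4 := h2 _ n2.
  apply: le_lt_trans (normcB _ _) _.
  apply: le_lt_trans (lerD (normcB _ _) (normcB _ _)) _.
  apply: le_lt_trans (lerD (lerD (normcD _ _) (lexx _)) (lexx _)) _.
  apply: le_lt_trans (lerD (lerD (lerD (normcB _ _) (lexx _)) (lexx _)) (lexx _)) _.
  have fin (x1 x2 x3 x4 x5 x6 : R) : x1 <= K * (t * N) ^+ 2 -> x2 <= K * (t * N) ^+ 2 ->
      x3 < e * t / 8 -> x4 < e * t / 8 -> x5 < e * t / 8 -> x6 < e * t / 8 ->
      x1 + x2 + x3 + x4 + (x5 + x6) < t * e.
    have : t * (4 * K * N ^+ 2 * t) < t * e by rewrite ltr_pM2l.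
    rewrite exprMn; clear; lra.
  exact: (fin _ _ _ _ _ _ gn gm a1 a2 a3 a4).
have [L LP] := choice cL.
have lL : linear L.
  move=> a u v; apply: cvgC_uniq (LP _) _.
  under eq_fun do rewrite linearP.
  exact: cvgCD (cvgCM (cvgC_cst a) (LP u)) (LP v).
apply: (@quadratic_diff f y L (rho / 4) K M lL).
- by rewrite divr_gt0.
- move=> v vr; have vr' : nrm v < rho by lra.
  apply: cvgC_normc_le (gf _ (yv _ vr')) _.
  by exists 0%N => // n _ /=; apply: gM; exact: yv.
- move=> v vr; have vr' : nrm v < rho by lra.
  have y0 : nrm (y - y) < rho by rewrite subrr nrm0.
  apply: cvgC_normc_le (cvgCB (cvgCB (gf _ (yv _ vr')) (gf _ y0)) (LP v)) _.
  by exists 0%N => // n _ /=; apply: gK; exact: ltW.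
Qed.

End holomorphic_functions.

(** * Functions of bounded type on the ball and entire functions of polynomial growth *)

Section bounded_type_functions.
Context {R : realType} {V : normedModType R[i]}.
Local Notation C := R[i].
Implicit Types (F P : V -> Cx R) (x y v w : V).

(** The algebra of the ball in terms of functions on the whole space, so that derivatives
    and translates need no restriction of their domain. *)
Definition hol_bt F := (forall x, nrm x < 1 -> differentiable F x) /\
  (forall s : R, 0 < s < 1 -> exists M : R, forall x, nrm x < s -> normc (F x) <= M).

(** These functions are the polynomials of degree at most m; this form makes
    stability under translation immediate. *)
Definition entire_growth (m : nat) P := (forall x, differentiable P x) /\
  exists K : R, forall x, normc (P x) <= K * (1 + nrm x) ^+ m.

Lemma taylor_local F y w (rho M : R) :
  (forall x, nrm (x - y) < rho -> differentiable F x) ->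
  (forall x, nrm (x - y) < rho -> normc (F x) <= M) ->
  forall x (r : R), 0 < r -> nrm (x - y) + r * nrm w < rho ->
  (forall k, normc (taylor_coef F k w x) <= M / r ^+ k) /\
  (forall n (l : C), normc l < r ->
    normc (F (x + l *: w) - \sum_(i < n) taylor_coef F i w x * l ^+ i) <=
      M * (normc l / r) ^+ n * (r / (r - normc l))).
Proof.
move=> dF FM x r r0 yw.
pose d := (rho - (nrm (x - y) + r * nrm w)) / (nrm w + 1).
have w1 : 0 < nrm w + 1 by rewrite ltr_wpDl ?nrm_ge0.
have d0 : 0 < d by rewrite divr_gt0// subr_gt0.
have rd : nrm (x - y) + (r + d) * nrm w < rho.
  have : d * (nrm w + 1) = rho - (nrm (x - y) + r * nrm w) by rewrite /d mulfVK ?gt_eqF.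
  by lra.
have lin (l : C) : normc l <= r + d -> nrm (x + l *: w - y) < rho.
  move=> lr; apply: line_in_ball; apply: le_lt_trans rd.
  by rewrite lerD2l ler_wpM2r ?nrm_ge0.
apply: (@taylor_line _ _ F x w (r + d)) => //; first by rewrite ltrDl.
  by move=> l /ltW lr; apply: dF; apply: lin.
by move=> l lr; apply: FM; apply: lin; rewrite lr lerDl ltW.
Qed.

Lemma taylor_ball F (s M r : R) y w : s <= 1 ->
  (forall x, nrm x < 1 -> differentiable F x) ->
  (forall x, nrm x < s -> normc (F x) <= M) -> 0 < r -> nrm y + r * nrm w < s ->
  (forall k, normc (taylor_coef F k w y) <= M / r ^+ k) /\
  (forall n (l : C), normc l < r ->
    normc (F (y + l *: w) - \sum_(i < n) taylor_coef F i w y * l ^+ i) <=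
      M * (normc l / r) ^+ n * (r / (r - normc l))).
Proof.
move=> s1 dF FM r0 yw; apply: (@taylor_local F 0 w s); rewrite ?subr0//.
- by move=> x; rewrite subr0 => xs; apply: dF; exact: lt_le_trans s1.
- by move=> x; rewrite subr0; exact: FM.
Qed.

(** The derivative along w is a bounded limit of difference quotients. *)
Lemma derive_differentiable F y w (rho M : R) : 0 < rho ->
  (forall x, nrm (x - y) < rho -> differentiable F x) ->
  (forall x, nrm (x - y) < rho -> normc (F x) <= M) ->
  differentiable ('D_w F) y.
Proof.
move=> rho0 dF FM.
have M0 : 0 <= M by apply: le_trans (normc_ge0 _) (FM y _); rewrite subrr nrm0.
pose r := rho / (4 * (nrm w + 1)).
have w1 : 0 < nrm w + 1 by rewrite ltr_wpDl ?nrm_ge0.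
have r0 : 0 < r by rewrite divr_gt0// mulr_gt0.
have rw : r * nrm w <= rho / 4.
  have : r * (4 * (nrm w + 1)) = rho by rewrite /r mulfVK// gt_eqF// mulr_gt0.
  by have := nrm_ge0 w; lra.
pose t (n : nat) : R := r / 2 / n.+1%:R.
have t0 n : 0 < t n := divr_gt0 (divr_gt0 r0 (ltr0Sn R 1)) (ltr0Sn R n).
have tr n : t n <= r / 2.
  rewrite ler_pdivrMr ?ltr0Sn//; apply: ler_peMr; last by rewrite ler1n.
  exact/ltW/divr_gt0.
have nt n : normc (t n)%:C = t n by rewrite normc_realE gtr0_norm.
have xw x n : nrm (x - y) < rho / 2 -> nrm (x + (t n)%:C *: w - y) < rho.
  move=> xy; apply: line_in_ball; rewrite nt.
  have : t n * nrm w <= r / 2 * nrm w by rewrite ler_wpM2r ?nrm_ge0.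
  have := nrm_ge0 w; lra.
pose g n x : Cx R := (t n)%:C^-1 * (F (x + (t n)%:C *: w) - F x).
apply: (@bounded_limit_diff _ _ g _ _ (rho / 2) (2 * M / r)); first by rewrite divr_gt0.
- move=> n x xy.
  have d1 : differentiable (fun x : V => F (x + (t n)%:C *: w)) x.
    apply: (@differentiable_comp _ V V (Cx R) (fun x => x + (t n)%:C *: w) F).
      by apply: differentiableD; [exact: ex_diff|exact: differentiable_cst].
    exact: dF (xw _ _ xy).
  have d2 : differentiable F x by apply: dF; lra.
  have := @differentiableZ _ V (Cx R) _ ((t n)%:C^-1) x (differentiableB d1 d2).
  by apply.
- move=> n x xy.
  have [|_ /(_ 1%N (t n)%:C)] := @taylor_local F y w rho M dF FM x r r0.
    by lra.
  rewrite nt => /(_ ltac:(have := tr n; lra)).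
  rewrite big_ord_recr big_ord0 /= add0r taylor_coef0 expr0 mulr1 expr1 => h.
  rewrite Normc.normcM Normc.normcV nt mulrC ler_pdivrMr//.
  apply: le_trans h _.
  have h2 : r / (r - t n) <= 2.
    rewrite ler_pdivrMr; have := tr n; lra.
  have -> : 2 * M / r * t n = M * (t n / r) * 2 by ring.
  apply: ler_wpM2l => //; apply: mulr_ge0 => //.
  exact: divr_ge0 (ltW (t0 n)) (ltW r0).
- move=> x xy; apply/cvgC_distn => e e0.
  have dFx : derivable F x w by apply: diff_derivable; apply: dF; lra.
  have [d d0 hd] := derive_approx dFx e0.
  exists (Num.truncn (d^-1 * (r / 2))).+1 => n nd.
  apply: hd.
    by rewrite -normc_eq0 nt gt_eqF.
  rewrite nt ltr_pdivrMr ?ltr0Sn// -ltr_pdivrMl//.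
  apply: lt_le_trans (truncnS_gt _) _.
  by rewrite ler_nat; exact: leqW.
Qed.

Lemma hol_bt_derive F w : hol_bt F -> hol_bt ('D_w F).
Proof.
move=> [dF bF]; split=> [x x1|s /andP[s0 s1]].
  pose rho := (1 - nrm x) / 2.
  have rho0 : 0 < rho by rewrite divr_gt0// subr_gt0.
  have n0 := nrm_ge0 x.
  have [|M hM] := bF (1 - rho); first by apply/andP; split; rewrite /rho; lra.
  have xr z : nrm (z - x) < rho -> nrm z < 1 - rho.
    move=> zx; rewrite -(subrK x z); apply: le_lt_trans (nrmD _ _) _.
    by move: zx; rewrite /rho; lra.
  apply: (@derive_differentiable F x w rho M) => // z /xr zr; last exact: hM.
  by apply: dF; lra.
pose s' := (1 + s) / 2.
have [|M hM] := bF s'; first by apply/andP; split; rewrite /s'; lra.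
pose r := (1 - s) / (4 * (nrm w + 1)).
have w1 : 0 < nrm w + 1 by rewrite ltr_wpDl ?nrm_ge0.
have r0 : 0 < r by rewrite divr_gt0// ?mulr_gt0// subr_gt0.
have rw : r * nrm w <= (1 - s) / 4.
  have : r * (4 * (nrm w + 1)) = 1 - s by rewrite /r mulfVK// gt_eqF// mulr_gt0.
  by have := nrm_ge0 w; lra.
exists (M / r) => x xs.
have [||/(_ 1%N) + _] := @taylor_ball F s' M r x w _ dF hM r0.
- by rewrite /s'; lra.
- by rewrite /s'; lra.
by rewrite taylor_coef1.
Qed.

Lemma hol_bt_cst (c : Cx R) : hol_bt (fun=> c).
Proof.
split=> [x _|s _]; first exact: differentiable_cst.
by exists (normc c).
Qed.

Lemma hol_btZ (c : C) F : hol_bt F -> hol_bt (fun x => c * F x).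
Proof.
move=> [dF bF]; split=> [x x1|s /bF[M hM]].
  exact: (@differentiableZ _ V (Cx R) F c x (dF x x1)).
exists (normc c * M) => x xs; rewrite Normc.normcM ler_wpM2l ?normc_ge0//.
exact: hM.
Qed.

Lemma hol_btD F P : hol_bt F -> hol_bt P -> hol_bt (fun x => F x + P x).
Proof.
move=> [dF bF] [dP bP]; split=> [x x1|s s01].
  by apply: differentiableD; [exact: dF|exact: dP].
have [M hM] := bF _ s01; have [N hN] := bP _ s01.
exists (M + N) => x xs; apply: le_trans (normcD _ _) _.
by apply: lerD; [exact: hM|exact: hN].
Qed.

Lemma hol_btM F P : hol_bt F -> hol_bt P -> hol_bt (fun x => F x * P x).
Proof.
move=> [dF bF] [dP bP]; split=> [x x1|s s01].
  by apply: differentiableM; [exact: dF|exact: dP].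
have [M hM] := bF _ s01; have [N hN] := bP _ s01.
exists (M * N) => x xs; rewrite Normc.normcM.
by apply: ler_pM; rewrite ?normc_ge0 ?hM ?hN.
Qed.

Lemma hol_bt_sum n (F : nat -> V -> Cx R) : (forall k, hol_bt (F k)) ->
  hol_bt (fun x => \sum_(i < n) F i x).
Proof.
move=> hF; elim: n => [|n IH].
  by under eq_fun do rewrite big_ord0; exact: hol_bt_cst.
by under eq_fun do rewrite big_ord_recr /=; exact: hol_btD.
Qed.

Lemma hol_bt_taylor_coef F k w : hol_bt F -> hol_bt (taylor_coef F k w).
Proof.
move=> hF; apply: hol_btZ; elim: k => // k IH; exact: hol_bt_derive.
Qed.

Lemma entire_growth_hol_bt m P : entire_growth m P -> hol_bt P.
Proof.
move=> [dP [K hK]]; split=> [x _|s /andP[s0 s1]]; first exact: dP.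
exists (`|K| * 2 ^+ m) => x xs; apply: le_trans (hK x) _.
have n0 := nrm_ge0 x.
have h1 : (1 + nrm x) ^+ m <= 2 ^+ m by rewrite lerXn2r ?nnegrE; lra.
have h2 : 0 <= (1 + nrm x) ^+ m by rewrite exprn_ge0; lra.
apply: (@le_trans _ _ (`|K| * (1 + nrm x) ^+ m)); first by rewrite ler_wpM2r ?ler_norm.
by rewrite ler_wpM2l.
Qed.

Lemma entire_growth_shift m P z : entire_growth m P ->
  entire_growth m (fun x => P (x + z)).
Proof.
move=> [dP [K hK]]; split=> [x|].
  apply: (@differentiable_comp _ V V (Cx R) (fun x => x + z) P); last exact: dP.
  by apply: differentiableD; [exact: ex_diff|exact: differentiable_cst].
exists (`|K| * (1 + nrm z) ^+ m) => x; apply: le_trans (hK _) _.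
have nx := nrm_ge0 x; have nz := nrm_ge0 z; have nxz := nrm_ge0 (x + z).
have h2 : 0 <= (1 + nrm (x + z)) ^+ m by rewrite exprn_ge0; lra.
apply: (@le_trans _ _ (`|K| * (1 + nrm (x + z)) ^+ m)); first by rewrite ler_wpM2r ?ler_norm.
rewrite -mulrA -exprMn ler_wpM2l// lerXn2r ?nnegrE//; first by lra.
  by rewrite mulr_ge0; lra.
have := nrmD x z; nra.
Qed.

Lemma entire_growthD m P Q : entire_growth m P -> entire_growth m Q ->
  entire_growth m (fun x => P x + Q x).
Proof.
move=> [dP [K hK]] [dQ [L hL]]; split=> [x|].
  by apply: differentiableD; [exact: dP|exact: dQ].
exists (K + L) => x; rewrite mulrDl; apply: le_trans (normcD _ _) _.
exact: lerD.
Qed.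

Lemma entire_growth_cst m (c : Cx R) : entire_growth m (fun=> c).
Proof.
split=> [x|]; first exact: differentiable_cst.
exists (normc c) => x; rewrite ler_peMr ?normc_ge0// exprn_ege1//.
by rewrite lerDl nrm_ge0.
Qed.

Lemma entire_growth_le m n P : (m <= n)%N -> entire_growth m P -> entire_growth n P.
Proof.
move=> mn [dP [K hK]]; split=> //; exists `|K| => x; apply: le_trans (hK x) _.
have n1 : 1 <= 1 + nrm x by rewrite lerDl nrm_ge0.
have p0 k : 0 <= (1 + nrm x) ^+ k by rewrite exprn_ge0//; lra.
apply: (@le_trans _ _ (`|K| * (1 + nrm x) ^+ m)); first by rewrite ler_wpM2r ?ler_norm.
by rewrite ler_wpM2l// ler_weXn2l.
Qed.

(** The Cauchy estimates at radius r, as r tends to infinity, kill the Taylor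
    coefficients of order greater than m, as well as the remainder of order
    m.+1. *)
Lemma entire_growth_taylor m P y w : entire_growth m P ->
  (forall k, (m < k)%N -> taylor_coef P k w y = 0) /\
  P (y + w) = \sum_(i < m.+1) taylor_coef P i w y.
Proof.
move=> [dP [K0 hK0]]; pose K := `|K0|.
have hK x : normc (P x) <= K * (1 + nrm x) ^+ m.
  apply: le_trans (hK0 x) _; rewrite ler_wpM2r ?ler_norm// exprn_ge0//.
  by rewrite addr_ge0 ?nrm_ge0.
pose A := 1 + nrm y + nrm w.
have ny := nrm_ge0 y; have nw := nrm_ge0 w.
have A1 : 1 <= A by rewrite /A; lra.
pose D := K * A ^+ m.
have D0 : 0 <= D by apply: mulr_ge0; [exact: normr_ge0|apply: exprn_ge0; lra].
have T (r : R) : 1 < r -> (forall k, normc (taylor_coef P k w y) <= D * r ^+ m / r ^+ k) /\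
  (forall n (l : C), normc l < r ->
    normc (P (y + l *: w) - \sum_(i < n) taylor_coef P i w y * l ^+ i) <=
      D * r ^+ m * (normc l / r) ^+ n * (r / (r - normc l))).
  move=> r1; apply: (@taylor_line _ _ P y w (r + 1)); [lra|lra|by move=> l _; exact: dP|].
  move=> l lr; apply: le_trans (hK _) _; rewrite /D -mulrA -exprMn.
  have nyl := nrm_ge0 (y + l *: w).
  apply: ler_wpM2l; first exact: normr_ge0.
  apply: lerXn2r; rewrite ?nnegrE; [lra|apply: mulr_ge0; lra|].
  have := nrmD y (l *: w); rewrite nrmZ lr /A; nra.
have eps0 (x : C) : (forall r : R, 2 <= r -> normc x <= 2 * D / r) -> x = 0.
  move=> h; apply/eqP; rewrite -normc_eq0; apply/eqP/le_anti; rewrite normc_ge0 andbT.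
  apply/ler_addgt0Pr => e e0; rewrite add0r.
  pose r := 2 + 2 * D / e.
  have q0 : 0 <= 2 * D / e by apply: divr_ge0; [exact: mulr_ge0|exact: ltW].
  apply: le_trans (h r _) _; first by rewrite /r; lra.
  have r0 : 0 < r by rewrite /r; lra.
  rewrite ler_pdivrMr// /r mulrDr [e * (_ / e)]mulrC mulfVK ?gt_eqF//; lra.
split=> [k mk|].
  apply: eps0 => r r2; have r0 : 0 < r by lra.
  have [h _] := T r ltac:(lra); apply: le_trans (h k) _.
  rewrite -mulrA -[leRHS]mulrA.
  have -> : k = (m + (k - m.+1).+1)%N by rewrite addnS -addSn subnKC.
  have rm : 0 < r ^+ m by rewrite exprn_gt0.
  rewrite exprD invfM (mulrA (r ^+ m)) divff ?gt_eqF// mul1r.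
  have h1 : (r ^+ (k - m.+1).+1)^-1 <= r^-1.
    rewrite lef_pV2 ?posrE ?exprn_gt0// exprS ler_peMr ?(ltW r0)// exprn_ege1//; lra.
  have : D * (r ^+ (k - m.+1).+1)^-1 <= D * r^-1 by rewrite ler_wpM2l.
  have : 0 <= D * r^-1 by rewrite mulr_ge0// invr_ge0 ltW.
  lra.
apply/eqP; rewrite -subr_eq0; apply/eqP; apply: eps0 => r r2; have r0 : 0 < r by lra.
have [_ /(_ m.+1 1)] := T r ltac:(lra); rewrite Normc.normc1 => /(_ ltac:(lra)).
rewrite scale1r; under eq_bigr do rewrite expr1n mulr1.
move/le_trans; apply.
have rm : 0 < r ^+ m by rewrite exprn_gt0.
have -> : D * r ^+ m * (1 / r) ^+ m.+1 * (r / (r - 1)) = D / r * (r / (r - 1)).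
  congr (_ * _); rewrite exprMn expr1n mul1r exprVn exprS; field.
  by rewrite !gt_eqF.
have : r / (r - 1) <= 2 by rewrite ler_pdivrMr; lra.
have : 0 <= D / r by rewrite divr_ge0// ltW.
have -> : 2 * D / r = D / r * 2 by ring.
by move=> *; rewrite ler_wpM2l.
Qed.

Lemma taylor_coef_growth F (s M r : R) m x : 0 < s -> s <= 1 ->
  (forall x, nrm x < 1 -> differentiable F x) ->
  (forall x, nrm x < s -> normc (F x) <= M) -> 0 < r -> r * nrm x < s ->
  normc (taylor_coef F m x 0) <= M / r ^+ m.
Proof.
move=> s0 s1 dF FM r0 rs.
by have [|] := @taylor_ball F s M r 0 x s1 dF FM r0; first by rewrite nrm0 add0r.
Qed.

(** The component of degree m is the limit, as t tends to 0, of the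
    remainder of F (t y) after the components of lower degree, divided by t^m;
    this limit is locally bounded, so [bounded_limit_diff] applies and
    differentiability propagates by induction on m. *)
Lemma homogeneous_component F m : hol_bt F ->
  entire_growth m (fun x => taylor_coef F m x 0).
Proof.
move=> [dF bF].
have h0 : 0 < (2^-1 : R) < 1 by apply/andP; split; lra.
have [M FM] := bF _ h0.
have M0 : 0 <= M by apply: le_trans (normc_ge0 _) (FM 0 _); rewrite nrm0; lra.
have h1 : (2^-1 : R) <= 1 by lra.
have T := fun r y w => @taylor_ball F _ M r y w h1 dF FM.
split; last first.
  exists (M * 4 ^+ m) => x.
  have nx := nrm_ge0 x.
  have d0 : 0 < 4 * (1 + nrm x) by lra.
  have [|h _] := T (4 * (1 + nrm x))^-1 0 x ltac:(by rewrite invr_gt0).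
    by rewrite nrm0 add0r mulrC ltr_pdivrMr//; lra.
  by have := h m; rewrite -mulrA -exprMn exprVn invrK.
elim/ltn_ind : m => m IH x.
pose X := nrm x + 1.
have X0 : 0 < X by rewrite ltr_wpDl ?nrm_ge0.
pose r := (4 * X)^-1.
have r0 : 0 < r by rewrite invr_gt0 mulr_gt0.
have rX : r * X = 4^-1 by rewrite /r; field; rewrite gt_eqF.
pose t (n : nat) : R := r / 2 / n.+1%:R.
have t0 n : 0 < t n := divr_gt0 (divr_gt0 r0 (ltr0Sn R 1)) (ltr0Sn R n).
have tr n : t n <= r / 2.
  rewrite ler_pdivrMr ?ltr0Sn//; apply: ler_peMr; last by rewrite ler1n.
  exact/ltW/divr_gt0.
have nt n : normc (t n)%:C = t n by rewrite normc_realE gtr0_norm.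
have yX y : nrm (y - x) < 1 -> nrm y < X.
  move=> yx; rewrite -(subrK x y); apply: le_lt_trans (nrmD _ _) _.
  by rewrite /X addrC ltrD2l.
pose g n y : Cx R := (t n)%:C^-1 ^+ m *
  (F ((t n)%:C *: y) - \sum_(i < m) (t n)%:C ^+ i * taylor_coef F i y 0).
have key n y : nrm (y - x) < 1 ->
    normc (g n y - taylor_coef F m y 0) <= (2 * M / r ^+ m.+1) * t n.
  move=> /yX yX'.
  have [|_ /(_ m.+1 (t n)%:C)] := T r 0 y r0.
    by rewrite nrm0 add0r; nra.
  rewrite nt => /(_ ltac:(have := tr n; lra)); rewrite add0r big_ord_recr /=.
  have c0 : (t n)%:C != 0 :> C by rewrite -normc_eq0 nt gt_eqF.
  have gE : g n y - taylor_coef F m y 0 = (t n)%:C^-1 ^+ m *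
    (F ((t n)%:C *: y) - (\sum_(i < m) taylor_coef F i y 0 * (t n)%:C ^+ i +
       taylor_coef F m y 0 * (t n)%:C ^+ m)).
    have -> : \sum_(i < m) taylor_coef F i y 0 * (t n)%:C ^+ i =
      \sum_(i < m) (t n)%:C ^+ i * taylor_coef F i y 0.
      by apply: eq_bigr => i _; rewrite mulrC.
    rewrite /g opprD addrA [in RHS]mulrBr; congr (_ - _).
    by rewrite mulrCA -exprMn mulVf// expr1n mulr1.
  move=> h; rewrite gE Normc.normcM normcX Normc.normcV nt exprVn mulrC ler_pdivrMr ?exprn_gt0//.
  apply: le_trans h _.
  have h2 : r / (r - t n) <= 2.
    rewrite ler_pdivrMr; have := tr n; lra.
  have -> : 2 * M / r ^+ m.+1 * t n * t n ^+ m = M * (t n / r) ^+ m.+1 * 2.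
    by move: (t n) => u; rewrite expr_div_n (exprS u); ring.
  apply: ler_wpM2l => //; apply: mulr_ge0 => //; apply: exprn_ge0.
  exact: divr_ge0 (ltW (t0 n)) (ltW r0).
have B0 : 0 <= 2 * M / r ^+ m.+1.
  by apply: divr_ge0; [exact: mulr_ge0 | rewrite exprn_ge0// ltW].
apply: (@bounded_limit_diff _ _ g _ x 1 (2 * M / r ^+ m.+1 * r + M / r ^+ m)); first by [].
- move=> n y yx.
  have dsum k : (k <= m)%N -> differentiable (fun y : V =>
      \sum_(i < k) (t n)%:C ^+ i * taylor_coef F i y 0 : Cx R) y.
    elim: k => [_|k IHk km].
      by under eq_fun do rewrite big_ord0; exact: differentiable_cst.
    under eq_fun do rewrite big_ord_recr /=.
    apply: differentiableD; first exact: IHk (ltnW km).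
    exact: (@differentiableZ _ V (Cx R) (fun y => taylor_coef F k y 0) _ y (IH k km y)).
  have d1 : differentiable (fun y : V => F ((t n)%:C *: y)) y.
    apply: (@differentiable_comp _ V V (Cx R) (fun y => (t n)%:C *: y) F); first exact: ex_diff.
    apply: dF; rewrite nrmZ nt; have := yX _ yx; have := tr n; have := nrm_ge0 y; nra.
  exact: (@differentiableZ _ V (Cx R) _ ((t n)%:C^-1 ^+ m) y (differentiableB d1 (dsum m (leqnn m)))).
- move=> n y yx; rewrite -(subrK (taylor_coef F m y 0) (g n y)).
  apply: le_trans (normcD _ _) _; apply: lerD.
    apply: le_trans (key _ _ yx) _; rewrite ler_wpM2l//; have := tr n; lra.
  apply: (@taylor_coef_growth F 2^-1); [lra|exact: h1|exact: dF|exact: FM|exact: r0|].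
  by have := yX _ yx; nra.
- move=> y yx; apply/cvgC_distn => e e0.
  pose B := 2 * M / r ^+ m.+1.
  exists (Num.truncn (e^-1 * (B * (r / 2)))).+1 => n nd.
  apply: le_lt_trans (key _ _ yx) _.
  rewrite -/B /t mulrA ltr_pdivrMr ?ltr0Sn// -ltr_pdivrMl//.
  apply: lt_le_trans (truncnS_gt _) _.
  by rewrite ler_nat; exact: leqW.
Qed.

End bounded_type_functions.

(** * The spaces of p-summable sequences and the diagonal polynomials *)

Section ell_facts.
Context {R : realType} {p : nat} (hp : (1 < p)%N).
Local Notation C := R[i].
Local Notation E := (ell R hp).
Implicit Types (x y z : E).

Definition psum (n : nat) x : R := \sum_(k < n) normc (x k) ^+ p.

Let p0 : (0 < p)%N. Proof. exact: ltnW. Qed.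

Lemma ell_coordD x y k : (x + y) k = x k + y k. Proof. by []. Qed.
Lemma ell_coordB x y k : (x - y) k = x k - y k. Proof. by []. Qed.
Lemma ell_coordZ (a : C) x k : (a *: x) k = a * x k. Proof. by []. Qed.
Lemma ell_coord0 k : (0 : E) k = 0. Proof. by []. Qed.
Lemma ell_coord_sum (I : Type) (s : seq I) (F : I -> E) k :
  (\sum_(i <- s) F i) k = \sum_(i <- s) F i k.
Proof.
by elim: s => [|i s IH]; rewrite ?big_nil// !big_cons ell_coordD IH.
Qed.
Lemma ell_basisE i k : (ell_basis hp i : E) k = (k == i)%:R. Proof. by []. Qed.

Lemma ell_ext x y : (forall k, x k = y k) -> x = y.
Proof. by move=> xy; apply/val_inj/funext. Qed.

Lemma psum_cvg x : psum ^~ x @ \oo --> nrm x ^+ p.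
Proof.
have fin : (lpnorm p x < +oo)%E by case: x.
pose T := (\sum_(0 <= k <oo) (normc (x k) ^+ p)%:E)%E.
have T0 : (0 <= T)%E.
  by apply: nneseries_ge0 => k _ _; rewrite lee_fin exprn_ge0 ?normc_ge0.
have pR : p%:R != 0 :> R by rewrite pnatr_eq0 -lt0n.
have Tfin : T \is a fin_num.
  rewrite ge0_fin_numE//; move: fin; rewrite /lpnorm -/T.
  rewrite [in X in _ -> X]ltey; apply: contraTneq => ->.
  by rewrite poweRyr ?invr_eq0// ltxx.
have nE : nrm x ^+ p = fine T.
  rewrite -[nrm x]/(fine (lpnorm p x)) /lpnorm -/T -(fineK Tfin) poweR_EFin /=.
  by rewrite -powR_mulrn ?powR_ge0// -powRrM mulVf// powRr1// fine_ge0.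
rewrite nE.
have cT : (fun n => \sum_(0 <= k < n) (normc (x k) ^+ p)%:E)%E @ \oo --> T.
  by apply: is_cvg_nneseries => k _ _; rewrite lee_fin exprn_ge0 ?normc_ge0.
have : (fun n => (psum n x)%:E) @ \oo --> (fine T)%:E.
  rewrite fineK//; apply: cvg_trans cT; apply: near_eq_cvg.
  by apply: nearW => n; rewrite /psum -sumEFin big_mkord.
by move/fine_cvgP => [].
Qed.

Arguments psum_cvg x : clear implicits.

Lemma psum_le x n : psum n x <= nrm x ^+ p.
Proof.
have := psum_cvg x => cv.
rewrite -(cvg_lim _ cv)//; apply: nondecreasing_cvgn_le; last by apply/cvg_ex; eexists; exact: cv.
apply/nondecreasing_seqP => m; rewrite /psum big_ord_recr /= lerDl.
by rewrite exprn_ge0 ?normc_ge0.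
Qed.

Lemma coord_le x k : normc (x k) <= nrm x.
Proof.
rewrite -(ler_pXn2r p0) ?nnegrE ?normc_ge0 ?nrm_ge0//.
apply: le_trans (psum_le x k.+1); rewrite /psum big_ord_recr /= lerDr.
by apply: sumr_ge0 => i _; rewrite exprn_ge0 ?normc_ge0.
Qed.

Lemma nrm_pow_le x (t : R) : (forall n, psum n x <= t) -> nrm x ^+ p <= t.
Proof.
move=> h; have cv := psum_cvg x.
by apply: (cvgr_to_le cv); apply: nearW.
Qed.

Lemma nrm_pow_inj (a b : R) : 0 <= a -> 0 <= b -> a ^+ p <= b ^+ p -> a <= b.
Proof. by move=> a0 b0; rewrite ler_pXn2r. Qed.

(** The p-additivity of the norm on disjoint supports, on which the description of the
    sheets rests. *)
Lemma nrm_pow_disjoint x y : (forall k, x k = 0 \/ y k = 0) ->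
  nrm (x + y) ^+ p = nrm x ^+ p + nrm y ^+ p.
Proof.
move=> xy; have cv := psum_cvg (x + y).
have cv' := cvgD (psum_cvg x) (psum_cvg y).
apply: (cvg_unique _ cv); first exact: Rhausdorff.
suff -> : psum ^~ (x + y) = (psum ^~ x + psum ^~ y)%R by exact: cv'.
apply/funext => n; transitivity (psum n x + psum n y) => //.
rewrite /psum -big_split; apply: eq_bigr => k _.
rewrite -[LHS]/(normc (x k + y k) ^+ p) -[RHS]/(normc (x k) ^+ p + normc (y k) ^+ p).
have p00 : (0 : R) ^+ p = 0 by rewrite expr0n gtn_eqF.
by case: (xy k) => ->; rewrite ?add0r ?addr0 Normc.normc0 p00 ?add0r ?addr0.
Qed.

Lemma nrm_basis k : nrm (ell_basis hp k : E) = 1.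
Proof.
apply/eqP; rewrite -(@eqrXn2 R p)// ?nrm_ge0// expr1n; apply/eqP.
apply: (cvg_unique _ (psum_cvg _)); first exact: Rhausdorff.
apply/cvgrPdist_lt => e e0; exists k.+1 => // n /= kn.
rewrite /psum (bigD1 (Ordinal kn)) //= big1 ?ell_basisE ?eqxx ?Normc.normc1 ?expr1n ?addr0 ?subrr ?normr0//.
move=> i ik; have ik' : (i == k :> nat) = false by apply/eqP => h; move/eqP: ik; apply; exact: val_inj.
have E0 : normc ((ell_basis hp k : E) i) ^+ p = 0.
  by rewrite ell_basisE ik' Normc.normc0 expr0n gtn_eqF.
exact: E0.
Qed.

Definition trunc (K : nat) x : E := \sum_(k < K) x k *: ell_basis hp k.

Lemma truncE K x k : trunc K x k = if (k < K)%N then x k else 0.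
Proof.
rewrite /trunc ell_coord_sum.
case: ltnP => kK; last first.
  rewrite big1 // => i _; rewrite ell_coordZ ell_basisE gtn_eqF ?mulr0//.
  exact: leq_trans (ltn_ord i) kK.
rewrite (bigD1 (Ordinal kK))// big1 => [|i /andP[_ ik]].
  have E1 : x k * (k == k :> nat)%:R + 0 = x k by rewrite eqxx mulr1 addr0.
  exact: E1.
have ki : (k == i :> nat) = false.
  by apply/eqP => h; move/eqP: ik; apply; apply: val_inj => /=; rewrite -h.
have E0 : x i * (k == i :> nat)%:R = 0 by rewrite ki mulr0.
exact: E0.
Qed.

Lemma nrm_pow_trunc K x : nrm (trunc K x) ^+ p = psum K x.
Proof.
apply: (cvg_unique _ (psum_cvg _)); first exact: Rhausdorff.
apply/cvgrPdist_lt => e e0; exists K => // n /= Kn.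
suff -> : psum n (trunc K x) = psum K x by rewrite subrr normr0.
rewrite /psum -(subnKC Kn) big_split_ord /= [X in _ + X]big1 ?addr0.
  by apply: eq_bigr => i _; rewrite truncE /= ltn_ord.
move=> i _; have E0 : normc (trunc K x (K + i)%N) ^+ p = 0.
  by rewrite truncE ltnNge leq_addr Normc.normc0 expr0n gtn_eqF.
exact: E0.
Qed.

Lemma trunc_approx x (e : R) : 0 < e -> exists K0, forall K, (K0 <= K)%N ->
  nrm (x - trunc K x) < e.
Proof.
move=> e0; have ep : 0 < e ^+ p by rewrite exprn_gt0.
have /cvgrPdist_lt/(_ _ ep)[K0 _ hK] := psum_cvg x.
exists K0 => K /hK /=; rewrite ger0_norm ?subr_ge0 ?psum_le// => h.
rewrite -(ltr_pXn2r p0) ?nnegrE ?nrm_ge0 ?(ltW e0)//.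
apply: le_lt_trans h; rewrite -nrm_pow_trunc.
have -> : nrm x ^+ p = nrm ((x - trunc K x) + trunc K x) ^+ p by rewrite subrK.
rewrite nrm_pow_disjoint ?addrK// => k.
by rewrite ell_coordB truncE; case: ifP => _; [left; rewrite subrr|right].
Qed.

(** The coordinate functional, named so that it can be declared linear. *)
Definition ell_coord (k : nat) : E -> Cx R := fun x => x k.

Lemma ell_coord_linear k : linear (ell_coord k).
Proof. by []. Qed.

HB.instance Definition _ k :=
  GRing.isLinear.Build C E (Cx R) *:%R (ell_coord k) (ell_coord_linear k).

Lemma ell_coord_continuous k : continuous (ell_coord k).
Proof.
by apply: (@normc_bounded_continuous R E (ell_coord k) 1) => x; rewrite mul1r coord_le.
Qed.

Section diagonal.
Variable theta : nat -> C.
Hypothesis theta1 : forall k, normc (theta k) <= 1.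

Definition dpartial (n : nat) x : Cx R := \sum_(k < n) theta k * x k ^+ p.

Definition diag_poly x : Cx R := lim (dpartial ^~ x @ \oo).

Lemma dpartial_dist x m n : (m <= n)%N ->
  normc (dpartial n x - dpartial m x) <= psum n x - psum m x.
Proof.
move=> mn; rewrite /dpartial /psum -(subnKC mn) !big_split_ord /=.
rewrite addrAC subrr add0r addrAC subrr add0r.
apply: le_trans (normc_sum _ _ _) _; apply: ler_sum => k _.
by rewrite Normc.normcM normcX ler_piMl ?exprn_ge0 ?normc_ge0.
Qed.

Lemma diag_poly_cvg x : dpartial ^~ x @ \oo --> diag_poly x.
Proof.
have [l hl] : exists l : Cx R, dpartial ^~ x @ \oo --> l.
  apply: cauchyC_cvg => e e0.
  have e20 : 0 < e / 2 by rewrite divr_gt0.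
  have /cvgrPdist_lt/(_ _ e20)[N _ hN] := psum_cvg x.
  exists N => m n Nm Nn.
  have key k : (N <= k)%N -> normc (dpartial k x - dpartial N x) < e / 2.
    move=> Nk; apply: le_lt_trans (dpartial_dist x Nk) _.
    have := hN N (leqnn N) => /=; rewrite ger0_norm ?subr_ge0 ?psum_le//.
    by have := psum_le x k; lra.
  apply: le_lt_trans (normc_triangle (dpartial N x) _ _) _.
  by have := key _ Nm; have := key _ Nn; rewrite (normc_dist (dpartial N x)); lra.
by rewrite /diag_poly (cvg_lim _ hl).
Qed.

Arguments diag_poly_cvg x : clear implicits.

Lemma dpartial_bound n x : normc (dpartial n x) <= nrm x ^+ p.
Proof.
have := dpartial_dist x (leq0n n); rewrite /dpartial /psum !big_ord0 !subr0.
by move/le_trans; apply; exact: psum_le.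
Qed.

Lemma diag_poly_bound x : normc (diag_poly x) <= nrm x ^+ p.
Proof.
apply: cvgC_normc_le (diag_poly_cvg x) _; apply: nearW => n.
exact: dpartial_bound.
Qed.

(** The partial sums are polynomials in finitely many coordinates, bounded by |x|^p. *)
Lemma diag_poly_entire : entire_growth p diag_poly.
Proof.
split=> [x|]; last first.
  exists 1 => x; rewrite mul1r; apply: le_trans (diag_poly_bound x) _.
  have := nrm_ge0 x => n0.
  by rewrite lerXn2r ?nnegrE//; lra.
apply: (@bounded_limit_diff _ _ dpartial _ _ 1 ((1 + nrm x) ^+ p)) => //.
- move=> n y _; elim: n => [|n IH].
    by rewrite /dpartial; under eq_fun do rewrite big_ord0; exact: differentiable_cst.
  rewrite /dpartial; under eq_fun do rewrite big_ord_recr /=.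
  apply: differentiableD; first exact: IH.
  have dc : differentiable (ell_coord n) y.
    by apply: linear_differentiable; exact: ell_coord_continuous.
  have dX q : differentiable (fun x : E => ell_coord n x ^+ q : Cx R) y.
    elim: q => [|q IHq]; first exact: differentiable_cst.
    by under eq_fun do rewrite exprS; exact: differentiableM.
  exact: (@differentiableZ _ E (Cx R) _ (theta n) y (dX p)).
- move=> n y yx; apply: le_trans (dpartial_bound _ _) _.
  rewrite lerXn2r ?nnegrE ?nrm_ge0//; first by rewrite addr_ge0 ?nrm_ge0.
  by have := nrmD (y - x) x; rewrite subrK; lra.
- by move=> y _; exact: diag_poly_cvg.
Qed.

(** With theta adapted to the arguments of the coordinates of x, no cancellation
    occurs. *)
Lemma diag_poly_nrm x : (forall k, theta k * x k ^+ p = (normc (x k) ^+ p)%:C) ->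
  diag_poly x = (nrm x ^+ p)%:C.
Proof.
move=> h; apply: cvgC_uniq (diag_poly_cvg x) _.
apply/cvgC_distn => e e0.
have /cvgrPdist_lt/(_ _ e0)[N _ hN] := psum_cvg x.
exists N => n /hN.
have -> : dpartial n x = (psum n x)%:C.
  by rewrite /dpartial /psum rmorph_sum; apply: eq_bigr => k _; rewrite h.
by rewrite -rmorphB normc_realE distrC.
Qed.

End diagonal.

End ell_facts.

(** * Functions on the space as elements of the algebra of the ball *)

Section Hb_functions.
Context {R : realType} {p : nat} (hp : (1 < p)%N).
Local Notation C := R[i].
Local Notation E := (ell R hp).
Local Notation B := {x : E | `|x| < 1}.
Local Notation H := (Hb R hp).
Implicit Types (f g : H) (F G : E -> Cx R) (u : B) (x y z w : E).

Lemma in_ballE (x : E) (s : R) : (`|x| < s%:C) = (nrm x < s).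
Proof. by rewrite nrmE ltcR. Qed.

Lemma ball_nrm u : nrm (val u) < 1.
Proof. by have := valP u; rewrite -[X in _ < X]/((1 : R)%:C) in_ballE. Qed.

Lemma nrm_ball x : nrm x < 1 -> `|x| < 1.
Proof. by rewrite -[X in _ -> _ < X]/((1 : R)%:C) in_ballE. Qed.

Definition to_ball x (x1 : nrm x < 1) : B := exist _ x (nrm_ball x1).

Lemma ext0_in (f : B -> Cx R) x (x1 : nrm x < 1) : ext0 f x = f (to_ball x1).
Proof.
rewrite /ext0 insubT; first exact: nrm_ball.
by move=> h; congr f; exact: val_inj.
Qed.

Lemma ext0_val (f : B -> Cx R) u : ext0 f (val u) = f u.
Proof. by rewrite (ext0_in f (ball_nrm u)); congr f; exact: val_inj. Qed.

Lemma hol_bt_ext0 f : hol_bt (ext0 f).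
Proof.
have /asboolP[df bf] : hb_val f \in @hb_pred R p hp by case: f.
split=> [x x1|s s01]; first exact: (df (to_ball x1)).
have /bounded_imageP[M hM] := bf s s01.
exists M => x xs; have x1 : nrm x < 1 by case/andP: s01 => _; exact: lt_trans.
by rewrite (ext0_in f x1); apply: hM; rewrite /sball /= in_ballE.
Qed.

Lemma hol_bt_hb_pred F : hol_bt F -> (fun u : B => F (val u)) \in @hb_pred R p hp.
Proof.
move=> [dF bF]; apply/asboolP; split=> [u|s s01].
  exact: (near_differentiable (ext0E (fun=> erefl) u) (dF _ (ball_nrm u))).
have [M hM] := bF s s01; apply/bounded_imageP; exists M => u.
by rewrite /sball /= in_ballE; exact: hM.
Qed.

(** The element of the algebra defined by F; the default value 0 is taken only when F is
    not of bounded type. *)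
Definition toH F : H := insubd (0 : H) (fun u : B => F (val u)).

Lemma toHE F u : hol_bt F -> toH F u = F (val u).
Proof. by move=> /hol_bt_hb_pred hF; rewrite -[LHS]/(val (toH F) u) insubdK. Qed.

Lemma H_ext f g : (forall u, f u = g u) -> f = g.
Proof. by move=> fg; apply/val_inj/funext. Qed.

Lemma toH_ext F G : (forall x, nrm x < 1 -> F x = G x) -> toH F = toH G.
Proof.
by move=> FG; congr insubd; apply/funext => u; exact: FG (ball_nrm u).
Qed.

Lemma toH_ext0 f : toH (ext0 f) = f.
Proof.
by apply: H_ext => u; rewrite toHE ?ext0_val//; exact: hol_bt_ext0.
Qed.

Lemma toHD F G : hol_bt F -> hol_bt G -> toH (fun x => F x + G x) = toH F + toH G.
Proof.
move=> hF hG; apply: H_ext => u; rewrite toHE; last exact: hol_btD.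
by rewrite -[RHS]/(toH F u + toH G u) !toHE.
Qed.

Lemma toHZ (c : C) F : hol_bt F -> toH (fun x => c * F x) = c *: toH F.
Proof.
move=> hF; apply: H_ext => u; rewrite toHE; last exact: hol_btZ.
by rewrite -[RHS]/(c * toH F u) toHE.
Qed.

Lemma toHM F G : hol_bt F -> hol_bt G -> toH (fun x => F x * G x) = toH F * toH G.
Proof.
move=> hF hG; apply: H_ext => u; rewrite toHE; last exact: hol_btM.
by rewrite -[RHS]/(toH F u * toH G u) !toHE.
Qed.

Lemma toH1 : toH (fun=> 1) = 1.
Proof. by apply: H_ext => u; rewrite toHE; last exact: hol_bt_cst. Qed.

Lemma toH0 : toH (fun=> 0) = 0.
Proof. by apply: H_ext => u; rewrite toHE; last exact: hol_bt_cst. Qed.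

Lemma toH_sum n (F : nat -> E -> Cx R) : (forall k, hol_bt (F k)) ->
  toH (fun x => \sum_(i < n) F i x) = \sum_(i < n) toH (F i).
Proof.
move=> hF; elim: n => [|n IH].
  by rewrite big_ord0 -toH0; congr toH; apply/funext => x; rewrite big_ord0.
rewrite big_ord_recr /= -IH -toHD//; last exact: hol_bt_sum.
by congr toH; apply/funext => x; rewrite big_ord_recr.
Qed.

Lemma taylor_term_toH f n z :
  insubd (0 : H) (taylor_term f n z) = toH (taylor_coef (ext0 f) n z).
Proof. by []. Qed.

Lemma HD f g u : (f + g) u = f u + g u. Proof. by []. Qed.
Lemma HM f g u : (f * g) u = f u * g u. Proof. by []. Qed.
Lemma HZ (c : C) f u : (c *: f) u = c * f u. Proof. by []. Qed.

Lemma HX f n u : (f ^+ n) u = f u ^+ n.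
Proof. by elim: n => // n IH; rewrite !exprS HM IH. Qed.

Lemma cvg_uniform_sballs (f_ : nat -> H) :
  (forall s : R, 0 < s < 1 -> forall e : R, 0 < e -> exists N, forall n, (N <= n)%N ->
     forall u, sball s u -> normc (f_ n u) < e) ->
  f_ @ \oo --> (0 : H).
Proof.
move=> h A [_ [[U oU <-] U0 UA]].
have fam0 : (fun n => hb_val (f_ n)) @ \oo -->
    (hb_val 0 : {family [set @sball R p hp s | s in [set s | 0 < s < 1]], B -> Cx R}).
  apply/fam_cvgP => _ [s s01 <-] P /uniform_nbhs[D [entD DP]].
  have [e e0 eD] : exists2 e : R, 0 < e & forall a b : Cx R, normc (a - b) < e -> D (a, b).
    move: entD; rewrite -entourage_ballE => -[x /= /gt0_complexE[xE e0] hD].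
    exists (complex.Re x) => // a b ab; apply: hD => /=.
    by rewrite -ball_normE /= normc_normr xE ltcR.
  have [N hN] := h s s01 e e0; exists N => // n /= /hN hn; apply: DP => u us.
  by apply: eD; rewrite sub0r normcN; exact: hn.
have : nbhs (hb_val 0 : {family [set @sball R p hp s | s in [set s | 0 < s < 1]], B -> Cx R}) U.
  by apply: open_nbhs_nbhs; split.
by move=> /fam0[N _ hN]; exists N => // n /= Nn; apply: UA; exact: (hN n Nn).
Qed.

Lemma near_uniform_sball f (s e : R) : 0 < s < 1 -> 0 < e ->
  \forall g \near f, forall u, sball s u -> normc ((g : H) u - f u) < e.
Proof.
move=> s01 e0.
pose fam := [set @sball R p hp s | s in [set s | 0 < s < 1]].
have : (fun g : H => hb_val g : B -> Cx R) @ nbhs f --> (hb_val f : {family fam, B -> Cx R}).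
  exact: (@initial_continuous H {family fam, B -> Cx R} (@hb_val R p hp) f).
move=> /fam_cvgP/(_ (sball s)) /(_ (ex_intro2 _ _ s s01 erefl)).
move=> /(_ [set h : {uniform` sball s -> Cx R} | forall u, sball s u -> normc (h u - f u) < e]).
apply; apply/uniform_nbhs.
exists [set ab | ball ab.1 e%:C ab.2]; split.
  by rewrite -entourage_ballE; exists e%:C => //=; rewrite ltcR.
move=> h hu u /hu /=; rewrite -ball_normE /= normc_normr ltcR.
by rewrite normc_dist.
Qed.

End Hb_functions.

(** * Characters *)

Section characters.
Context {R : realType} {p : nat} {hp : (1 < p)%N}.
Local Notation C := R[i].
Local Notation E := (ell R hp).
Local Notation B := {x : E | `|x| < 1}.
Local Notation H := (Hb R hp).
Local Notation M := (@Mb R p hp).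
Implicit Types (f g : H) (F G P : E -> Cx R) (u : B) (x y z w : E) (psi chi : M).

HB.instance Definition _ psi :=
  GRing.isLinear.Build C H (Cx R) *:%R (mb_val psi) (mb_linear psi).

Lemma mbD psi f g : psi (f + g) = psi f + psi g. Proof. exact: linearD. Qed.
Lemma mbB psi f g : psi (f - g) = psi f - psi g. Proof. exact: linearB. Qed.
Lemma mbZ psi (c : C) f : psi (c *: f) = c * psi f. Proof. exact: linearZ. Qed.
Lemma mb0 psi : psi 0 = 0. Proof. exact: linear0. Qed.
Lemma mbM psi f g : psi (f * g) = psi f * psi g. Proof. exact: mb_mul. Qed.

Lemma mb_sum psi n (F : nat -> H) : psi (\sum_(i < n) F i) = \sum_(i < n) psi (F i).
Proof.
by elim: n => [|n IH]; rewrite ?big_ord0 ?mb0// !big_ord_recr/= mbD IH.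
Qed.

Lemma mb1 psi : psi 1 = 1.
Proof.
have [f f0] := mb_neq0 psi; apply: (mulfI f0).
by rewrite -mbM mulr1 [RHS]mulr1.
Qed.

Lemma mbX psi f n : psi (f ^+ n) = psi f ^+ n.
Proof. by elim: n => [|n IH]; rewrite ?expr0 ?mb1// !exprS mbM IH. Qed.

Lemma mb_ext psi chi : (forall f, psi f = chi f) -> psi = chi.
Proof.
case: psi => a a1 a2 a3 a4; case: chi => b b1 b2 b3 b4 /= ab.
have {}ab : a = b by apply/funext.
by subst b; congr MkMb; exact: Prop_irrelevance.
Qed.

(** [prec] for a ball, with the supremum replaced by its upper bounds. *)
Definition dominated psi (s : R) := forall f (K : R),
  (forall u, sball s u -> normc (f u) <= K) -> normc (psi f) <= K.

(** Continuity gives s and e such that |f| < e on sB implies |psi f| < 1.  Then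
    |psi f| > K >= sup |f| on sB is impossible: f / psi f would have powers less
    than e on sB, while psi maps these powers to 1. *)
Lemma mb_dominated psi : exists2 s : R, 0 < s < 1 & dominated psi s.
Proof.
have [s s01 hs] : exists2 s : R, 0 < s < 1 & exists2 e : R, 0 < e &
    forall f, (forall u, sball s u -> normc (f u) < e) -> normc (psi f) < 1.
  apply: contrapT => nex.
  (* otherwise some f n is less than 1 / n.+1 on the ball of radius t n, and so tends to
     0, although |psi (f n)| >= 1 *)
  pose t (n : nat) : R := 1 - n.+2%:R^-1.
  have t01 n : 0 < t n < 1.
    have h : 0 < (n.+2%:R^-1 : R) by rewrite invr_gt0.
    have h1 : (n.+2%:R^-1 : R) < 1 by rewrite invf_lt1 ?ltr1n ?ltr0n.
    by rewrite /t subr_gt0 h1 gtrBl h.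
  have step n : exists f, (forall u, sball (t n) u -> normc (f u) < n.+1%:R^-1) /\
      1 <= normc (psi f).
    apply: contrapT => nf; apply: nex; exists (t n); first exact: t01.
    exists n.+1%:R^-1; first by rewrite invr_gt0.
    move=> f hf; rewrite ltNge; apply/negP => psif; apply: nf.
    by exists f.
  have [f_ hf_] := choice step.
  have cf : f_ @ \oo --> (0 : H).
    apply: cvg_uniform_sballs => s /andP[s0 s1] e e0.
    exists (maxn (Num.truncn (1 - s)^-1) (Num.truncn e^-1)).+1 => n.
    move=> /ltnW; rewrite geq_max => /andP[n1 n2] u us.
    have [h _] := hf_ n.
    have ne : n.+1%:R^-1 < e.
      rewrite -[ltRHS]invrK ltf_pV2 ?posrE ?invr_gt0//.
      by apply: lt_le_trans (truncnS_gt _) _; rewrite ler_nat ltnS.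
    apply: lt_trans ne; apply: h; move: us; rewrite /sball /= !in_ballE => us.
    apply: lt_le_trans us _; rewrite /t.
    have : n.+2%:R^-1 <= 1 - s.
      rewrite -[leRHS]invrK lef_pV2 ?posrE ?invr_gt0 ?subr_gt0//.
      apply/ltW/(lt_le_trans (truncnS_gt _)); rewrite ler_nat.
      by rewrite ltnS; exact: leqW.
    by rewrite !lerBrDr addrC.
  have : (fun n => psi (f_ n)) @ \oo --> psi 0.
    by apply: continuous_cvg cf; exact: mb_continuous.
  rewrite mb0 => /cvgC_distn/(_ 1 ltr01)[N /(_ N (leqnn N))].
  by rewrite subr0; have [_] := hf_ N; lra.
case: hs => e e0 hs; exists s => // f K fK.
rewrite leNgt; apply/negP => Kf.
have K0 : 0 <= K.
  have z1 : nrm (0 : E) < 1 by rewrite nrm0.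
  apply: le_trans (normc_ge0 _) (fK (to_ball z1) _).
  by rewrite /sball /= in_ballE nrm0; case/andP: s01.
have c0 : psi f != 0 by rewrite -normc_gt0 (le_lt_trans K0).
pose q := K / normc (psi f).
have q0 : 0 <= q by rewrite divr_ge0 ?normc_ge0.
have q1 : q < 1 by rewrite ltr_pdivrMr ?mul1r ?normc_gt0.
have [n qn] : exists n, q ^+ n < e.
  have : (fun n => q ^+ n) @ \oo --> 0 by apply: cvg_expr; rewrite ger0_norm.
  move/cvgrPdist_lt => /(_ _ e0)[N _ /(_ N (leqnn N))].
  by rewrite /= sub0r normrN ger0_norm ?exprn_ge0//; exists N.
have : normc (psi (((psi f)^-1 *: f) ^+ n)) < 1; first apply: hs.
  move=> u us; rewrite HX HZ normcX; apply: le_lt_trans qn.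
  rewrite lerXn2r ?nnegrE ?normc_ge0// Normc.normcM Normc.normcV mulrC.
  by rewrite ler_pM2r ?invr_gt0 ?normc_gt0//; exact: fK.
by rewrite mbX mbZ mulVf// expr1n Normc.normc1 ltxx.
Qed.

Lemma precP psi (s : R) : 0 < s -> prec psi (@sball R p hp s) <-> dominated psi s.
Proof.
move=> s0; split=> [h f K fK|h f].
  rewrite -lee_fin; apply: le_trans (h f) _; apply: ge_ereal_sup.
  by move=> _ [u us <-]; rewrite lee_fin; exact: fK.
set S := ereal_sup _.
have ub u : sball s u -> ((normc (f u))%:E <= S)%E.
  by move=> us; apply: ereal_sup_ubound; exists u.
case: S ub => [K||] ub.
- by rewrite lee_fin; apply: h => u /ub; rewrite lee_fin.
- by rewrite leey.
have z1 : nrm (0 : E) < 1 by rewrite nrm0.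
have := ub (to_ball z1); rewrite /sball /= in_ballE nrm0 => /(_ s0).
by rewrite leeNy_eq.
Qed.

Lemma dominated_dist psi (s e : R) F G : s <= 1 -> dominated psi s -> hol_bt F -> hol_bt G ->
  (forall x, nrm x < s -> normc (F x - G x) <= e) ->
  normc (psi (toH F) - psi (toH G)) <= e.
Proof.
move=> s1 ds hF hG FG; rewrite -mbB; apply: ds => u; rewrite /sball /= in_ballE => us.
by rewrite -[X in normc X]/(toH F u - toH G u) !toHE//; exact: FG.
Qed.

Lemma translate0 psi : is_translate psi 0 psi.
Proof.
move=> f; have T0 n : taylor_coef (ext0 f) n.+1 (0 : E) = fun=> 0.
  apply/funext => x; rewrite /taylor_coef iterS.
  rewrite (_ : 'D_0 _ x = 0) ?mulr0//; apply: derive_limE => e e0.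
  exists 1 => // t t0 _; rewrite scaler0 addr0 subrr mulr0 subr0 Normc.normc0.
  exact: ltW.
apply/cvgC_distn => e e0; exists 1%N => -[//|n] _.
rewrite /series /= big_mkord big_ord_recl /= big1 => [|i _].
  rewrite addr0 taylor_term_toH (_ : taylor_coef _ _ _ = ext0 f).
    by rewrite toH_ext0 subrr Normc.normc0.
  by apply/funext => x; exact: taylor_coef0.
by rewrite taylor_term_toH /bump /= T0 toH0 mb0.
Qed.

Lemma translate_uniq psi z chi chi' :
  is_translate psi z chi -> is_translate psi z chi' -> chi = chi'.
Proof. by move=> h h'; apply: mb_ext => f; apply: cvgC_uniq (h f) (h' f). Qed.

Lemma taylor_coef_ext F G n w y : (forall x, nrm x < 1 -> F x = G x) -> nrm y < 1 ->
  taylor_coef F n w y = taylor_coef G n w y.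
Proof.
move=> FG y1; congr (_ * _); elim: n y y1 => [|n IH] y y1; first exact: FG.
rewrite !iterS; apply: near_eq_derive.
  apply/(@nearV R E); exists (1 - nrm y); first by rewrite subr_gt0.
  move=> x xy; apply: IH; rewrite -(subrK y x); apply: le_lt_trans (nrmD _ _) _.
  by move: xy; lra.
Qed.

(** The translate is defined by a Taylor series in w, which is a finite sum when P
    has polynomial growth. *)
Lemma translate_entire psi w chi m P : is_translate psi w chi -> entire_growth m P ->
  chi (toH P) = psi (toH (fun x => P (x + w))).
Proof.
move=> tr eP; have hP := entire_growth_hol_bt eP.
apply: cvgC_uniq (tr (toH P)) _.
have TE n : insubd (0 : H) (taylor_term (toH P) n w) = toH (taylor_coef P n w).
  rewrite taylor_term_toH; apply: toH_ext => x x1; apply: taylor_coef_ext => // y y1.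
  by rewrite (ext0_in _ y1) toHE.
apply/cvgC_distn => e e0; exists m.+1 => n mn.
rewrite /series /= big_mkord; under eq_bigr do rewrite TE.
rewrite -(@mb_sum psi n (fun i => toH (taylor_coef P i w))).
rewrite -(@toH_sum _ _ _ n (fun i => taylor_coef P i w)); last first.
  by move=> k; exact: hol_bt_taylor_coef.
suff -> : toH (fun x => \sum_(i < n) taylor_coef P i w x) = toH (fun x => P (x + w)).
  by rewrite subrr Normc.normc0.
congr toH; apply/funext => x; have [T0 ->] := entire_growth_taylor x w eP.
rewrite -(subnKC mn) big_split_ord /= [X in _ + X]big1 ?addr0// => i _.
by apply: T0; rewrite ltnS leq_addr.
Qed.

(** The value v = psi F cannot have modulus at least 1, since v - F would then be
    invertible in the algebra: (v - F)^-1 is bounded on each sB because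
    |v - F| >= 1 - s^p there. *)
Lemma spectral_bound psi F : hol_bt F -> (forall x, nrm x < 1 -> normc (F x) <= nrm x ^+ p) ->
  normc (psi (toH F)) < 1.
Proof.
move=> hF Fp; rewrite ltNge; apply/negP => v1.
set v := psi (toH F) in v1.
have p0 : (0 < p)%N by exact: ltnW.
have ge x : nrm x < 1 -> 1 - nrm x ^+ p <= normc (v - F x).
  move=> x1; apply: le_trans (normc_lerB _ _); have := Fp x x1; lra.
have gt0 x : nrm x < 1 -> v - F x != 0.
  move=> x1; rewrite -normc_gt0; apply: lt_le_trans (ge x x1).
  by rewrite subr_gt0 exprn_ilt1 ?nrm_ge0// -lt0n.
have hv : hol_bt (fun x => v - F x).
  have -> : (fun x => v - F x) = (fun x => v + (-1) * F x).
    by apply/funext => x; rewrite mulN1r.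
  by apply: hol_btD; [exact: hol_bt_cst|exact: hol_btZ].
have hG : hol_bt (fun x => (v - F x)^-1).
  split=> [x x1|s /andP[s0 s1]].
    apply: (@differentiableV _ E (fun x => v - F x)); last exact: gt0.
    by have [dv _] := hv; exact: dv.
  have sp : 0 < 1 - s ^+ p by rewrite subr_gt0 exprn_ilt1 ?(ltW s0)// -lt0n.
  exists (1 - s ^+ p)^-1 => x xs; have x1 := lt_trans xs s1.
  rewrite Normc.normcV lef_pV2 ?posrE ?normc_gt0 ?gt0//.
  apply: le_trans (ge x x1).
  have : nrm x ^+ p <= s ^+ p by rewrite lerXn2r ?nnegrE ?nrm_ge0 ?(ltW s0)// ltW.
  lra.
have : psi (toH (fun x => (v - F x) * (v - F x)^-1)) = 1.
  rewrite (_ : toH _ = 1) ?mb1// -toH1; apply: toH_ext => x x1.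
  by rewrite divff// gt0.
rewrite toHM// mbM (_ : psi (toH _) = 0) ?mul0r; first by move/eqP; rewrite eq_sym oner_eq0.
have -> : toH (fun x => v - F x) = toH (fun=> v) - toH F.
  by apply: H_ext => u; rewrite -[RHS]/(toH (fun=> v) u - toH F u) !toHE//; exact: hol_bt_cst.
rewrite mbB (_ : toH (fun=> v) = v *: (1 : H)) ?mbZ ?mb1 ?mulr1 ?subrr//.
by apply: H_ext => u; rewrite toHE ?HZ ?mulr1//; exact: hol_bt_cst.
Qed.

Lemma mb_base_open (U : set M) : @mb_base R p hp U -> open U.
Proof.
move=> bU; exists [set U]; last by rewrite bigcup_set1.
move=> _ ->; exists [fset U]%fset; last by rewrite set_fset1 bigcap_set1.
by move=> V; rewrite in_fset1 => /eqP ->; exact/mem_set.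
Qed.

Lemma mb_base_cvg (F : set_system M) psi : Filter F ->
  (forall U, @mb_base R p hp U -> U psi -> F U) -> F --> psi.
Proof.
move=> FF h A [_ [[D sD <-] [V DV Vpsi] DA]].
have [D' bD' VE] := sD _ DV.
have : F V.
  rewrite -VE; apply: filter_bigI => U UD'; apply: h.
    by have := bD' _ UD'; rewrite inE.
  by move: Vpsi; rewrite -VE; apply.
by apply: filterS => chi Vchi; apply: DA; exists V.
Qed.

(** Basic neighbourhoods of psi are described without reference to the radius at which
    psi is dominated. *)
Lemma mb_nbhs psi (A : set M) : (exists2 e : R, 0 < e & forall z chi,
    nrm z < e -> is_translate psi z chi -> A chi) -> nbhs psi A.
Proof.
move=> [e e0 eA]; have [s s01 ds] := mb_dominated psi.
pose e' := Num.min (e / 2) ((1 - s) / 2).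
have [s0 s1] := andP s01.
have e'0 : 0 < e' by rewrite lt_min !divr_gt0// subr_gt0.
have e'e : e' < e by apply: (@le_lt_trans _ _ (e / 2)); [rewrite ge_min lexx|lra].
have e's : e' < 1 - s.
  by apply: (@le_lt_trans _ _ ((1 - s) / 2)); [rewrite ge_min lexx orbT|lra].
pose U : set M := [set chi | exists2 z : E, `|z| < e'%:C & is_translate psi z chi].
have oU : open U.
  apply: mb_base_open; exists psi, s, e'.
  by split=> //; [exact/precP | rewrite e'0 e's].
have Upsi : U psi.
  by exists 0; [rewrite in_ballE nrm0 | exact: translate0].
apply: filterS (open_nbhs_nbhs (conj oU Upsi)) => chi [z].
rewrite in_ballE => ze; apply: eA; exact: lt_trans ze e'e.
Qed.

End characters.

(** * Block homomorphisms and their sheets *)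

Section block_homomorphisms.
Context {R : realType} {p : nat} {hp : (1 < p)%N}.
Local Notation C := R[i].
Local Notation E := (ell R hp).
Local Notation B := {x : E | `|x| < 1}.
Local Notation H := (Hb R hp).
Local Notation M := (@Mb R p hp).
Implicit Types (f g : H) (P : E -> Cx R) (x y z w : E) (psi phi chi : M).

(** What is used of a block basic sequence: constant norm, supports that are pairwise
    disjoint and escape to infinity. *)
Definition blocks (r : R) (x : nat -> E) := [/\ forall n, nrm (x n) = r,
  forall n k, x n k != 0 -> (n <= k)%N &
  forall m n k, x m k != 0 -> x n k != 0 -> m = n].

(** Adherence to the sequence of evaluations, tested on one function at a time. *)
Definition adherent (x : nat -> E) phi := forall F, hol_bt F -> forall (e : R) N, 0 < e ->
  exists2 n, (N <= n)%N & normc (F (x n) - phi (toH F)) < e.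

Lemma block_hom_blocks (r : R) phi : 0 < r -> block_hom r phi ->
  exists x : nat -> E, blocks r x /\ adherent x phi.
Proof.
move=> r0 [x [[J [a [Jlt xE]]] xr cl]]; exists (fun n => val (x n)); split.
  have nx n : nrm (val (x n)) = r by apply: complexI; rewrite -nrmE.
  have xk n k : (val (x n) : E) k != 0 -> k \in J n.
    apply: contraNT => kJ; have := xE n => /= ->.
    rewrite ell_coord_sum big_seq big1 // => i iJ.
    have ki : (k == i) = false by apply: contraNF kJ => /eqP ->.
    by rewrite ell_coordZ ell_basisE ki mulr0.
  have Jn n : exists k, k \in J n.
    apply: contrapT => nJ; have : nrm (val (x n)) = 0.
      rewrite -(@nrm0 R E); congr nrm; apply: ell_ext => k; rewrite ell_coord0; apply/eqP.
      by apply: contrapT => /negP/xk kJ; apply: nJ; exists k.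
    by rewrite nx => r00; move: r0; rewrite r00 ltxx.
  have Jd n d i j : i \in J n -> j \in J (n + d.+1)%N -> (i < j)%N.
    elim: d j => [|d IH] j iJ; first by rewrite addn1; exact: Jlt.
    rewrite addnS => jJ; have [k kJ] := Jn (n + d.+1)%N.
    exact: ltn_trans (IH k iJ kJ) (Jlt _ _ _ kJ jJ).
  have Jlt' m n i j : (m < n)%N -> i \in J m -> j \in J n -> (i < j)%N.
    by move=> mn iJ jJ; apply: (Jd m (n - m.+1)%N i j iJ); rewrite addnS -addSn subnKC.
  split=> // [n k /xk|m n k /xk km /xk kn].
    elim: n k => // n IH k kJ; have [i iJ] := Jn n.
    exact: leq_ltn_trans (IH i iJ) (Jlt _ _ _ iJ kJ).
  case: (ltngtP m n) => // [mn|nm].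
    by have := Jlt' _ _ _ _ mn km kn; rewrite ltnn.
  by have := Jlt' _ _ _ _ nm kn km; rewrite ltnn.
move=> F hF e N e0.
pose A : set {ptws H -> Cx R} := [set h | exists2 n, (N <= n)%N & h = (fun f : H => f (x n))].
pose D : set {ptws H -> Cx R} := [set h | normc (h (toH F) - phi (toH F)) < e].
have FA : ((fun n => (fun f : H => f (x n)) : {ptws H -> Cx R}) @ \oo) A.
  by exists N => // n /= Nn; exists n.
have nD : nbhs (phi : {ptws H -> Cx R}) D.
  have := @proj_continuous H (fun=> Cx R) (toH F) (phi : {ptws H -> Cx R}).
  move=> /(_ [set c | normc (c - phi (toH F)) < e]); apply.
  by apply/(@nearV R (Cx R)); exists e.
have [_ [[n Nn ->] Dn]] := cl _ _ FA nD.
by exists n => //; rewrite -(toHE (x n) hF).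
Qed.

Section fixed_block.
Variables (r : R) (x : nat -> E) (phi : M).
Hypotheses (r0 : 0 < r) (xb : blocks r x) (ad : adherent x phi).

Let p0 : (0 < p)%N. Proof. exact: ltnW. Qed.

Lemma linear_bound (L : {linear E -> Cx R}) : continuous L ->
  exists2 A : R, 0 < A & forall y, normc (L y) <= A * nrm y.
Proof.
move=> /linear_bounded_continuous/linear_boundedP/pinfty_ex_gt0[A A0 h].
have [AE A0'] := gt0_complexE A0.
exists (complex.Re A) => // y; have := h y.
by rewrite normc_normr AE nrmE -rmorphM lecR.
Qed.

Lemma linear_entire (L : {linear E -> Cx R}) : continuous L -> entire_growth 1 L.
Proof.
move=> cL; split=> [y|]; first exact: linear_differentiable.
have [A A0 h] := linear_bound cL; exists A => y; apply: le_trans (h y) _.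
by rewrite expr1 ler_wpM2l ?(ltW A0)// lerDr.
Qed.

Lemma toH_linear (L : {linear E -> Cx R}) (cL : continuous L) :
  MkHb (hb_linear cL) = toH L.
Proof.
have hL := entire_growth_hol_bt (linear_entire cL).
by apply: H_ext => u; rewrite (toHE u hL).
Qed.

Lemma block_sum (s : seq nat) : uniq s ->
  nrm (\sum_(n <- s) x n) ^+ p = (size s)%:R * r ^+ p.
Proof.
have [xr _ xd] := xb.
elim: s => [_|n s IH /= /andP[ns us]].
  by rewrite big_nil nrm0 mul0r expr0n gtn_eqF.
rewrite big_cons nrm_pow_disjoint ?IH// ?xr; first by rewrite -natr1; ring.
move=> k; have [xk|xk] := eqVneq (x n k) 0; [by left|right].
rewrite ell_coord_sum big_seq big1 // => m ms.
by apply: contraNeq ns => mk; rewrite (xd _ _ _ xk mk).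
Qed.

(** Blocks of constant norm tend weakly to 0, as p > 1: if infinitely many values
    L (x n) were close to some c != 0, then L would be of order K at the sum of
    K of these blocks, whose norm is only r K^(1/p). *)
Lemma block_linear0 (L : {linear E -> Cx R}) : continuous L -> phi (toH L) = 0.
Proof.
move=> cL; apply/eqP; rewrite -normc_eq0; apply: contraT => c0'.
set c := phi (toH L) in c0' *.
have c0 : 0 < normc c by rewrite lt_def c0' normc_ge0.
have c20 : 0 < normc c / 2 by rewrite divr_gt0.
have hL := entire_growth_hol_bt (linear_entire cL).
have [A A0 hA] := linear_bound cL.
have sel K : exists s : seq nat, [/\ uniq s, size s = K &
    forall n, n \in s -> normc (L (x n) - c) < normc c / 2].
  elim: K => [|K [s [us sK hs]]]; first by exists [::].
  have [n ns hn] := ad hL (\max_(m <- s) m).+1 c20.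
  exists (n :: s); split => /=; last 2 first.
  - by rewrite sK.
  - by move=> m; rewrite inE => /orP[/eqP ->//|]; exact: hs.
  rewrite us andbT; apply/negP => nins.
  by move: ns; rewrite ltnNge (big_rem n)//= leq_maxl.
(* K blocks give K |c| / 2 <= A r K^(1/p), that is K^p <= D K, false for K > D *)
pose D := (2 * A * r / normc c) ^+ p.
have D0 : 0 <= D by apply: exprn_ge0; apply: divr_ge0; rewrite ?mulr_ge0 ?(ltW A0) ?(ltW r0) ?(ltW c0).
pose K := (Num.truncn D).+1.
have [s [us sK hs]] := sel K.
have KD : D < K%:R by exact: truncnS_gt.
have Lsum : L (\sum_(n <- s) x n) = \sum_(n <- s) L (x n) by rewrite linear_sum.
have h1 : normc (\sum_(n <- s) L (x n) - K%:R * c) <= K%:R * (normc c / 2).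
  have -> : K%:R * c = \sum_(n <- s) c.
    by rewrite big_const_seq count_predT sK iter_addr_0 mulr_natl.
  have -> : K%:R * (normc c / 2) = \sum_(n <- s) (normc c / 2) :> R.
    by rewrite big_const_seq count_predT sK iter_addr_0 mulr_natl.
  rewrite -sumrB; apply: le_trans (normc_sum _ _ _) _.
  by rewrite !big_seq; apply: ler_sum => n ns; apply/ltW/hs.
have h2 : K%:R * (normc c / 2) <= normc (\sum_(n <- s) L (x n)).
  have := normc_triangle (\sum_(n <- s) L (x n)) (K%:R * c) 0.
  rewrite !subr0 Normc.normcM normc_nat normc_dist; lra.
have h3 := hA (\sum_(n <- s) x n); rewrite Lsum in h3.
have K0 : 0 < K%:R :> R by rewrite ltr0n.
have h4 : (K%:R * (normc c / 2)) ^+ p <= (A * nrm (\sum_(n <- s) x n)) ^+ p.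
  apply: lerXn2r; rewrite ?nnegrE; last exact: le_trans h2 h3.
    by apply: mulr_ge0; rewrite ltW.
  by rewrite mulr_ge0 ?nrm_ge0 ?(ltW A0).
move: h4; rewrite [leRHS]exprMn block_sum// sK => h4.
have h5 : K%:R ^+ p <= D * K%:R.
  have cp : 0 < (normc c / 2) ^+ p by rewrite exprn_gt0.
  rewrite -(ler_pM2r cp) -exprMn; apply: le_trans h4 _.
  have -> : D * K%:R * (normc c / 2) ^+ p = K%:R * ((2 * A * r / normc c) * (normc c / 2)) ^+ p.
    by rewrite [in RHS]exprMn -/D -mulrA mulrCA.
  have -> : 2 * A * r / normc c * (normc c / 2) = A * r by field; rewrite gt_eqF.
  by rewrite exprMn; have -> : A ^+ p * (K%:R * r ^+ p) = K%:R * (A ^+ p * r ^+ p) by ring.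
have h6 : K%:R ^+ 2 <= K%:R ^+ p :> R by rewrite ler_weXn2l// ler1n.
have : K%:R <= D by rewrite -(ler_pM2r K0) -expr2 (le_trans h6).
by rewrite leNgt KD.
Qed.

(** On polynomials psi is the translate of phi by z.  Unlike [is_translate], this
    relation composes for z of any size, so it extends along the whole
    sheet. *)
Definition shifted psi z := forall m P, entire_growth m P ->
  psi (toH P) = phi (toH (fun y => P (y + z))).

Lemma shifted0 : shifted phi 0.
Proof. by move=> m P _; congr (phi (toH _)); apply/funext => y; rewrite addr0. Qed.

Lemma shifted_translate psi chi z w : is_translate psi w chi ->
  shifted psi z -> shifted chi (z + w).
Proof.
move=> tr sh m P eP; rewrite (translate_entire tr eP).
rewrite (sh m) ?(entire_growth_shift w eP)//; last exact: entire_growth_shift.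
by congr (phi (toH _)); apply/funext => y; rewrite addrA.
Qed.

Lemma shifted_translate_inv psi chi z w : is_translate psi w chi ->
  shifted chi z -> shifted psi (z - w).
Proof.
move=> tr sh m P eP.
have eP' := entire_growth_shift (- w) eP.
have -> : P = (fun y => (fun y' => P (y' - w)) (y + w)).
  by apply/funext => y; rewrite addrK.
rewrite -(translate_entire tr eP') (sh m _ eP').
by congr (phi (toH _)); apply/funext => y; rewrite addrA subrK.
Qed.

(** The characters that are shifted from phi form an open and closed set, as each is
    shifted exactly when its translates by small vectors are. *)
Lemma sheet_shifted psi : sheet phi psi -> exists z, shifted psi z.
Proof.
move=> [A [Aphi _ cA] Apsi].
pose S : set M := [set chi | exists z, shifted chi z].
have oS : open S.
  rewrite openE => chi [z sh]; apply: mb_nbhs; exists 1 => // w chi' _ tr.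
  by exists (z + w); exact: shifted_translate tr sh.
have oSC : open (~` S).
  rewrite openE => chi nS; apply: mb_nbhs; exists 1 => // w chi' _ tr [z sh].
  by apply: nS; exists (z - w); exact: shifted_translate_inv tr sh.
have SA : A `&` S = A.
  apply: cA; first by exists phi; split=> //; exists 0; exact: shifted0.
    by exists S.
  by exists S => //; rewrite -(setCK S); apply: open_closedC.
by move: Apsi; rewrite -SA => -[].
Qed.

(** For linear L, psi L = phi (L + L z) = L z as phi vanishes on linear functionals. *)
Lemma mb_pi_shifted psi z : shifted psi z -> mb_pi psi = z.
Proof.
move=> sh; pose S : set E := [set z' | forall (L : {linear E -> Cx R}) (cL : continuous L),
    psi (MkHb (hb_linear cL)) = L z'].
have Sz : S z.
  move=> L cL; rewrite toH_linear (sh 1%N _ (linear_entire cL)).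
  have hL := entire_growth_hol_bt (linear_entire cL).
  rewrite (_ : (fun y => L (y + z)) = (fun y => L y + L z)); last first.
    by apply/funext => y; rewrite linearD.
  rewrite toHD//; last exact: hol_bt_cst.
  rewrite mbD block_linear0// add0r.
  rewrite (_ : toH (fun=> L z) = L z *: (1 : H)) ?mbZ ?mb1 ?mulr1//.
  by apply: H_ext => u; rewrite toHE ?HZ ?mulr1//; exact: hol_bt_cst.
rewrite /mb_pi -/S; have Sg : S (xget 0 S) by apply: xgetPex; exists z.
apply: ell_ext => k.
by rewrite -[LHS]/(ell_coord k (xget 0 S)) -(Sg _ (@ell_coord_continuous R p hp k)) (Sz _ (@ell_coord_continuous R p hp k)).
Qed.

(** The supports of z and of the x n with n >= K are pairwise disjoint, so a single
    theta is adapted to all of them, and the diagonal polynomial takes the constant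
    value r^p + |z|^p at the x n + z. *)
Lemma shifted_radius psi z K : shifted psi z -> trunc K z = z ->
  r ^+ p + nrm z ^+ p < 1.
Proof.
move=> sh zK; have [xr xge xd] := xb.
have zk k : (K <= k)%N -> z k = 0 by move=> Kk; rewrite -zK truncE ltnNge Kk.
have phase (c : C) : exists t : C, normc t <= 1 /\ t * c ^+ p = (normc c ^+ p)%:C.
  have [->|c0] := eqVneq c 0.
    by exists 0; rewrite Normc.normc0 ler01 mul0r expr0n gtn_eqF.
  have n0 : (normc c ^+ p)%:C != 0 :> C.
    by rewrite -normc_eq0 normc_realE normr_eq0 expf_eq0 p0 normc_eq0 c0.
  exists ((normc c ^+ p)%:C / c ^+ p); split; last by rewrite mulfVK// expf_neq0.
  rewrite Normc.normcM Normc.normcV normcX normc_realE ger0_norm ?exprn_ge0 ?normc_ge0//.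
  by rewrite divff// expf_neq0// normc_eq0.
(* theta k is taken from z for k < K, and otherwise from the only block whose support
   may contain k *)
have th k : exists t : C, [/\ normc t <= 1, (k < K)%N -> t * z k ^+ p = (normc (z k) ^+ p)%:C
    & (K <= k)%N -> forall n, t * x n k ^+ p = (normc (x n k) ^+ p)%:C].
  have [kK|Kk] := ltnP k K.
    by have [t [t1 tz]] := phase (z k); exists t.
  have [[n xn]|nx] := EM (exists n, x n k != 0).
    have [t [t1 tx]] := phase (x n k); exists t; split=> // _ m.
    have [->|mn] := eqVneq m n; first exact: tx.
    have -> : x m k = 0 by apply/eqP; apply: contraNT mn => xm; apply/eqP; exact: xd xm xn.
    by rewrite Normc.normc0 !expr0n gtn_eqF// mulr0.
  exists 0; rewrite Normc.normc0; split=> // _ m.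
  have -> : x m k = 0 by apply/eqP; apply: contrapT => xm; apply: nx; exists m; apply/negP.
  by rewrite Normc.normc0 !expr0n gtn_eqF// mulr0.
have [theta hth] := choice th.
have th1 k : normc (theta k) <= 1 by have [] := hth k.
have eQ := diag_poly_entire hp th1.
have Qn n : (K <= n)%N -> diag_poly theta (x n + z) = (r ^+ p + nrm z ^+ p)%:C.
  move=> Kn; rewrite diag_poly_nrm//.
    rewrite nrm_pow_disjoint ?xr// => k.
    have [kK|Kk] := ltnP k K; last by right; exact: zk.
    left; apply/eqP; apply: contrapT => /negP/xge nk.
    by move: (leq_trans (leq_trans kK Kn) nk); rewrite ltnn.
  move=> k; rewrite ell_coordD; have [_ h1 h2] := hth k.
  have [kK|Kk] := ltnP k K; last by rewrite zk// addr0; exact: h2.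
  have -> : x n k = 0.
    apply/eqP; apply: contrapT => /negP/xge nk.
    by move: (leq_trans (leq_trans kK Kn) nk); rewrite ltnn.
  by rewrite add0r; exact: h1.
have QE : psi (toH (diag_poly theta)) = (r ^+ p + nrm z ^+ p)%:C.
  rewrite (sh _ _ eQ); apply/eqP; rewrite -subr_eq0 -normc_eq0; apply/eqP/le_anti.
  rewrite normc_ge0 andbT; apply/ler_addgt0Pr => e e0; rewrite add0r.
  have hQ := entire_growth_hol_bt (entire_growth_shift z eQ).
  have [n Kn] := ad hQ K e0.
  by rewrite (Qn n Kn) normc_dist => /ltW.
have := spectral_bound psi (entire_growth_hol_bt eQ) (fun y _ => diag_poly_bound th1 y).
rewrite QE normc_realE; apply: le_lt_trans.
exact: ler_norm.
Qed.

(** By p-additivity, |x n + trunc N z|^p <= r^p + |z|^p for n >= N, so that x n + z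
    is in tB. *)
Lemma shifted_entire_bound psi z (t0 t K : R) m P : shifted psi z ->
  r ^+ p + nrm z ^+ p <= t0 ^+ p -> 0 <= t0 -> t0 < t ->
  entire_growth m P -> (forall y, nrm y < t -> normc (P y) <= K) ->
  normc (psi (toH P)) <= K.
Proof.
move=> sh zt t00 t0t eP PK; have [xr xge xd] := xb.
have tt : 0 < t - t0 by rewrite subr_gt0.
have [N hN] := trunc_approx z tt.
rewrite (sh _ _ eP); apply/ler_addgt0Pr => e e0.
have hP := entire_growth_hol_bt (entire_growth_shift z eP).
have [n Nn hn] := ad hP N e0.
have dis : nrm (x n + trunc N z) ^+ p = nrm (x n) ^+ p + nrm (trunc N z) ^+ p.
  apply: nrm_pow_disjoint => k; rewrite truncE; case: ltnP => kN; last by right.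
  left; apply/eqP; apply: contrapT => /negP/xge nk.
  by move: (leq_trans (leq_trans kN Nn) nk); rewrite ltnn.
have h1 : nrm (x n + trunc N z) <= t0.
  apply: (@nrm_pow_inj R p hp); rewrite ?nrm_ge0//.
  by rewrite dis xr nrm_pow_trunc; apply: le_trans zt; rewrite lerD2l psum_le.
have h2 : nrm (x n + z) < t.
  have -> : x n + z = (x n + trunc N z) + (z - trunc N z) by rewrite addrACA subrr addr0.
  by apply: le_lt_trans (nrmD _ _) _; have := hN N (leqnn N); lra.
have h3 := PK _ h2.
rewrite -(subrK (P (x n + z)) (phi _)); apply: le_trans (normcD _ _) _.
by rewrite normc_dist; lra.
Qed.

End fixed_block.

(** Any character is determined by its values on polynomials: the Taylor series
    of f at 0 converges to f geometrically, uniformly on each tB, t < 1, and characters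
    are dominated by some sB. *)
Lemma taylor_partial_sums f : exists S : nat -> E -> Cx R,
  [/\ forall n, exists m, entire_growth m (S n),
      forall t : R, 0 < t < 1 -> exists K : R, forall n y, nrm y < t -> normc (S n y) <= K &
      forall psi, (fun n => psi (toH (S n))) @ \oo --> psi f].
Proof.
pose F := ext0 f; have hF : hol_bt F := hol_bt_ext0 f.
pose S n y := \sum_(i < n) taylor_coef F i y 0.
have key (t : R) : 0 < t < 1 -> exists K q : R, [/\ 0 <= K, 0 <= q < 1 &
    (forall n y, nrm y < t -> normc (F y - S n y) <= K * q ^+ n) /\
    forall y, nrm y < t -> normc (F y) <= K].
  move=> /andP[t0 t1]; pose s := (1 + t) / 2.
  have [dF bF] := hF; have [|K0 hK0] := bF s; first by apply/andP; split; rewrite /s; lra.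
  have ts : t < s by rewrite /s; lra.
  have s1 : s <= 1 by rewrite /s; lra.
  pose r := s / t; have r1 : 1 < r by rewrite ltr_pdivlMr ?mul1r.
  have K00 : 0 <= K0 by apply: le_trans (normc_ge0 _) (hK0 0 _); rewrite nrm0; lra.
  have c0 : 1 <= r / (r - 1) by rewrite ler_pdivlMr; lra.
  have r0 : 0 < r by lra.
  exists (K0 * (r / (r - 1))), r^-1; split.
  - by apply: mulr_ge0 => //; lra.
  - by rewrite invr_ge0 (ltW r0) invf_lt1.
  split=> [n y yt|y yt].
    have ry : nrm (0 : E) + r * nrm y < s.
      by rewrite nrm0 add0r /r mulrAC ltr_pdivrMr// ltr_pM2l//; lra.
    have [_ /(_ n 1)] := taylor_ball s1 dF hK0 r0 ry.
    rewrite Normc.normc1 => /(_ r1); rewrite add0r scale1r.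
    under eq_bigr do rewrite expr1n mulr1.
    by move/le_trans; apply; rewrite div1r mulrAC.
  apply: (@le_trans _ _ K0); first by apply: hK0; lra.
  by rewrite ler_peMr.
have eS n : exists m, entire_growth m (S n).
  elim: n => [|n [m IH]].
    by exists 0%N; rewrite /S; under eq_fun do rewrite big_ord0; exact: entire_growth_cst.
  exists (maxn m n); rewrite /S; under eq_fun do rewrite big_ord_recr /=.
  apply: entire_growthD; first exact: entire_growth_le (leq_maxl _ _) IH.
  apply: entire_growth_le (leq_maxr _ _) _; exact: homogeneous_component.
exists S; split=> //.
- move=> t /key[K [q [K0 /andP[q0 q1] [h1 h2]]]]; exists (K + K) => n y yt.
  have -> : S n y = F y - (F y - S n y) by rewrite opprB addrC subrK.
  apply: le_trans (normcB _ _) _; apply: lerD; first exact: h2.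
  by apply: le_trans (h1 n y yt) _; rewrite ler_piMr// exprn_ile1// ltW.
- move=> psi; have [s s01 ds] := mb_dominated psi.
  have [K [q [K0 q01 [h1 _]]]] := key _ s01.
  apply/cvgC_distn => e e0; have [N hN] := geometric_small K0 q01 e0.
  exists N => n /hN.
  apply: le_lt_trans; rewrite normc_dist -{1}(toH_ext0 f).
  apply: (@dominated_dist _ _ _ psi s) => //; first by case/andP: s01 => _ /ltW.
    by have [m] := eS n; exact: entire_growth_hol_bt.
  by move=> y ys; exact: h1.
Qed.

End block_homomorphisms.

(** * Translates of characters *)

Section translates.
Context {R : realType} {p : nat} {hp : (1 < p)%N}.
Local Notation C := R[i].
Local Notation E := (ell R hp).
Local Notation B := {x : E | `|x| < 1}.
Local Notation H := (Hb R hp).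
Local Notation M := (@Mb R p hp).
Implicit Types (f g : H) (F G P : E -> Cx R) (x y z w v : E) (psi phi chi : M).

(** F need not be of bounded type on the unit ball (typically it is a translate of
    such a function), but it is a uniform limit on sB of such functions; c
    is then the value at F of the extension of psi to these limits, when psi is
    dominated by sB. *)
Definition ev psi (s : R) F (c : Cx R) := forall e : R, 0 < e ->
  exists G, [/\ hol_bt G, forall y, nrm y < s -> normc (G y - F y) <= e &
    normc (psi (toH G) - c) <= e].

Lemma ev_self psi s F : hol_bt F -> ev psi s F (psi (toH F)).
Proof.
move=> hF e e0; exists F; split=> // [y _|]; rewrite subrr Normc.normc0; exact: ltW.
Qed.

Section dominated_by.
Variables (psi : M) (s : R).
Hypotheses (s1 : s <= 1) (ds : dominated psi s).

Lemma ev_dist F G c d (eta : R) : ev psi s F c -> ev psi s G d ->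
  (forall y, nrm y < s -> normc (F y - G y) <= eta) -> normc (c - d) <= eta.
Proof.
move=> Fc Gd FG; apply/ler_addgt0Pr => e e0.
have e4 : 0 < e / 4 by rewrite divr_gt0.
have [F' [hF' FF' Fc']] := Fc _ e4; have [G' [hG' GG' Gd']] := Gd _ e4.
have h : normc (psi (toH F') - psi (toH G')) <= eta + e / 2.
  apply: (dominated_dist s1 ds hF' hG') => y ys.
  have -> : F' y - G' y = (F' y - F y) + (F y - G y) - (G' y - G y) by ring.
  apply: le_trans (normcB _ _) _; apply: le_trans (lerD (normcD _ _) (lexx _)) _.
  have := FF' _ ys; have := GG' _ ys; have := FG _ ys; lra.
apply: le_trans (normc_triangle (psi (toH F')) _ _) _.
have := normc_triangle (psi (toH G')) (psi (toH F')) d.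
rewrite (normc_dist c); lra.
Qed.

Lemma ev_uniq F c d : ev psi s F c -> ev psi s F d -> c = d.
Proof.
move=> Fc Fd; apply/eqP; rewrite -subr_eq0 -normc_eq0; apply/eqP/le_anti.
rewrite normc_ge0 andbT; apply: (ev_dist Fc Fd) => y _.
by rewrite subrr Normc.normc0.
Qed.

Lemma ev_linear (a : C) F G c d : ev psi s F c -> ev psi s G d ->
  ev psi s (fun y => a * F y + G y) (a * c + d).
Proof.
move=> Fc Gd e e0; have a1 : 0 < normc a + 1 by rewrite ltr_wpDl ?normc_ge0.
have e1 : 0 < e / (normc a + 1) by exact: divr_gt0.
have [F' [hF' FF' Fc']] := Fc _ e1; have [G' [hG' GG' Gd']] := Gd _ e1.
have haF : hol_bt (fun y => a * F' y) by exact: hol_btZ.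
have key (u u' t t' : C) : normc (u - u') <= e / (normc a + 1) ->
    normc (t - t') <= e / (normc a + 1) -> normc (a * u + t - (a * u' + t')) <= e.
  move=> uu tt; have -> : a * u + t - (a * u' + t') = a * (u - u') + (t - t') by ring.
  apply: le_trans (normcD _ _) _; rewrite Normc.normcM.
  have -> : e = normc a * (e / (normc a + 1)) + e / (normc a + 1).
    by field; rewrite gt_eqF.
  by apply: lerD => //; rewrite ler_wpM2l ?normc_ge0.
exists (fun y => a * F' y + G' y); split.
- exact: hol_btD.
- by move=> y ys; apply: key; [exact: FF'|exact: GG'].
- rewrite (@toHD _ _ _ (fun y => a * F' y)) ?toHZ// mbD mbZ.
  by apply: key.
Qed.

Lemma ev_mul F G c d (K : R) : ev psi s F c -> ev psi s G d ->
  (forall y, nrm y < s -> normc (F y) <= K /\ normc (G y) <= K) ->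
  ev psi s (fun y => F y * G y) (c * d).
Proof.
move=> Fc Gd FK e e0.
pose D := `|K| + normc c + normc d + 1.
have K0 := normr_ge0 K; have KK := ler_norm K.
have nc := normc_ge0 c; have nd := normc_ge0 d.
have D1 : 1 <= D by rewrite /D; lra.
pose e1 := Num.min 1 (e / (3 * D)).
have e10 : 0 < e1 by rewrite lt_min ltr01 divr_gt0//; lra.
have e11 : e1 <= 1 by rewrite ge_min lexx.
have e1e : e1 * (3 * D) <= e.
  have : e1 <= e / (3 * D) by rewrite ge_min lexx orbT.
  by rewrite ler_pdivlMr//; lra.
have [F' [hF' FF' Fc']] := Fc _ e10; have [G' [hG' GG' Gd']] := Gd _ e10.
have key (u u' t t' : C) : normc u' <= D -> normc t' <= D -> normc (u - u') <= e1 ->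
    normc (t - t') <= e1 -> normc (u * t - u' * t') <= e.
  move=> uD tD uu tt.
  have -> : u * t - u' * t' = (u - u') * (t - t') + u' * (t - t') + (u - u') * t' by ring.
  apply: le_trans (normcD _ _) _; apply: le_trans (lerD (normcD _ _) (lexx _)) _.
  rewrite !Normc.normcM.
  have h1 : normc (u - u') * normc (t - t') <= e1 * D.
    by apply: ler_pM; rewrite ?normc_ge0//; lra.
  have h2 : normc u' * normc (t - t') <= D * e1 by apply: ler_pM; rewrite ?normc_ge0.
  have h3 : normc (u - u') * normc t' <= e1 * D by apply: ler_pM; rewrite ?normc_ge0.
  lra.
exists (fun y => F' y * G' y); split.
- exact: hol_btM.
- move=> y ys; have [FK' GK'] := FK _ ys.
  by apply: key; [rewrite /D; lra|rewrite /D; lra|exact: FF'|exact: GG'].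
- rewrite toHM// mbM; apply: key => //; rewrite /D; lra.
Qed.

End dominated_by.

(** The Taylor series of F (y + w) in w converges geometrically, uniformly for y in sB, as
    some larger multiple r w still keeps y + r w away from the sphere. *)
Lemma translate_approx F (s : R) w : 0 <= s -> s + nrm w < 1 -> hol_bt F ->
  exists K q : R, [/\ 0 <= K, 0 <= q < 1,
    forall n y, nrm y < s ->
      normc (F (y + w) - \sum_(i < n) taylor_coef F i w y) <= K * q ^+ n &
    forall y, nrm y < s -> normc (F (y + w)) <= K].
Proof.
move=> s0 sw [dF bF]; have nw := nrm_ge0 w.
pose s' := (1 + s + nrm w) / 2; pose r := 1 + (1 - s - nrm w) / 4.
have [|K0 hK0] := bF s'; first by apply/andP; split; rewrite /s'; lra.
have r1 : 1 < r by rewrite /r; lra.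
have r0 : 0 < r by lra.
have w1 : nrm w <= 1 by lra.
have rw : s + r * nrm w < s' by rewrite /r /s'; nra.
have s'1 : s' <= 1 by rewrite /s'; lra.
have K00 : 0 <= K0 by apply: le_trans (normc_ge0 _) (hK0 0 _); rewrite nrm0 /s'; lra.
have c0 : 1 <= r / (r - 1) by rewrite ler_pdivlMr; lra.
exists (K0 * (r / (r - 1))), r^-1; split.
- by apply: mulr_ge0 => //; lra.
- by rewrite invr_ge0 (ltW r0) invf_lt1.
- move=> n y ys; have yw : nrm y + r * nrm w < s' by lra.
  have [_ /(_ n 1)] := taylor_ball s'1 dF hK0 r0 yw.
  rewrite Normc.normc1 => /(_ r1); rewrite scale1r.
  under eq_bigr do rewrite expr1n mulr1.
  by move/le_trans; apply; rewrite div1r mulrAC.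
- move=> y ys; apply: (@le_trans _ _ K0); last by rewrite ler_peMr.
  by apply: hK0; apply: le_lt_trans (nrmD _ _) _; rewrite /s'; lra.
Qed.

Lemma translate_partial_sum psi f n w :
  series (fun n => psi (insubd (0 : H) (taylor_term f n w))) n =
  psi (toH (fun y => \sum_(i < n) taylor_coef (ext0 f) i w y)).
Proof.
rewrite /series /= big_mkord.
rewrite (@toH_sum _ _ _ n (fun i => taylor_coef (ext0 f) i w)); last first.
  by move=> k; exact: hol_bt_taylor_coef (hol_bt_ext0 f).
exact/esym/(@mb_sum _ _ _ psi n (fun i => toH (taylor_coef (ext0 f) i w))).
Qed.

Section translating.
Variables (psi : M) (s : R).
Hypotheses (s0 : 0 < s) (ds : dominated psi s).

(** The translate of psi by w is the composition of psi with translation by w, psi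
    being extended to uniform limits on sB. *)
Lemma ev_translateP w chi : s + nrm w < 1 ->
  is_translate psi w chi <-> forall f, ev psi s (fun y => ext0 f (y + w)) (chi f).
Proof.
move=> sw; have s1 : s <= 1 by have := nrm_ge0 w; lra.
split=> tr f; have hF := hol_bt_ext0 f;
  have [K [q [K0 q01 h _]]] := translate_approx (ltW s0) sw hF;
  have hS n := hol_bt_sum n (fun k => hol_bt_taylor_coef k w hF).
- move=> e e0; have [N hN] := geometric_small K0 q01 e0.
  have := tr f => /cvgC_distn/(_ _ e0)[N' hN'].
  pose n := maxn N N'; exists (fun y => \sum_(i < n) taylor_coef (ext0 f) i w y).
  split; first exact: hS.
    move=> y ys; rewrite normc_dist; apply: le_trans (h n y ys) _.
    by apply/ltW/hN; exact: leq_maxl.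
  by rewrite -translate_partial_sum; apply/ltW/hN'; exact: leq_maxr.
- apply/cvgC_distn => e e0; have [N hN] := geometric_small K0 q01 e0.
  exists N => n /hN; apply: le_lt_trans; rewrite translate_partial_sum normc_dist.
  apply: (ev_dist s1 ds (tr f) (ev_self psi s (hS n))) => y ys.
  exact: h.
Qed.

Lemma ev_translate_ex w f : s + nrm w < 1 ->
  exists c, ev psi s (fun y => ext0 f (y + w)) c.
Proof.
move=> sw; have s1 : s <= 1 by have := nrm_ge0 w; lra.
have hF := hol_bt_ext0 f.
have [K [q [K0 q01 h _]]] := translate_approx (ltW s0) sw hF.
have hS n := hol_bt_sum n (fun k => hol_bt_taylor_coef k w hF).
pose u n := psi (toH (fun y => \sum_(i < n) taylor_coef (ext0 f) i w y)).
have [c /cvgC_distn hc] : exists c : Cx R, u @ \oo --> c.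
  apply: cauchyC_cvg => e e0; have e2 : 0 < e / 2 by rewrite divr_gt0.
  have [N hN] := geometric_small K0 q01 e2.
  exists N => m n /hN hm /hN hn.
  apply: (@le_lt_trans _ _ (K * q ^+ m + K * q ^+ n)); last by lra.
  apply: (dominated_dist s1 ds (hS m) (hS n)) => y ys.
  apply: le_trans (normc_triangle (ext0 f (y + w)) _ _) _.
  by apply: lerD; rewrite ?(normc_dist _ (ext0 f (y + w))); exact: h.
exists c => e e0; have [N hN] := geometric_small K0 q01 e0.
have [N' hN'] := hc e e0; pose n := maxn N N'.
exists (fun y => \sum_(i < n) taylor_coef (ext0 f) i w y); split; first exact: hS.
  move=> y ys; rewrite normc_dist; apply: le_trans (h n y ys) _.
  by apply/ltW/hN; exact: leq_maxl.
by apply/ltW/hN'; exact: leq_maxr.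
Qed.

Lemma ev_translate_bound w f c (K : R) : s + nrm w < 1 ->
  ev psi s (fun y => ext0 f (y + w)) c ->
  (forall u, sball (s + nrm w) u -> normc (f u) <= K) -> normc c <= K.
Proof.
move=> sw fc fK; have s1 : s <= 1 by have := nrm_ge0 w; lra.
have e0 := ev_self psi s (hol_bt_cst (V := E) (0 : Cx R)).
rewrite toH0 mb0 in e0; rewrite -(subr0 c).
apply: (ev_dist s1 ds fc e0) => y ys; rewrite subr0.
have yw : nrm (y + w) < s + nrm w.
  by apply: le_lt_trans (nrmD _ _) _; rewrite ltrD2r.
have yw1 := lt_trans yw sw.
by rewrite (ext0_in f yw1); apply: fK; rewrite /sball /= in_ballE.
Qed.

Lemma dominated_translate w chi : s + nrm w < 1 -> is_translate psi w chi ->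
  dominated chi (s + nrm w).
Proof.
move=> sw tr f K fK; have := proj1 (ev_translateP chi sw) tr f => h.
exact: ev_translate_bound sw h fK.
Qed.

(** The values T f of the extension of psi at f (. + w) depend on f linearly and
    multiplicatively, since the extension does, and are bounded by the supremum of |f|
    over the ball of radius s + |w|. *)
Lemma translate_ex w : s + nrm w < 1 -> exists chi, is_translate psi w chi.
Proof.
move=> sw; have s1 : s <= 1 by have := nrm_ge0 w; lra.
have sw0 : 0 < s + nrm w by rewrite ltr_wpDr ?nrm_ge0.
have [T hT] := choice (fun f => ev_translate_ex f sw).
have Tlin : linear T.
  move=> a f g; apply: (ev_uniq s1 ds (hT _)).
  have := ev_linear a (hT f) (hT g).
  congr (ev psi s _ _); apply/funext => y.
  rewrite /ext0; case: insubP => [u _ _|_] //.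
  by rewrite mulr0 addr0.
have Tmul : {morph T : f g / f * g}.
  move=> f g; apply: (ev_uniq s1 ds (hT _)).
  have [K [_ [_ _ _ hK]]] := translate_approx (ltW s0) sw (hol_bt_ext0 f).
  have [L [_ [_ _ _ hL]]] := translate_approx (ltW s0) sw (hol_bt_ext0 g).
  have b y : nrm y < s -> normc (ext0 f (y + w)) <= Num.max K L /\
      normc (ext0 g (y + w)) <= Num.max K L.
    move=> ys; rewrite !le_max; split; apply/orP; [left; exact: hK|right; exact: hL].
  have := ev_mul (hT f) (hT g) b; congr (ev psi s _ _); apply/funext => y.
  rewrite /ext0; case: insubP => [u _ _|_] //.
  by rewrite mulr0.
have Tb f (K : R) : (forall u, sball (s + nrm w) u -> normc (f u) <= K) -> normc (T f) <= K.
  by move=> fK; exact: ev_translate_bound sw (hT f) fK.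
have Tcont : continuous T.
  move=> f; apply/(@cvgC_dist _ _ (nbhs (f : H)) _) => e e0.
  have e2 : 0 < e / 2 by rewrite divr_gt0.
  have sw01 : 0 < s + nrm w < 1 by rewrite sw0 sw.
  have := near_uniform_sball f sw01 e2; apply: filterS => g gf.
  have -> : T g - T f = T (g - f).
    have := Tlin (-1) f g; rewrite scaleN1r (addrC (- f)) => ->.
    by rewrite -[-1 *: T f]/((-1) * T f) mulN1r addrC.
  apply: (@le_lt_trans _ _ (e / 2)); last by lra.
  by apply: Tb => u /gf /ltW.
have T0 : T 1 != 0.
  have -> : T 1 = 1; last exact: oner_neq0.
  apply: (ev_uniq s1 ds (hT 1)).
  have := ev_self psi s (hol_bt_cst (V := E) (1 : Cx R)); rewrite toH1 mb1.
  move=> h e e0; have [G [hG G1 G2]] := h e e0; exists G; split=> // y ys.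
  have yw1 : nrm (y + w) < 1.
    by apply: lt_trans sw; apply: le_lt_trans (nrmD _ _) _; rewrite ltrD2r.
  by rewrite (ext0_in (1 : H) yw1); exact: G1.
exists (MkMb Tlin Tmul Tcont (ex_intro _ 1 T0)).
by apply/(ev_translateP _ sw) => f; exact: hT.
Qed.

(** By [ev_translateP], chi' f and the values of chi at the Taylor sums of f (. + v) are
    values of the extension of psi, at f (. + w + v) and at functions close to it. *)
Lemma translate_add w v chi chi' : s + nrm w + nrm v < 1 ->
  is_translate psi w chi -> is_translate psi (w + v) chi' -> is_translate chi v chi'.
Proof.
move=> swv tr tr'; have nv := nrm_ge0 v; have nw := nrm_ge0 w.
have sw : s + nrm w < 1 by lra.
have swv' : s + nrm (w + v) < 1 by have := nrmD w v; lra.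
have s1 : s <= 1 by lra.
pose s2 := s + nrm w.
have s20 : 0 < s2 by rewrite /s2 ltr_wpDr.
have ds2 : dominated chi s2 := dominated_translate sw tr.
have s2v : s2 + nrm v < 1 by [].
move=> f; have hF := hol_bt_ext0 f.
have [K [q [K0 q01 h _]]] := translate_approx (ltW s20) s2v hF.
have hS n := hol_bt_sum n (fun k => hol_bt_taylor_coef k v hF).
apply/cvgC_distn => e e0; have [N hN] := geometric_small K0 q01 e0.
exists N => n /hN; apply: le_lt_trans; rewrite translate_partial_sum normc_dist.
have e1 := proj1 (ev_translateP chi' swv') tr' f.
have e2 := proj1 (ev_translateP chi sw) tr (toH (fun y => \sum_(i < n) taylor_coef (ext0 f) i v y)).
apply: (ev_dist s1 ds e1 e2) => y ys.
have yw : nrm (y + w) < s2.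
  by apply: le_lt_trans (nrmD _ _) _; rewrite ltrD2r.
have yw1 : nrm (y + w) < 1 by rewrite /s2 in yw; lra.
by rewrite (ext0_in _ yw1) (toHE _ (hS n)) addrA; exact: h.
Qed.

End translating.

Lemma segment_continuous (V : normedModType R[i]) (y v : V) :
  continuous (fun t : R => y + t%:C *: v).
Proof.
move=> t; apply/cvgrPdist_lt => e /gt0_complexE[-> e0].
have v1 : 0 < nrm v + 1 by rewrite ltr_wpDl ?nrm_ge0.
apply/nbhs_ballP; exists (complex.Re e / (nrm v + 1)) => /=; first exact: divr_gt0.
move=> u; rewrite /ball /= ltr_pdivlMr// => tu.
rewrite opprD addrACA subrr add0r -scalerBl -rmorphB nrmE ltcR nrmZ normc_realE.
by apply: le_lt_trans tu; rewrite ler_wpM2l// lerDl.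
Qed.

Lemma path_component (T : topologicalType) (c : R -> T) :
  (forall t, 0 <= t <= 1 -> {for t, continuous c}) ->
  connected_component setT (c 0) (c 1).
Proof.
move=> cc; exists (c @` `[0, 1]%classic); last first.
  by exists 1 => //=; rewrite in_itv/= lexx ler01.
split=> //; first by exists 0 => //=; rewrite in_itv/= lexx ler01.
apply: connected_continuous_connected; first exact: segment_connected.
apply: continuous_in_subspaceT => t; rewrite inE /= in_itv /=; exact: cc.
Qed.

(** A basic neighbourhood of G w0 consists of translates of some phi that is dominated
    by another ball; for w close to w0, the translate of G w0 by w - w0 is
    both G w, by [translate_add] for psi, and a translate of phi, by
    [translate_add] for phi. *)
Lemma translate_continuous psi (s : R) (G : E -> M) w0 : 0 < s -> dominated psi s ->
  (\forall w \near w0, is_translate psi w (G w)) -> s + nrm w0 < 1 ->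
  {for w0, continuous G}.
Proof.
move=> s0 ds /(@nearV R E)[d d0 hG] sw0.
have FF : Filter (G @ w0) by apply: fmap_filter; exact: nbhs_filter.
apply: mb_base_cvg => U [phi [s' [e' [s'01 pr /andP[e'0 e's'] ->]]]] [z].
rewrite in_ballE => ze tr; have [s'0 s'1] := andP s'01.
have ds' : dominated phi s' := proj1 (precP phi s'0) pr.
have trw0 : is_translate psi w0 (G w0) by apply: hG; rewrite subrr nrm0.
apply/(@nearV R E).
pose m := Num.min d (Num.min (e' - nrm z) (1 - s - nrm w0)).
exists m; first by rewrite !lt_min d0 subr_gt0 ze subr_gt0; lra.
move=> w; rewrite !lt_min => /and3P[wd we ws].
pose v := w - w0; have vE : w = w0 + v by rewrite subrKC.
rewrite -/v in wd we ws.
exists (z + v); first by rewrite in_ballE; have := nrmD z v; lra.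
have zv : s' + nrm (z + v) < 1 by have := nrmD z v; lra.
have [chi hchi] := translate_ex s'0 ds' zv.
have t1 : is_translate (G w0) v chi.
  by apply: (translate_add s'0 ds' _ tr hchi); lra.
have t2 : is_translate (G w0) v (G w).
  apply: (translate_add s0 ds _ trw0); first by lra.
  by rewrite -vE; apply: hG.
by rewrite (translate_uniq t2 t1).
Qed.

End translates.

(** * The canonical extension *)

Lemma translation_continuous (K : numFieldType) (V : normedModType K) (a : V) :
  continuous (fun y : V => y - a).
Proof. by move=> y; apply: cvgB; [exact: cvg_id|exact: cvg_cst]. Qed.

Lemma nrm_continuous (R : realType) (T : topologicalType) (V : normedModType R[i])
    (h : T -> V) (t : T) :
  (forall e : R, 0 < e -> \forall y \near t, nrm (h y - h t) < e) ->
  {for t, continuous h}.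
Proof.
move=> ht; apply/cvgrPdist_lt => e /gt0_complexE[-> e0].
by have := ht _ e0; apply: filterS => y; rewrite distrC nrmE ltcR.
Qed.

Section sheets.
Context {R : realType} {p : nat} {hp : (1 < p)%N}.
Local Notation C := R[i].
Local Notation E := (ell R hp).
Local Notation H := (Hb R hp).
Local Notation M := (@Mb R p hp).
Local Notation X := (@Mb0 R p hp).
Implicit Types (f : H) (w v z : E) (psi phi chi : M) (x : X).

Lemma Mb0_block psi : X psi -> exists (r : R) (b : nat -> E) phi,
  [/\ 0 < r < 1, blocks r b, adherent b phi & sheet phi psi].
Proof.
move=> [r [phi [r01 bh sh]]]; have [r0 _] := andP r01.
by have [b [bb ad]] := block_hom_blocks r0 bh; exists r, b, phi.
Qed.

Lemma val_nbhs x (D : set M) : nbhs (val x) D -> nbhs x (\val @^-1` D : set X).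
Proof.
have valC : continuous (\val : X -> M) by exact: initial_continuous.
by move=> h; exact: (valC x D h).
Qed.

Lemma near_ball w0 (s t : R) : s + nrm w0 < t -> \forall w \near w0, s + nrm w < t.
Proof.
move=> h; apply/(@nearV R E); exists (t - s - nrm w0); first by lra.
by move=> w; have := nrmD (w - w0) w0; rewrite subrK; lra.
Qed.

(** The segment from 0 to w lifts to the path of the translates of psi. *)
Lemma sheet_translate psi chi (s : R) w : 0 < s -> dominated psi s -> s + nrm w < 1 ->
  is_translate psi w chi -> connected_component setT psi chi.
Proof.
move=> s0 ds sw tr.
have /choice[G hG] : forall w', exists chi, s + nrm w' < 1 -> is_translate psi w' chi.
  move=> w'; have [sw'|sw'] := boolP (s + nrm w' < 1); last first.
    by exists psi => sw''; case/negP: sw'.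
  by have [chi' h] := translate_ex s0 ds sw'; exists chi' => _; exact: h.
pose c (t : R) := G (0 + t%:C *: w).
have c0 : c 0 = psi.
  have tr0 : is_translate psi 0 (G 0) by apply: hG; rewrite nrm0; have := nrm_ge0 w; lra.
  by rewrite /c scale0r addr0; exact: (translate_uniq tr0 (@translate0 _ _ _ psi)).
have c1 : c 1 = chi.
  by rewrite /c scale1r add0r; exact: translate_uniq (hG w sw) tr.
rewrite -c0 -c1; apply: path_component => t /andP[t0 t1].
have tw : s + nrm (0 + t%:C *: w) < 1.
  rewrite add0r nrmZ normc_realE ger0_norm//; have := nrm_ge0 w; nra.
apply: continuous_comp; first exact: segment_continuous.
apply: (translate_continuous s0 ds) => //.
by apply: filterS (near_ball tw) => w'; exact: hG.
Qed.

(** That pi psi^w = pi psi + w is proved here through the description of the sheet by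
    [shifted]. *)
Lemma Mb0_translate psi chi (s : R) w : 0 < s -> dominated psi s -> s + nrm w < 1 ->
  is_translate psi w chi -> X psi -> X chi /\ mb_pi chi = mb_pi psi + w.
Proof.
move=> s0 ds sw tr Xpsi; split.
  have [r [phi [r01 bh sh]]] := Xpsi; exists r, phi; split=> //.
  exact: connected_component_trans sh (sheet_translate s0 ds sw tr).
have [r [b [phi [/andP[r0 r1] bb ad sh]]]] := Mb0_block Xpsi.
have [z hz] := sheet_shifted sh.
rewrite (mb_pi_shifted r0 bb ad hz); apply: (mb_pi_shifted r0 bb ad).
exact: shifted_translate tr hz.
Qed.

Lemma second_order F (s : R) : 0 < s < 1 -> @hol_bt R E F -> exists K d : R,
  [/\ 0 < d, s + d < 1 & forall v y, nrm v < d -> nrm y < s ->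
    normc (F (y + v) - F y - 'D_v F y) <= K * nrm v ^+ 2].
Proof.
move=> /andP[s0 s1] [dF bF]; pose rho := (1 - s) / 2.
have rho0 : 0 < rho by rewrite divr_gt0// subr_gt0.
have [|K hK] := bF ((1 + s) / 2); first by apply/andP; split; lra.
exists (8 * K / rho ^+ 2), (rho / 4); split; [by rewrite divr_gt0|by rewrite /rho; lra|].
move=> v y vr ys.
have inner (a : E) : nrm (a - y) < rho -> nrm a < (1 + s) / 2.
  move=> xy; rewrite -(subrK y a); apply: le_lt_trans (nrmD _ _) _.
  by move: xy; rewrite /rho; lra.
have dy : differentiable F y by apply: dF; lra.
rewrite deriveE//; apply: quadratic_remainder => //; last exact: ltW.
  by move=> a /inner xs; apply: dF; lra.
by move=> a /inner; exact: hK.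
Qed.

Lemma toH_derive_linear F psi : @hol_bt R E F ->
  linear (fun v => psi (toH ('D_v F))).
Proof.
move=> hF a u v.
have hu := hol_bt_derive u hF; have hv := hol_bt_derive v hF.
transitivity (psi (toH (fun y => a * 'D_u F y + 'D_v F y))).
  congr (psi _); apply: toH_ext => y y1.
  have dy : differentiable F y by case: hF => dF _; exact: dF.
  by rewrite !(deriveE _ dy) linearP.
by rewrite (toHD (hol_btZ a hu) hv) mbD (toHZ a hu) mbZ.
Qed.

(** The section of pi near psi sends y to the translate of psi by y - pi psi.  If chi is
    its value at y, then y + v is sent to the translate of chi by v, and the
    expansion F (. + v) = F + D_v F + O(|v|^2), uniform on the ball that
    dominates chi, passes to the values at chi. *)
Theorem canonical_ext_holomorphic f :
  dom_holomorphic (fun x => mb_pi (\val x)) (fun x => canonical_ext f (\val x)).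
Proof.
move=> x; pose q (x : X) := mb_pi (\val x).
have Xval (x' : X) : X (val x') by exact: set_valP.
have [s /andP[s0 s1] ds] := mb_dominated (val x).
pose rho := (1 - s) / 2.
have rho0 : 0 < rho by rewrite divr_gt0// subr_gt0.
have srho w : nrm w < rho -> s + nrm w < 1 by rewrite /rho; lra.
have srho2 (a b : R) : b < rho - a -> s + a + b < 1 by rewrite /rho; lra.
pose psi := val x.
have /choice[g hg] : forall y, exists x' : X, nrm (y - q x) < rho ->
    is_translate psi (y - q x) (val x').
  move=> y; have [yr|yr] := boolP (nrm (y - q x) < rho); last first.
    by exists x => yr'; case/negP: yr.
  have [chi tr] := translate_ex s0 ds (srho _ yr).
  have [Xchi _] := Mb0_translate s0 ds (srho _ yr) tr (Xval x).
  by exists (SigSub (mem_set Xchi)) => _; exact: tr.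
pose D : set M := [set chi | exists2 w, nrm w < rho & is_translate psi w chi].
pose U : set X := \val @^-1` D.
have qU x' w : nrm w < rho -> is_translate psi w (val x') -> q x' = q x + w.
  by move=> wr tr; have [] := Mb0_translate s0 ds (srho _ wr) tr (Xval x).
have valC : continuous (\val : X -> M) by exact: initial_continuous.
have ballE (y : E) : ball (q x) rho%:C y = (nrm (y - q x) < rho) :> Prop.
  by rewrite -ball_normE /= distrC in_ballE.
have gval y : nrm (y - q x) < rho -> {for y, continuous (\val \o g : E -> M)}.
  move=> yr.
  pose G w := val (g (w + q x)).
  have cG : {for (y - q x), continuous G}.
    apply: (translate_continuous s0 ds); last exact: srho.
    apply/(@nearV R E); exists (rho - nrm (y - q x)); first by rewrite subr_gt0.
    move=> w wy; have wr : nrm w < rho.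
      by have := nrmD (w - (y - q x)) (y - q x); rewrite subrK; lra.
    by have := hg (w + q x); rewrite addrK; exact.
  have -> : (\val \o g) = G \o (fun y => y - q x).
    by apply/funext => y' /=; rewrite /G subrK.
  apply: continuous_comp; last exact: cG.
  exact: translation_continuous.
have gC y : nrm (y - q x) < rho -> {for y, continuous g}.
  move=> yr A [_ [[W oW <-] Wg WA]].
  have : nbhs (val (g y)) W by exact: open_nbhs_nbhs (conj oW Wg).
  move=> /(gval y yr) h; apply: (@filterS _ (nbhs y) (nbhs_filter y) _ _ _ h) => y' Wy'.
  by apply: WA; exact: Wy'.
have qC : continuous q.
  move=> x'; apply: nrm_continuous => e e0.
  have [s' /andP[s'0 s'1] ds'] := mb_dominated (val x').
  pose d := Num.min e (1 - s').
  have d0 : 0 < d by rewrite lt_min e0 subr_gt0.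
  pose D' : set M := [set chi | exists2 w, nrm w < d & is_translate (val x') w chi].
  have h1 : nbhs (val x') D'.
    by apply: mb_nbhs; exists d; [exact: d0|move=> z chi zd tr; exists z].
  apply: (@filterS _ (nbhs x') (nbhs_filter x') _ _ _ (val_nbhs h1)) => x'' [w].
  rewrite lt_min => /andP[we ws] tr.
  have sw : s' + nrm w < 1 by lra.
  have [_ qE] := Mb0_translate s'0 ds' sw tr (Xval x').
  by rewrite /q qE addrAC subrr add0r.
exists rho, U, g; split=> //.
- have h1 : nbhs (val x) D.
    by apply: mb_nbhs; exists rho; [exact: rho0|move=> z chi zd tr; exists z].
  exact: val_nbhs h1.
- split.
  + apply/seteqP; split=> [_ [x' [w wr tr] <-]|y].
      by rewrite -/(q x') ballE (qU x' w wr tr) addrAC subrr add0r.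
    rewrite ballE => yr; exists (g y); first by exists (y - q x) => //; exact: hg.
    by rewrite -/(q (g y)) (qU _ _ yr (hg y yr)) subrKC.
  + move=> x' [w wr tr]; apply: val_inj.
    have E1 : mb_pi (\val x') - q x = w.
      by rewrite -/(q x') (qU _ _ wr tr) addrAC subrr add0r.
    have := hg (mb_pi (\val x')); rewrite E1 => /(_ wr) tr'.
    exact: translate_uniq tr' tr.
  + exact: continuous_subspaceT.
  + apply: continuous_in_subspaceT => y; rewrite inE ballE; exact: gC.
move=> y; rewrite ballE => yr.
set F := ext0 f; have hF : hol_bt F := hol_bt_ext0 f.
pose chi := val (g y).
have [t t01 dt] := mb_dominated chi; have [t0 t1] := andP t01.
have [K [d [d0 td hK]]] := second_order t01 hF.
have [|N hN] := (proj2 hF) (t + d); first by apply/andP; split; lra.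
pose d' := Num.min d (rho - nrm (y - q x)).
have d'0 : 0 < d' by rewrite lt_min d0 subr_gt0.
have trv v : nrm v < d' -> nrm v < d /\ is_translate chi v (val (g (y + v))).
  rewrite lt_min => /andP[vd vr]; split=> //.
  have yvr : nrm (y + v - q x) < rho.
    by rewrite addrAC; apply: le_lt_trans (nrmD _ _) _; rewrite -ltrBrDl.
  have yvE : y - q x + v = y + v - q x by rewrite addrAC.
  apply: (translate_add s0 ds _ (hg y yr)); last by rewrite yvE; exact: hg.
  exact: srho2 vr.
apply: (@quadratic_diff R E _ y (fun v => chi (toH ('D_v F))) d' K N).
- exact: toH_derive_linear.
- exact: d'0.
- move=> v /trv[vd tr].
  have dg : dominated (val (g (y + v))) (t + nrm v).
    by apply: (dominated_translate t0 dt) => //; lra.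
  apply: dg => u; rewrite /sball /= in_ballE => us.
  by rewrite -(ext0_val f u); apply: hN; lra.
- move=> v /trv[vd tr].
  have tv : t + nrm v < 1 by lra.
  have e1 := proj1 (ev_translateP t0 dt (val (g (y + v))) tv) tr f.
  have hD := hol_bt_derive v hF.
  have e2 := ev_self chi t (hol_btD hF hD).
  rewrite (toHD hF hD) mbD toH_ext0 in e2.
  have := ev_dist (ltW t1) dt e1 e2 (eta := K * nrm v ^+ 2).
  rewrite opprD addrA; apply=> z zt.
  by rewrite opprD addrA; exact: hK.
Qed.

(** A ball onto which pi is a homeomorphism lifts the segment from pi x to
    pi x + v, hence reaches points of the same sheet. *)
Lemma homeo_sheet (x : X) (rho : R) (U : set X) (g : E -> X) v :
  let q := fun x : X => mb_pi (\val x) in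
  0 < rho -> nbhs x U -> homeo_onto q U (ball (q x) rho%:C) g -> nrm v < rho ->
  connected_component setT (val x) (val (g (q x + v))) /\ q (g (q x + v)) = q x + v.
Proof.
move=> q rho0 nU [qU gq _ cg] vr.
have Ux : U x by exact: nbhs_singleton nU.
have inb (t : R) : 0 <= t <= 1 -> ball (q x) rho%:C (q x + t%:C *: v).
  move=> /andP[t0 t1]; rewrite -ball_normE /= opprD addrA subrr add0r normrN in_ballE.
  rewrite nrmZ normc_realE ger0_norm//; have := nrm_ge0 v; nra.
have valC : continuous (\val : X -> M) by exact: initial_continuous.
pose c (t : R) := val (g (q x + t%:C *: v)).
have c0 : c 0 = val x by rewrite /c scale0r addr0 gq.
have c1 : c 1 = val (g (q x + v)) by rewrite /c scale1r.
split; last first.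
  have := inb 1; rewrite ler01 lexx scale1r => /(_ isT).
  by rewrite -qU => -[x' Ux' <-]; rewrite gq.
rewrite -c0 -c1; apply: path_component => t t01.
have ob : open (ball (q x) rho%:C) by apply: ball_open; rewrite ltcR.
move: cg; rewrite continuous_open_subspace// => cg.
have cgt : {for q x + t%:C *: v, continuous g} by apply: cg; rewrite inE; exact: inb.
apply: (@continuous_comp _ _ _ (fun t : R => g (q x + t%:C *: v)) \val); last exact: valC.
apply: (@continuous_comp _ _ _ (fun t : R => q x + t%:C *: v) g); last exact: cgt.
exact: segment_continuous.
Qed.

(** The character over trunc K z + delta e_K is on the same sheet, because this point is
    at distance less than rho from z for large K.  Its norm to the power p
    is psum K z + delta^p. *)
Lemma dist_radius (x : X) (delta r : R) (b : nat -> E) phi z : 0 < r -> blocks r b ->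
  adherent b phi -> sheet phi (val x) -> shifted phi (val x) z -> 0 < delta ->
  (delta%:E < dist_dom (fun x : X => mb_pi (\val x)) x)%E ->
  r ^+ p + nrm z ^+ p <= 1 - delta ^+ p.
Proof.
move=> r0 bb ad sh sz d0 /ereal_sup_gt[_ [rho [rho0 [U [g [nU hg]]]] <-]].
rewrite lte_fin => drho.
have qx : mb_pi (\val x) = z := mb_pi_shifted r0 bb ad sz.
have p0 : (0 < p)%N by exact: ltnW.
have rd : 0 < rho - delta by rewrite subr_gt0.
have [N hN] := trunc_approx z rd.
have key K : (N <= K)%N -> r ^+ p + (psum K z + delta ^+ p) < 1.
  move=> NK; pose u : E := delta%:C *: ell_basis hp K.
  have nu : nrm u = delta by rewrite nrmZ nrm_basis mulr1 normc_realE gtr0_norm.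
  pose z' := trunc K z + u; pose v := z' - z.
  have vr : nrm v < rho.
    have -> : v = u - (z - trunc K z) by rewrite /v /z' opprB addrCA addrA.
    by have := nrmB u (z - trunc K z); have := hN K NK; lra.
  have [cc qg] := homeo_sheet rho0 nU hg vr.
  rewrite /= qx /v subrKC in cc qg.
  have sh' : sheet phi (val (g z')) := connected_component_trans sh cc.
  have [z'' sz''] := sheet_shifted sh'.
  have zz : z'' = z' by rewrite -(mb_pi_shifted r0 bb ad sz'').
  rewrite zz in sz''.
  have tz' : trunc K.+1 z' = z'.
    apply: ell_ext => k; rewrite truncE; case: ltnP => // Kk.
    by rewrite ell_coordD truncE ltnNge (ltnW Kk) ell_coordZ ell_basisE gtn_eqF// mulr0 addr0.
  have := shifted_radius bb ad sz'' tz'.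
  rewrite nrm_pow_disjoint ?nu ?nrm_pow_trunc// => k.
  rewrite truncE; case: ltnP => kK; last by left.
  by right; rewrite ell_coordZ ell_basisE ltn_eqF// mulr0.
suff : nrm z ^+ p <= 1 - delta ^+ p - r ^+ p by lra.
apply: nrm_pow_le => n.
have h1 := key (maxn N n) (leq_maxl _ _).
have h2 : psum n z <= psum (maxn N n) z.
  rewrite /psum -(subnKC (leq_maxr N n)) big_split_ord /= lerDl.
  by apply: sumr_ge0 => i _; rewrite exprn_ge0 ?normc_ge0.
lra.
Qed.

(** A lower bound delta of the distance gives t0^p = 1 - delta^p, and any t between t0
    and 1 serves for all points of A, by [shifted_entire_bound]. *)
Theorem canonical_ext_bounded f (A : set X) :
  dom_bounded (fun x => mb_pi (\val x)) A ->
  bounded_set ((fun x => canonical_ext f (\val x)) @` A).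
Proof.
move=> [_ dA]; have p0 : (0 < p)%N by exact: ltnW.
have [delta d0 hdelta] : exists2 delta : R, 0 < delta & forall x, A x ->
    (delta%:E < dist_dom (fun x : X => mb_pi (\val x)) x)%E.
  set I := ereal_inf _ in dA.
  have [d d0 dI] : exists2 d : R, 0 < d & (d%:E < I)%E.
    case: I dA => [a||] //=; last by move=> _; exists 1 => //; exact: ltry.
    by rewrite lte_fin => a0; exists (a / 2); [exact: divr_gt0|rewrite lte_fin; lra].
  exists d => // x Ax; apply: lt_le_trans dI _.
  by apply: ereal_inf_lbound; exists x.
pose delta1 := Num.min delta (1 / 2).
have d10 : 0 < delta1 by rewrite lt_min d0 divr_gt0.
have d11 : delta1 < 1 by apply: (@le_lt_trans _ _ (1 / 2)); [rewrite ge_min lexx orbT|lra].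
pose T := 1 - delta1 ^+ p.
have dp0 : 0 < delta1 ^+ p by rewrite exprn_gt0.
have dp1 : delta1 ^+ p < 1 by rewrite exprn_ilt1 ?(ltW d10)// -lt0n.
have T0 : 0 <= T by rewrite subr_ge0 ltW.
pose t0 := T `^ (p%:R^-1).
have pR : p%:R != 0 :> R by rewrite pnatr_eq0 -lt0n.
have t00 : 0 <= t0 by exact: powR_ge0.
have t0p : t0 ^+ p = T by rewrite -powR_mulrn// -powRrM mulVf// powRr1.
have t01 : t0 < 1.
  rewrite -(ltr_pXn2r p0) ?nnegrE// t0p expr1n /T; lra.
pose t := (1 + t0) / 2.
have t01' : 0 < t < 1 by apply/andP; split; rewrite /t; lra.
have t0t : t0 < t by rewrite /t; lra.
have [S [eS bS cS]] := taylor_partial_sums f.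
have [K hK] := bS t t01'.
apply/bounded_imageP; exists K => x Ax.
have [r [b [phi [/andP[r0 r1] bb ad sh]]]] := Mb0_block (set_valP x).
have [z sz] := sheet_shifted sh.
have dx : (delta1%:E < dist_dom (fun x : X => mb_pi (\val x)) x)%E.
  by apply: le_lt_trans (hdelta x Ax); rewrite lee_fin ge_min lexx.
have rz := dist_radius r0 bb ad sh sz d10 dx.
apply: cvgC_normc_le (cS (val x)) _; apply: nearW => n.
have [m eSn] := eS n.
by apply: (shifted_entire_bound bb ad sz _ t00 t0t eSn (hK n)); rewrite t0p.
Qed.

End sheets.

Theorem proposition5p5 (R : realType) (p : nat) (hp : (1 < p)%N)
    (f : Hb R hp) :
  bounded_type (fun phi : @Mb0 R p hp => mb_pi (\val phi))
    (fun phi : @Mb0 R p hp => canonical_ext f (\val phi)).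
Proof.
split; first exact: canonical_ext_holomorphic.
by move=> A; exact: canonical_ext_bounded.
Qed.
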